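(* Let $P$ be a polynomial on $\mathbb{R}^d$ and let $\widetilde T_1$ be the closed operator on $L^1(\mathbb{R}^d)$ with domain $D_{\widetilde T_1}=\{f\in L^1(\mathbb{R}^d):P(\partial)f\in L^1(\mathbb{R}^d)\}$, given by $\widetilde T_1 f=P(\partial)f$. Then $\widetilde T_1$ has the single-valued extension property (SVEP). Furthermore, if $f\in\mathcal{S}(\mathbb{R}^d)\subseteq D_{\widetilde T_1}$, then $$\sigma_{\widetilde T_1}(f)=\overline{\{P(i\lambda):\lambda\in\operatorname{supp}\mathcal{F}f\}}.$$ Hence, for all $f\in\mathcal{S}(\mathbb{R}^d)$, the local spectral radius formula $$\lim_{n\to\infty}\|\widetilde T_1^n f\|_1^{1/n}=\sup\{|z|:z\in\sigma_{\widetilde T_1}(f)\}$$ is valid in the extended positive real numbers.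
   Context: Polynomials have complex coefficients; $P(\partial)$ is the constant coefficient differential operator with $P(\partial)e^{i\lambda\cdot x}=P(i\lambda)e^{i\lambda\cdot x}$, acting on $L^1(\mathbb{R}^d)$ in the sense of distributions. $\mathcal{S}(\mathbb{R}^d)$ is the Schwartz space, and $\mathcal{F}f(\lambda)=(2\pi)^{-d/2}\int_{\mathbb{R}^d}f(x)e^{-i\lambda\cdot x}\,dx$. The extended positive real numbers are $[0,\infty]$, and the supremum over the empty set (case $f=0$) is $0$. A bar over a subset of $\mathbb{C}$ denotes closure. For a closed operator $T$ with domain $D_T$ in a Banach space $X$ and $x\in X$: $z_0\in\mathbb{C}$ is in the local resolvent set $\rho_T(x)$ of $T$ at $x$ if there are an open neighborhood $U$ of $z_0$ in $\mathbb{C}$ and an analytic function $\phi:U\to X$, $z\mapsto\phi_z$, with $\phi_z\in D_T$ and $(T-z)\phi_z=x$ for all $z\in U$; the local spectrum is $\sigma_T(x)=\mathbb{C}\setminus\rho_T(x)$. $T$ has SVEP if, for every non-empty open $U\subset\mathbb{C}$, the only analytic $\phi:U\to X$ with $\phi_z\in D_T$ and $(T-z)\phi_z=0$ for all $z\in U$ is the zero function. *)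

(* Defs.v *)
From HB Require Import structures.
From mathcomp Require Import all_boot all_order all_algebra.
From mathcomp Require Import all_classical all_reals all_analysis.
From mathcomp Require Import measurable_realfun complex.
From mathcomp Require mpoly.

Set Implicit Arguments.
Unset Strict Implicit.
Unset Printing Implicit Defensive.

Import Order.TTheory GRing.Theory Num.Theory.
Import numFieldNormedType.Exports.

Local Open Scope classical_set_scope.
Local Open Scope ring_scope.

(* R[i] as a normed space over itself. The norm of a normed space over R[i] *)
(* takes its values in R[i]; [modulus] is the same norm as an element of R. *)
Notation "''C[' R ]" := ((complex R)^o) (at level 8, format "''C[' R ]").

Definition modulus (R : realType) (V : normedModType R[i]) (v : V) : R :=
  complex.Re `|v|.

Definition rV_display : measure_display -> measure_display.
Proof. exact. Qed.

Section rV_measurable.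
Context (R : realType) (d : nat).

Let coords (i : 'I_d) (x : 'rV[R]_d) : measurableTypeR R := x ord0 i.

Let rV_set0 : g_sigma_preimage coords set0.
Proof. exact: sigma_algebra0. Qed.

Let rV_setC A : g_sigma_preimage coords A -> g_sigma_preimage coords (~` A).
Proof. exact: sigma_algebraC. Qed.

Let rV_bigcup (F : _^nat) : (forall i, g_sigma_preimage coords (F i)) ->
  g_sigma_preimage coords (\bigcup_i F i).
Proof. exact: sigma_algebra_bigcup. Qed.

(* the product sigma-algebra, i.e. the Borel sigma-algebra of R^d *)
HB.instance Definition _ := @isMeasurable.Build (rV_display default_measure_display)
  'rV[R]_d (g_sigma_preimage coords) rV_set0 rV_setC rV_bigcup.

Lemma measurable_coord (i : 'I_d) :
  measurable_fun [set: 'rV[R]_d] (fun x => x ord0 i : measurableTypeR R).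
Proof.
move=> _ Y mY; rewrite setTI; apply: sub_sigma_algebra => /=.
rewrite -bigcup_seq/=; exists i => /=; first by rewrite mem_index_enum.
by exists Y => //; rewrite setTI.
Qed.

Lemma measurable_fun_coordP d1 (T : measurableType d1) (f : T -> 'rV[R]_d) :
  (forall i, measurable_fun [set: T] (fun x => f x ord0 i : measurableTypeR R)) ->
  measurable_fun [set: T] f.
Proof.
move=> mf.
have key : g_sigma_preimage (fun i => coords i \o f) `<=` measurable.
  apply: smallest_sub; first exact: sigma_algebra_measurable.
  rewrite -bigcup_seq; apply: bigcup_sub => i _ A [B mB <-].
  exact: mf.
move=> _ A mA; rewrite setTI; apply: key.
by rewrite g_sigma_preimage_comp; exists A => //; rewrite setTI.
Qed.

End rV_measurable.

Section lebesgue_rV.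
Context (R : realType).

Definition rV_cons d (p : measurableTypeR R * 'rV[R]_d) : 'rV[R]_d.+1 :=
  \row_i oapp (p.2 ord0) p.1 (unlift ord0 i).

Definition rV_uncons d (x : 'rV[R]_d.+1) : measurableTypeR R * 'rV[R]_d :=
  (x ord0 ord0, \row_i x ord0 (lift ord0 i)).

Lemma rV_consK d : cancel (@rV_cons d) (@rV_uncons d).
Proof.
move=> [a y]; rewrite /rV_uncons mxE unlift_none/=; congr pair.
by apply/rowP => i; rewrite !mxE liftK.
Qed.

Lemma measurable_rV_cons d : measurable_fun [set: _] (@rV_cons d).
Proof.
apply: measurable_fun_coordP => i.
case: (unliftP ord0 i) => [j ->|->].
  rewrite (_ : (fun _ => _) = (fun y : 'rV[R]_d => y ord0 j) \o snd).
    exact: measurableT_comp (@measurable_coord R d j) measurable_snd.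
  by apply/funext => p /=; rewrite mxE liftK.
rewrite (_ : (fun _ => _) = fst); first exact: measurable_fst.
by apply/funext => p /=; rewrite mxE unlift_none.
Qed.

Lemma measurable_rV_uncons d : measurable_fun [set: _] (@rV_uncons d).
Proof.
apply: measurable_fun_pair; first exact: measurable_coord.
apply: measurable_fun_coordP => i.
rewrite (_ : (fun _ => _) =
  (fun x : 'rV[R]_d.+1 => x ord0 (lift ord0 i) : measurableTypeR R)).
  exact: measurable_coord.
by apply/funext => x; rewrite mxE.
Qed.

Section succ.
Context (d : nat).
Variable mu : {sigma_finite_measure set 'rV[R]_d -> \bar R}.

Definition lebesgue_rV_succ : set 'rV[R]_d.+1 -> \bar R :=
  pushforward (@lebesgue_measure R \x mu)%E (@rV_cons d).

Let succ0 : lebesgue_rV_succ set0 = 0%E.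
Proof. by rewrite /lebesgue_rV_succ /pushforward preimage_set0 measure0. Qed.

Let succ_ge0 A : (0 <= lebesgue_rV_succ A)%E.
Proof. by rewrite /lebesgue_rV_succ /pushforward measure_ge0. Qed.

Let succ_sigma_additive : semi_sigma_additive lebesgue_rV_succ.
Proof.
rewrite /lebesgue_rV_succ.
by apply: measure_semi_sigma_additive; exact: measurable_rV_cons.
Qed.

HB.instance Definition _ := isMeasure.Build _ _ _ lebesgue_rV_succ
  succ0 succ_ge0 succ_sigma_additive.

Let sigma_finite_succ : sigma_finite setT lebesgue_rV_succ.
Proof.
pose leb : {sigma_finite_measure set _ -> \bar R} := @lebesgue_measure R.
have /sigma_finiteP[F [TF ndF Foo]] := sigma_finiteT leb.
have /sigma_finiteP[G [TG ndG Goo]] := sigma_finiteT mu.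
exists (fun n => @rV_uncons d @^-1` (F n `*` G n)).
  apply/seteqP; split=> // x _.
  have [n _ Fx] : (\bigcup_n F n) (rV_uncons x).1 by rewrite -TF.
  have [m _ Gx] : (\bigcup_n G n) (rV_uncons x).2 by rewrite -TG.
  exists (maxn n m) => //; split.
    by move: Fx; exact/subsetPset/ndF/leq_maxl.
  by move: Gx; exact/subsetPset/ndG/leq_maxr.
move=> k; have [mF Fk] := Foo k; have [mG Gk] := Goo k; split.
  rewrite -[X in measurable X]setTI; apply: measurable_rV_uncons => //.
  exact: measurableX.
rewrite /lebesgue_rV_succ /pushforward -comp_preimage.
rewrite (_ : _ \o _ = id); last by apply/funext => x; exact: rV_consK.
by rewrite preimage_id product_measure1E// lte_mul_pinfty// ge0_fin_numE.
Qed.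

HB.instance Definition _ :=
  Measure_isSigmaFinite.Build _ _ _ lebesgue_rV_succ sigma_finite_succ.

End succ.

Fixpoint lebesgue_rV (d : nat) : {sigma_finite_measure set 'rV[R]_d -> \bar R} :=
  match d with
  | 0 => \d_(0 : 'rV[R]_0)
  | d'.+1 => lebesgue_rV_succ (lebesgue_rV d')
  end.

End lebesgue_rV.

Section complex_integral.
Context d (T : measurableType d) (R : realType).
Variable mu : {measure set T -> \bar R}.

Definition cintegrable (f : T -> 'C[R]) : Prop :=
  mu.-integrable setT (fun x => (complex.Re (f x))%:E) /\
  mu.-integrable setT (fun x => (complex.Im (f x))%:E).

Definition cintegral (f : T -> 'C[R]) : 'C[R] :=
  Complex (\int[mu]_x complex.Re (f x)) (\int[mu]_x complex.Im (f x)).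

End complex_integral.

Section L1fun.
Context d (T : measurableType d) (R : realType).
Variable mu : {measure set T -> \bar R}.

Let L1fun_normE (f : T -> 'C[R]) x :
  modulus (f x) = Num.sqrt (complex.Re (f x) ^+ 2 + complex.Im (f x) ^+ 2).
Proof. by rewrite /modulus normc_def. Qed.

Lemma modulus_ge0 (V : normedModType R[i]) (v : V) : 0 <= modulus v.
Proof.
by rewrite /modulus; have := normr_ge0 v; rewrite lecE => /andP[_].
Qed.

Lemma modulusE (V : normedModType R[i]) (v : V) : (modulus v)%:C%C = `|v|.
Proof.
rewrite /modulus; have := normr_ge0 v; rewrite lecE => /andP[/eqP im _].
by case: `|v| im => a b /= ->.
Qed.

Lemma modulusD (V : normedModType R[i]) (v w : V) :
  modulus (v + w) <= modulus v + modulus w.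
Proof. by rewrite -lecR rmorphD/= !modulusE ler_normD. Qed.

Lemma modulusZ (V : normedModType R[i]) (a : R[i]) (v : V) :
  modulus (a *: v) = modulus (a : 'C[R]) * modulus v.
Proof.
apply: complexI; rewrite rmorphM/= !modulusE normrZ; congr (_ * _).
Qed.

Lemma measurable_modulus (f : T -> 'C[R]) : cintegrable mu f ->
  measurable_fun setT (fun x => modulus (f x)).
Proof.
move=> [/integrableP[/measurable_EFinP mRe _] /integrableP[/measurable_EFinP mIm _]].
under eq_fun do rewrite L1fun_normE.
apply: (measurableT_comp (continuous_measurable_fun (@sqrt_continuous R))).
by apply: measurable_funD; exact: measurable_funX.
Qed.

Lemma integrable_modulus (f : T -> 'C[R]) : cintegrable mu f ->
  mu.-integrable setT (fun x => (modulus (f x))%:E).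
Proof.
move=> If; have [IRe IIm] := If.
have := integrableD measurableT (integrable_abse IRe) (integrable_abse IIm).
apply: le_integrable => //; first exact/measurable_EFinP/measurable_modulus.
move=> x _ /=; rewrite lee_fin (ger0_norm (modulus_ge0 _)) L1fun_normE.
rewrite (ger0_norm (addr_ge0 _ _))//.
rewrite -(@ler_pXn2r _ 2%N) ?nnegrE ?sqrtr_ge0 ?addr_ge0//.
rewrite sqr_sqrtr ?addr_ge0 ?sqr_ge0// sqrrD !real_normK ?num_real//.
by rewrite addrAC lerDl mulrn_wge0// mulr_ge0.
Qed.

Lemma cintegrable_submod_closed :
  submod_closed (mem [set f | cintegrable mu f] : {pred (T -> 'C[R])}).
Proof.
split=> [|a f g].
  by rewrite inE; split; exact: integrable0.
rewrite !inE => -[fR fI] [gR gI].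
have Z (k : R) (u : T -> R) : mu.-integrable setT (fun x => (u x)%:E) ->
    mu.-integrable setT (fun x => (k * u x)%:E).
  by move=> /(integrableZl measurableT k).
have D (u v : T -> R) : mu.-integrable setT (fun x => (u x)%:E) ->
    mu.-integrable setT (fun x => (v x)%:E) ->
    mu.-integrable setT (fun x => (u x + v x)%:E).
  by move=> Iu Iv; have := integrableD measurableT Iu Iv.
split.
  rewrite (_ : (fun _ => _) = fun x => ((complex.Re a * complex.Re (f x) +
    - complex.Im a * complex.Im (f x)) + complex.Re (g x))%:E).
    by apply: (D _ _) => //; apply: (D _ _); exact: (Z _ _).
  apply/funext => x; rewrite !fctE; congr EFin.
  by rewrite /GRing.scale/=; case: a (f x) (g x) => [? ?] [? ?] [? ?] /=; rewrite mulNr.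
rewrite (_ : (fun _ => _) = fun x => ((complex.Re a * complex.Im (f x) +
  complex.Im a * complex.Re (f x)) + complex.Im (g x))%:E).
  by apply: (D _ _) => //; apply: (D _ _); exact: (Z _ _).
apply/funext => x; rewrite !fctE; congr EFin.
by rewrite /GRing.scale/=; case: a (f x) (g x) => [? ?] [? ?] [? ?] /=.
Qed.

Definition L1fun : {pred (T -> 'C[R])} := mem [set f | cintegrable mu f].

HB.instance Definition _ :=
  GRing.isSubmodClosed.Build _ _ L1fun cintegrable_submod_closed.

(* integrable functions, not yet identified almost everywhere *)
Record L1pre := MkL1pre { L1pre_fun :> T -> 'C[R] ; _ : L1pre_fun \in L1fun }.

HB.instance Definition _ := [isSub for L1pre_fun].
HB.instance Definition _ := [Choice of L1pre by <:].
HB.instance Definition _ := [SubChoice_isSubLmodule of L1pre by <:].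

Lemma L1preP (f : L1pre) : cintegrable mu f.
Proof. by case: f => f /=; rewrite inE. Qed.

Definition L1null : {pred L1pre} :=
  mem [set f : L1pre | {ae mu, forall x, f x = 0}].

Lemma L1null_submod_closed : submod_closed L1null.
Proof.
split=> [|a f g]; rewrite !inE; first exact: aeW.
apply: filterS2 => x f0 g0.
by change (a *: f x + g x = 0); rewrite f0 g0 scaler0 addr0.
Qed.

HB.instance Definition _ :=
  GRing.isSubmodClosed.Build _ _ L1null L1null_submod_closed.

End L1fun.

Section L1.
Context d (T : measurableType d) (R : realType).
Variable mu : {measure set T -> \bar R}.
Local Open Scope quotient_scope.

Definition L1 : Type := Quotient.quot (@L1null _ _ _ mu).
HB.instance Definition _ := GRing.Zmodule.on L1.
HB.instance Definition _ : EqQuotient _ _ L1 := EqQuotient.on L1.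

Implicit Types (f g : L1pre mu) (x y : L1) (a : R[i]).

Definition L1_class : L1pre mu -> L1 := \pi_L1.

Lemma L1_classE f g : L1_class f = L1_class g <-> {ae mu, forall t, f t = g t}.
Proof.
rewrite /L1_class; split.
  move/eqmodP; rewrite /= /Quotient.equiv inE.
  by apply: filterS => t /eqP; rewrite subr_eq0 => /eqP.
move=> fg; apply/eqmodP; rewrite /= /Quotient.equiv inE.
apply: filterS fg => t fgt; apply/eqP.
by change (f t - g t == 0); rewrite subr_eq0 fgt.
Qed.

Lemma L1_class_repr x : L1_class (repr x) = x.
Proof. exact: reprK. Qed.

Lemma repr_L1_class f : {ae mu, forall t, repr (L1_class f) t = f t}.
Proof. exact/L1_classE/L1_class_repr. Qed.

Lemma L1_classD f g : L1_class (f + g) = L1_class f + L1_class g.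
Proof. exact: raddfD. Qed.

Definition L1_scale a x : L1 := L1_class (a *: repr x).

Lemma L1_classZ a f : L1_class (a *: f) = L1_scale a (L1_class f).
Proof.
apply/L1_classE; apply: filterS (repr_L1_class f) => t ft.
by change (a *: f t = a *: repr (L1_class f) t); rewrite ft.
Qed.

Let L1_scaleA a b x : L1_scale a (L1_scale b x) = L1_scale (a * b) x.
Proof.
by rewrite -(L1_class_repr x) -!L1_classZ scalerA.
Qed.

Let L1_scale1 : left_id 1 L1_scale.
Proof. by move=> x; rewrite -(L1_class_repr x) -L1_classZ scale1r. Qed.

Let L1_scaleDr : right_distributive L1_scale +%R.
Proof.
move=> a x y; rewrite -(L1_class_repr x) -(L1_class_repr y).
by rewrite -L1_classD -!L1_classZ scalerDr L1_classD.
Qed.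

Let L1_scaleDl x : {morph L1_scale^~ x : a b / a + b}.
Proof.
move=> a b; rewrite -(L1_class_repr x).
by rewrite -!L1_classZ scalerDl L1_classD.
Qed.

HB.instance Definition _ := GRing.Zmodule_isLmodule.Build R[i] L1
  L1_scaleA L1_scale1 L1_scaleDr L1_scaleDl.

Definition L1pre_norm f : R := \int[mu]_t modulus (f t).

Definition L1_norm x : R[i] := (L1pre_norm (repr x))%:C%C.

Lemma L1pre_norm_ge0 f : 0 <= L1pre_norm f.
Proof. by apply: Rintegral_ge0 => t _; exact: modulus_ge0. Qed.

Lemma L1pre_norm_ae f g : {ae mu, forall t, f t = g t} ->
  L1pre_norm f = L1pre_norm g.
Proof.
move=> fg; congr fine; apply: ge0_ae_eq_integral => //.
- by apply/measurable_EFinP/measurable_modulus; exact: L1preP.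
- by apply/measurable_EFinP/measurable_modulus; exact: L1preP.
- by move=> t _; rewrite lee_fin modulus_ge0.
- by move=> t _; rewrite lee_fin modulus_ge0.
- by apply: filterS fg => t ft _; rewrite ft.
Qed.

Lemma L1pre_normD f g : L1pre_norm (f + g) <= L1pre_norm f + L1pre_norm g.
Proof.
have If := integrable_modulus (L1preP f).
have Ig := integrable_modulus (L1preP g).
rewrite /L1pre_norm -RintegralD//.
apply: le_Rintegral => //.
- exact: integrable_modulus (L1preP (f + g)).
- by have := integrableD measurableT If Ig.
- by move=> t _; exact: modulusD.
Qed.

Lemma L1pre_normZ a f :
  L1pre_norm (a *: f) = modulus (a : 'C[R]) * L1pre_norm f.
Proof.
rewrite /L1pre_norm -RintegralZl//; last exact: integrable_modulus (L1preP f).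
by apply: eq_Rintegral => t _; exact: modulusZ.
Qed.

Lemma L1pre_norm0 f : L1pre_norm f = 0 -> {ae mu, forall t, f t = 0}.
Proof.
move=> f0.
have mf : measurable_fun setT (fun t => (modulus (f t))%:E).
  by apply/measurable_EFinP/measurable_modulus; exact: L1preP.
have /(ae_eq_integral_abs mu measurableT mf) :
    (\int[mu]_t `|(modulus (f t))%:E| = 0)%E.
  under eq_integral do rewrite gee0_abs ?lee_fin ?modulus_ge0//.
  rewrite -[LHS]fineK; first by congr EFin.
  exact: integrable_fin_num (integrable_modulus (L1preP f)).
apply: filterS => t /(_ I)[] ft0; apply/normr0_eq0.
by rewrite -modulusE ft0.
Qed.

Lemma L1_norm_class f : L1_norm (L1_class f) = (L1pre_norm f)%:C%C.
Proof. by congr (_%:C)%C; apply: L1pre_norm_ae; exact: repr_L1_class. Qed.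

Let L1_normD x y : L1_norm (x + y) <= L1_norm x + L1_norm y.
Proof.
rewrite -(L1_class_repr x) -(L1_class_repr y) -L1_classD !L1_norm_class.
by rewrite -rmorphD lecR L1pre_normD.
Qed.

Let L1_normZ a x : L1_norm (a *: x) = `|a| * L1_norm x.
Proof.
rewrite -(L1_class_repr x) -[_ *: _]L1_classZ !L1_norm_class L1pre_normZ.
by rewrite rmorphM/= modulusE.
Qed.

Let L1_norm0 x : L1_norm x = 0 -> x = 0.
Proof.
rewrite -(L1_class_repr x) L1_norm_class => /complexI /L1pre_norm0 x0.
rewrite -[RHS](raddf0 (\pi_L1 : L1pre mu -> L1)).
exact/L1_classE.
Qed.

HB.instance Definition _ :=
  Lmodule_isNormed.Build R[i] L1 L1_normD L1_normZ L1_norm0.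

End L1.

Section L1_of.
Context d (T : measurableType d) (R : realType).
Variable mu : {measure set T -> \bar R}.

(* the class of f in L^1, with the junk value 0 when f is not integrable *)
Definition L1_of (f : T -> 'C[R]) : L1 mu :=
  if insub f is Some u then L1_class (u : L1pre mu) else 0.

Definition L1_fun (u : L1 mu) : T -> 'C[R] := (repr u : L1pre mu).

End L1_of.

Section local_spectral_theory.
Context (R : realType) (X : normedModType R[i]).

(* only the values of [op_app] on [op_dom] are relevant *)
Record operator := Operator { op_dom : set X ; op_app : X -> X }.

Fixpoint op_pow (T : operator) (n : nat) : operator :=
  if n is m.+1 then
    Operator [set x | op_dom (op_pow T m) x /\ op_dom T (op_app (op_pow T m) x)]
             (fun x => op_app T (op_app (op_pow T m) x))
  else Operator setT id.

(* phi is locally the sum of a norm-convergent power series *)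
Definition analytic_on (U : set 'C[R]) (phi : 'C[R] -> X) : Prop :=
  forall z0, U z0 -> exists a : nat -> X,
    \forall z \near z0,
      [series ((z - z0) ^+ n : R[i]) *: a n]_n @ \oo --> phi z.

Definition SVEP (T : operator) : Prop :=
  forall U : set 'C[R], open U -> U !=set0 ->
  forall phi : 'C[R] -> X, analytic_on U phi ->
    (forall z, U z ->
      op_dom T (phi z) /\ op_app T (phi z) - (z : R[i]) *: phi z = 0) ->
    forall z, U z -> phi z = 0.

Definition local_resolvent_set (T : operator) (x : X) : set 'C[R] :=
  [set z0 | exists (U : set 'C[R]) (phi : 'C[R] -> X),
    [/\ open U, U z0, analytic_on U phi &
        forall z, U z ->
          op_dom T (phi z) /\ op_app T (phi z) - (z : R[i]) *: phi z = x]].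

Definition local_spectrum (T : operator) (x : X) : set 'C[R] :=
  ~` local_resolvent_set T x.

End local_spectral_theory.

Section smooth.
Context (R : realType) (d : nat).
Implicit Types f : 'rV[R]_d -> 'C[R].

Let basis (j : 'I_d) : 'rV[R]_d := delta_mx ord0 j.

Definition partial (j : 'I_d) f : 'rV[R]_d -> 'C[R] := fun x =>
  Complex ('D_(basis j) (fun y => complex.Re (f y)) x)
          ('D_(basis j) (fun y => complex.Im (f y)) x).

Definition partially_derivable f : Prop := forall (j : 'I_d) (x : 'rV[R]_d),
  derivable (fun y => complex.Re (f y)) x (basis j) /\
  derivable (fun y => complex.Im (f y)) x (basis j).

(* all iterated partial derivatives exist and are continuous *)
Definition smooth f : Prop := forall s : seq 'I_d,
  continuous (foldr partial f s) /\ partially_derivable (foldr partial f s).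

Definition multi_partial (m : mpoly.multinom d) f : 'rV[R]_d -> 'C[R] :=
  foldr (fun j g => iter (mpoly.fun_of_multinom m j) (partial j) g) f
    (enum 'I_d).

Definition monomial (m : mpoly.multinom d) (x : 'rV[R]_d) : R :=
  \prod_(j < d) x ord0 j ^+ mpoly.fun_of_multinom m j.

Definition support_of f : set 'rV[R]_d := closure [set x | f x != 0].

Definition test_function f : Prop := smooth f /\ compact (support_of f).

Definition schwartz f : Prop := smooth f /\
  forall a b : mpoly.multinom d, exists M : R, forall x : 'rV[R]_d,
    `|monomial a x| * modulus (multi_partial b f x) <= M.

End smooth.

Section fourier.
Context (R : realType) (d : nat).

Definition dot (x y : 'rV[R]_d) : R := \sum_(j < d) x ord0 j * y ord0 j.

Definition expi (t : R) : 'C[R] := Complex (cos t) (sin t).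

Definition fourier (f : 'rV[R]_d -> 'C[R]) (l : 'rV[R]_d) : 'C[R] :=
  ((2 * pi) `^ (- (d%:R / 2)))%:C%C *
  cintegral (lebesgue_rV R d) (fun x => f x * expi (- dot l x)).

(* the value P(i l) *)
Definition symbol (P : mpoly.mpoly d R[i]) (l : 'rV[R]_d) : 'C[R] :=
  mpoly.meval (fun j => Complex 0 (l ord0 j)) P.

End fourier.

Section diffop.
Context (R : realType) (d : nat).
Implicit Types P : mpoly.mpoly d R[i].

(* a distribution is only meant to be applied to test functions *)
Definition distribution := ('rV[R]_d -> 'C[R]) -> 'C[R].

Definition regular_distribution (f : 'rV[R]_d -> 'C[R]) : distribution :=
  fun psi => cintegral (lebesgue_rV R d) (fun x => f x * psi x).

Definition distribution_partial (m : mpoly.multinom d) (u : distribution) :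
    distribution :=
  fun psi => (-1) ^+ mpoly.mdeg m * u (multi_partial m psi).

(* P(d)u, where P(d) is obtained by substituting the d/dx_j for the variables *)
Definition distribution_diffop P (u : distribution) : distribution :=
  fun psi => \sum_(m <- mpoly.msupp P)
    (mpoly.mcoeff m P : 'C[R]) * distribution_partial m u psi.

Definition weak_diffop P (u v : L1 (lebesgue_rV R d)) : Prop :=
  forall psi, test_function psi ->
    distribution_diffop P (regular_distribution (L1_fun u)) psi =
    regular_distribution (L1_fun v) psi.

(* for u in the domain, v is unique because an integrable function which *)
(* vanishes as a distribution vanishes almost everywhere *)
Definition diffop_L1 P : operator (L1 (lebesgue_rV R d)) :=
  Operator [set u | exists v, weak_diffop P u v]
           (fun u => xget 0 [set v | weak_diffop P u v]).

End diffop.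

(* supremum in [0, +oo], so that the supremum of the empty set is 0 *)
Definition sup_nonneg (R : realType) (A : set \bar R) : \bar R :=
  ereal_sup (0%E |` A).

(* Main.v *)
(* On the Fourier side P(d) is multiplication by p = P(i.): if u and P(d)u are
   integrable then the transform of P(d)u is p times that of u, as is seen by
   testing against a smooth cut-off of a character. This gives SVEP: if
   (P(d) - z) phi_z = 0 on an open set, the transform of phi_z at l vanishes for
   z <> p(l), hence for all z, by continuity of phi. Likewise a local resolvent
   phi of f satisfies (p(l) - z) phi_z^(l) = f^(l), so f^ vanishes wherever p(l)
   lies in the local resolvent set, and the local spectrum contains the closure
   of p(supp f^).

   Conversely the inverse transform of a rapidly decreasing h is integrable, with
   an L^1 norm controlled by finitely many derivatives and moments of h. Off the
   closure of p(supp f^) the inverse transform of f^/(p - z) is thus a local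
   resolvent. It is analytic because, for q = p - z1 with |q| >= r on supp f^,
   the L^1 norm of the inverse transform of q^-n h is O(rho^n) for every
   rho > 1/r: a derivative of q^-n h only costs a factor O(n). The same estimate
   for p^n f^ bounds ||T^n f||_1 by O(rho^n) as soon as |p| < rho on supp f^, and
   ||T^n f||_1 >= |p(l)|^n |f^(l)| for all l; this is the spectral radius formula.

   The multivariate inversion theorem is proved by inserting an Abel factor
   exp(-e|l|) in each coordinate and integrating over boxes. *)
From HB Require Import structures.
From mathcomp Require Import all_boot all_order all_algebra.
From mathcomp Require Import all_classical all_reals all_analysis.
From mathcomp Require Import measurable_realfun complex.
From mathcomp Require mpoly.
From mathcomp Require Import ring lra.
Require Import Defs.
Set Implicit Arguments.
Unset Strict Implicit.
Unset Printing Implicit Defensive.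
Import Order.TTheory GRing.Theory Num.Theory.
Import numFieldNormedType.Exports.
Local Open Scope classical_set_scope.
Local Open Scope ring_scope.

(** * Complex-valued functions and their integrals *)

(** An element of L^1 is accessible only through its pairings with test functions, and the value of
    [P(d)] on it is a choice by [xget]. Injectivity of the transform on L^1 therefore serves twice:
    it makes that choice unique, and it turns operator equations into pointwise equations between
    transforms. This is why inversion concerns integrable functions, up to null sets. The obstacle
    in the estimates is uniformity in n: the derivatives of q^-n h are sums whose terms grow with n.
    The predicate [rapid] bounds whole families at once. It is defined by an invariant set, so that
    an estimate of all derivatives and moments reduces to one set of families that is stable under a
    single differentiation and a single multiplication by a coordinate. Such sets are exhibited for
    Schwartz functions, for transforms and for powers. A Schwartz function f enters as the inverse
    transform of its own transform h; the spectral statements are proved for any rapidly decreasing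
    h that is the transform of its inverse transform. *)

Section complex_numbers.
Variable R : realType.
Implicit Types a b : 'C[R].

Lemma modulus_def a :
  modulus a = Num.sqrt (complex.Re a ^+ 2 + complex.Im a ^+ 2).
Proof. by rewrite /modulus normc_def. Qed.

Lemma modulus_sqr a : modulus a ^+ 2 = complex.Re a ^+ 2 + complex.Im a ^+ 2.
Proof. by rewrite modulus_def sqr_sqrtr// addr_ge0// sqr_ge0. Qed.

Lemma modulusM a b : modulus (a * b) = modulus a * modulus b.
Proof. by apply: complexI; rewrite rmorphM/= !modulusE normrM. Qed.

Lemma modulusX a n : modulus (a ^+ n) = modulus a ^+ n.
Proof. by apply: complexI; rewrite rmorphXn/= !modulusE normrX. Qed.

Lemma modulusV a : modulus a^-1 = (modulus a)^-1.
Proof. by apply: complexI; rewrite fmorphV/= !modulusE normfV. Qed.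

Lemma modulusN (V : normedModType R[i]) (v : V) : modulus (- v) = modulus v.
Proof. by rewrite /modulus normrN. Qed.

Lemma modulusB (V : normedModType R[i]) (v w : V) :
  modulus (v - w) = modulus (w - v).
Proof. by rewrite /modulus distrC. Qed.

Lemma modulus0 (V : normedModType R[i]) : modulus (0 : V) = 0.
Proof. by rewrite /modulus normr0. Qed.

Lemma modulus1 : modulus (1 : 'C[R]) = 1.
Proof. by rewrite /modulus normr1. Qed.

Lemma modulus_eq0 (V : normedModType R[i]) (v : V) :
  (modulus v == 0) = (v == 0).
Proof.
by rewrite -[RHS]normr_eq0 -modulusE -(inj_eq (@complexI R)).
Qed.

Lemma modulus_gt0 (V : normedModType R[i]) (v : V) : (0 < modulus v) = (v != 0).
Proof. by rewrite lt_neqAle modulus_ge0 andbT eq_sym modulus_eq0. Qed.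

Lemma modulus_real (x : R) : modulus (x%:C%C : 'C[R]) = `|x|.
Proof. by rewrite modulus_def/= expr0n/= addr0 sqrtr_sqr. Qed.

Lemma modulus_sum (V : normedModType R[i]) I (r : seq I) (Q : pred I)
    (F : I -> V) :
  modulus (\sum_(i <- r | Q i) F i) <= \sum_(i <- r | Q i) modulus (F i).
Proof.
elim/big_ind2 : _ => [|x1 x2 y1 y2 h1 h2|//]; first by rewrite modulus0.
by rewrite (le_trans (modulusD _ _))// lerD.
Qed.

Lemma modulus_prod I (r : seq I) (Q : pred I) (F : I -> 'C[R]) :
  modulus (\prod_(i <- r | Q i) F i) = \prod_(i <- r | Q i) modulus (F i).
Proof. by elim/big_rec2 : _ => [|i y x _ <-]; [exact: modulus1|rewrite modulusM]. Qed.

Lemma le_Re_modulus a : `|complex.Re a| <= modulus a.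
Proof.
rewrite -(@ler_pXn2r _ 2)// ?nnegrE ?modulus_ge0// modulus_sqr.
by rewrite real_normK ?num_real// lerDl sqr_ge0.
Qed.

Lemma le_Im_modulus a : `|complex.Im a| <= modulus a.
Proof.
rewrite -(@ler_pXn2r _ 2)// ?nnegrE ?modulus_ge0// modulus_sqr.
by rewrite real_normK ?num_real// lerDr sqr_ge0.
Qed.

Lemma modulus_le a : modulus a <= `|complex.Re a| + `|complex.Im a|.
Proof.
rewrite -(@ler_pXn2r _ 2)// ?nnegrE ?modulus_ge0 ?addr_ge0// modulus_sqr.
rewrite sqrrD !real_normK ?num_real// addrAC lerDl.
by rewrite mulrn_wge0// mulr_ge0.
Qed.

Lemma ReM a b :
  complex.Re (a * b) = complex.Re a * complex.Re b - complex.Im a * complex.Im b.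
Proof. by case: a b => [? ?] [? ?]. Qed.

Lemma ImM a b :
  complex.Im (a * b) = complex.Re a * complex.Im b + complex.Im a * complex.Re b.
Proof. by case: a b => [? ?] [? ?]. Qed.

Lemma ReD a b : complex.Re (a + b) = complex.Re a + complex.Re b.
Proof. by case: a b => [? ?] [? ?]. Qed.

Lemma ImD a b : complex.Im (a + b) = complex.Im a + complex.Im b.
Proof. by case: a b => [? ?] [? ?]. Qed.

Lemma ReN a : complex.Re (- a) = - complex.Re a.
Proof. by case: a. Qed.

Lemma ImN a : complex.Im (- a) = - complex.Im a.
Proof. by case: a. Qed.

Lemma complexP a b :
  complex.Re a = complex.Re b -> complex.Im a = complex.Im b -> a = b.
Proof. by case: a b => [? ?] [? ?]/= -> ->. Qed.

Lemma expiD (s t : R) : expi (s + t) = expi s * expi t.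
Proof.
apply: complexP => /=; first by rewrite cosD.
by rewrite sinD addrC.
Qed.

Lemma expi0 : expi 0 = 1 :> 'C[R].
Proof. by rewrite /expi cos0 sin0. Qed.

Lemma modulus_expi (t : R) : modulus (expi t) = 1.
Proof. by rewrite modulus_def /= cos2Dsin2 sqrtr1. Qed.

Lemma expi_sum I (r : seq I) (F : I -> R) :
  expi (\sum_(i <- r) F i) = \prod_(i <- r) expi (F i).
Proof. by elim/big_rec2 : _ => [|i x y _ <-]; [exact: expi0|rewrite expiD]. Qed.

Lemma cvg_complexP T (F : set_system T) {FF : Filter F} (u : T -> 'C[R]) a :
  u @ F --> a <->
  (fun x => complex.Re (u x)) @ F --> complex.Re a /\
  (fun x => complex.Im (u x)) @ F --> complex.Im a.
Proof.
split=> [/cvgrPdist_lt ua|[/cvgrPdist_lt uR /cvgrPdist_lt uI]].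
  split; apply/cvgrPdist_lt => e e0; have := ua e%:C%C.
    rewrite ltcR => /(_ e0); apply: filterS => x; rewrite -modulusE ltcR.
    by apply: le_lt_trans; rewrite -ReN -ReD le_Re_modulus.
  rewrite ltcR => /(_ e0); apply: filterS => x; rewrite -modulusE ltcR.
  by apply: le_lt_trans; rewrite -ImN -ImD le_Im_modulus.
(* A positive element of [R[i]] has imaginary part 0, so the radius is the real number [e]. *)
apply/cvgrPdist_lt => -[e e']; rewrite ltcE/= => /andP[/eqP -> e0].
have e20 : 0 < e / 2 by rewrite divr_gt0.
apply: filterS2 (uR _ e20) (uI _ e20) => x xR xI.
rewrite -modulusE ltcR (le_lt_trans (modulus_le _))// ReD ImD ReN ImN.
by rewrite [ltRHS]splitr ltrD.
Qed.

Lemma ccvgM T (F : set_system T) {FF : Filter F} (u v : T -> 'C[R]) a b :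
  u @ F --> a -> v @ F --> b -> (fun t => u t * v t) @ F --> a * b.
Proof. exact: cvgM. Qed.

Lemma ccvgD T (F : set_system T) {FF : Filter F} (u v : T -> 'C[R]) a b :
  u @ F --> a -> v @ F --> b -> (fun t => u t + v t) @ F --> a + b.
Proof. exact: cvgD. Qed.

Lemma cvg_cprod T (F : set_system T) {FF : Filter F} I (r : seq I)
    (u : I -> T -> 'C[R]) (l : I -> 'C[R]) :
  (forall i, u i @ F --> l i) ->
  (fun t => \prod_(i <- r) u i t) @ F --> (\prod_(i <- r) l i : 'C[R]).
Proof.
move=> ul; elim: r => [|i r ih].
  rewrite (_ : (fun _ => _) = fun=> 1); last by apply/funext => t; rewrite big_nil.
  by rewrite big_nil; exact: cvg_cst.
rewrite (_ : (fun _ => _) = fun t => u i t * \prod_(i <- r) u i t); last first.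
  by apply/funext => t; rewrite big_cons.
have -> : \prod_(j <- i :: r) l j = l i * \prod_(j <- r) l j by rewrite big_cons.
exact: (ccvgM (ul i) ih).
Qed.

Lemma cvg_csum T (F : set_system T) {FF : Filter F} I (r : seq I)
    (u : I -> T -> 'C[R]) (l : I -> 'C[R]) :
  (forall i, u i @ F --> l i) ->
  (fun t => \sum_(i <- r) u i t) @ F --> (\sum_(i <- r) l i : 'C[R]).
Proof.
move=> ul; elim: r => [|i r ih].
  rewrite (_ : (fun _ => _) = fun=> 0); last by apply/funext => t; rewrite big_nil.
  by rewrite big_nil; exact: cvg_cst.
rewrite (_ : (fun _ => _) = fun t => u i t + \sum_(i <- r) u i t); last first.
  by apply/funext => t; rewrite big_cons.
have -> : \sum_(j <- i :: r) l j = l i + \sum_(j <- r) l j by rewrite big_cons.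
exact: (ccvgD (ul i) ih).
Qed.

(** The norm takes its values in [R[i]]; this reduces convergence to a real function tending to 0,
    to which squeeze arguments apply. *)
Lemma cvg_modulusP (V : normedModType R[i]) T (F : set_system T) {FF : Filter F}
    (u : T -> V) (l : V) :
  u @ F --> l <-> (fun x => modulus (l - u x)) @ F --> (0 : R).
Proof.
split=> [/cvgrPdist_lt h|/cvgrPdist_lt h]; apply/cvgrPdist_lt.
  move=> e e0; have := h e%:C%C; rewrite ltcR => /(_ e0).
  apply: filterS => x; rewrite -modulusE ltcR.
  by rewrite sub0r normrN (ger0_norm (modulus_ge0 _)).
move=> -[e e']; rewrite ltcE/= => /andP[/eqP -> e0].
apply: filterS (h _ e0) => x; rewrite -modulusE ltcR.
by rewrite sub0r normrN (ger0_norm (modulus_ge0 _)).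
Qed.

End complex_numbers.

Section complex_measurable.
Context d (T : measurableType d) (R : realType).
Implicit Types f g : T -> 'C[R].

Definition cmeasurable f :=
  measurable_fun setT (fun x => complex.Re (f x)) /\
  measurable_fun setT (fun x => complex.Im (f x)).

Lemma cmeasurable_cst a : cmeasurable (fun _ => a).
Proof. by split; exact: measurable_cst. Qed.

Lemma cmeasurableD f g : cmeasurable f -> cmeasurable g ->
  cmeasurable (fun x => f x + g x).
Proof.
move=> [fR fI] [gR gI]; split.
  by under eq_fun do rewrite ReD; exact: measurable_funD.
by under eq_fun do rewrite ImD; exact: measurable_funD.
Qed.

Lemma cmeasurableM f g : cmeasurable f -> cmeasurable g ->
  cmeasurable (fun x => f x * g x).
Proof.
move=> [fR fI] [gR gI]; split.
  under eq_fun do rewrite ReM.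
  by apply: measurable_funB; exact: measurable_funM.
under eq_fun do rewrite ImM.
by apply: measurable_funD; exact: measurable_funM.
Qed.

Lemma cmeasurableN f : cmeasurable f -> cmeasurable (fun x => - f x).
Proof.
move=> mf; under eq_fun do rewrite -mulN1r.
by apply: cmeasurableM => //; exact: cmeasurable_cst.
Qed.

Lemma cmeasurableB f g : cmeasurable f -> cmeasurable g ->
  cmeasurable (fun x => f x - g x).
Proof. by move=> mf mg; apply: cmeasurableD => //; exact: cmeasurableN. Qed.

Lemma cmeasurable_real (u : T -> R) : measurable_fun setT u ->
  cmeasurable (fun x => (u x)%:C%C : 'C[R]).
Proof. by move=> mu; split => //=; exact: measurable_cst. Qed.

Lemma cmeasurable_expi (u : T -> R) : measurable_fun setT u ->
  cmeasurable (fun x => expi (u x)).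
Proof.
move=> mu; split=> /=; apply: (measurableT_comp _ mu).
  by apply: continuous_measurable_fun; exact: continuous_cos.
by apply: continuous_measurable_fun; exact: continuous_sin.
Qed.

Lemma cmeasurable_prod I (r : seq I) (F : I -> T -> 'C[R]) :
  (forall i, cmeasurable (F i)) -> cmeasurable (fun x => \prod_(i <- r) F i x).
Proof.
move=> mF; elim: r => [|i r ih].
  by under eq_fun do rewrite big_nil; exact: cmeasurable_cst.
by under eq_fun do rewrite big_cons; exact: cmeasurableM.
Qed.

End complex_measurable.

Lemma cmeasurableT_comp d1 d2 (T1 : measurableType d1) (T2 : measurableType d2)
    (R : realType) (f : T2 -> 'C[R]) (g : T1 -> T2) :
  cmeasurable f -> measurable_fun setT g -> cmeasurable (fun x => f (g x)).
Proof.
by move=> [fR fI] mg; split; [exact: (measurableT_comp fR)|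
  exact: (measurableT_comp fI)].
Qed.

Section complex_integral_theory.
Context d (T : measurableType d) (R : realType).
Variable mu : {measure set T -> \bar R}.
Implicit Types f g : T -> 'C[R].

Lemma cintegrable_measurable f : cintegrable mu f -> cmeasurable f.
Proof.
by move=> [/integrableP[/measurable_EFinP ? _] /integrableP[/measurable_EFinP ? _]].
Qed.

Lemma cintegrable_le f (g : T -> R) : cmeasurable f ->
  mu.-integrable setT (EFin \o g) -> (forall x, modulus (f x) <= g x) ->
  cintegrable mu f.
Proof.
move=> [fR fI] ig fg; split; apply: le_integrable ig => //.
- exact/measurable_EFinP.
- move=> x _ /=; rewrite lee_fin (le_trans (le_Re_modulus _))//.
  by rewrite (le_trans (fg x))// ler_norm.
- exact/measurable_EFinP.
- move=> x _ /=; rewrite lee_fin (le_trans (le_Im_modulus _))//.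
  by rewrite (le_trans (fg x))// ler_norm.
Qed.

Lemma cintegrableD f g : cintegrable mu f -> cintegrable mu g ->
  cintegrable mu (fun x => f x + g x).
Proof.
move=> If Ig; have [_ /(_ 1 f g)] := cintegrable_submod_closed mu.
by rewrite !inE => /(_ If Ig); rewrite scale1r.
Qed.

Lemma cintegrableZ a f : cintegrable mu f -> cintegrable mu (fun x => a * f x).
Proof.
move=> If; have [+ /(_ a f 0)] := cintegrable_submod_closed mu.
by rewrite !inE => I0 /(_ If I0); rewrite addr0.
Qed.

Lemma cintegrable0 : cintegrable mu (fun _ => 0).
Proof. by have [+ _] := cintegrable_submod_closed mu; rewrite inE. Qed.

Lemma cintegrableN f : cintegrable mu f -> cintegrable mu (fun x => - f x).
Proof. by move=> If; under eq_fun do rewrite -mulN1r; exact: cintegrableZ. Qed.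

Lemma cintegrableB f g : cintegrable mu f -> cintegrable mu g ->
  cintegrable mu (fun x => f x - g x).
Proof. by move=> If Ig; apply: cintegrableD => //; exact: cintegrableN. Qed.

Lemma cintegrableM f g M : cintegrable mu f -> cmeasurable g ->
  (forall x, modulus (g x) <= M) -> cintegrable mu (fun x => f x * g x).
Proof.
move=> If mg gM; apply: (@cintegrable_le _ (fun x => M * modulus (f x))).
- by apply: cmeasurableM => //; exact: cintegrable_measurable If.
- exact: integrableZl (integrable_modulus If).
- by move=> x; rewrite modulusM mulrC ler_wpM2r// modulus_ge0.
Qed.

Lemma eq_cintegral f g : f =1 g -> cintegral mu f = cintegral mu g.
Proof. by move=> fg; congr cintegral; exact/funext. Qed.

Lemma ae_eq_cintegral f g : cintegrable mu f -> cintegrable mu g ->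
  {ae mu, forall x, f x = g x} -> cintegral mu f = cintegral mu g.
Proof.
move=> If Ig fg; have [fR fI] := cintegrable_measurable If.
have [gR gI] := cintegrable_measurable Ig.
congr Complex; congr fine; apply: ae_eq_integral => //.
- exact/measurable_EFinP.
- exact/measurable_EFinP.
- by apply: filterS fg => x -> _.
- exact/measurable_EFinP.
- exact/measurable_EFinP.
- by apply: filterS fg => x -> _.
Qed.

Lemma cintegralD f g : cintegrable mu f -> cintegrable mu g ->
  cintegral mu (fun x => f x + g x) = cintegral mu f + cintegral mu g.
Proof.
move=> [fR fI] [gR gI]; apply: complexP; rewrite ?ReD ?ImD /=.
  by under eq_Rintegral do rewrite ReD; rewrite RintegralD.
by under eq_Rintegral do rewrite ImD; rewrite RintegralD.
Qed.

Lemma cintegralZ a f : cintegrable mu f ->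
  cintegral mu (fun x => a * f x) = a * cintegral mu f.
Proof.
have Zi (k : R) (u : T -> R) : mu.-integrable setT (EFin \o u) ->
    mu.-integrable setT (EFin \o (fun x => k * u x)).
  by move=> /(integrableZl measurableT k).
move=> [fR fI]; apply: complexP; rewrite ?ReM ?ImM /=.
  under eq_Rintegral do rewrite ReM.
  by rewrite RintegralB ?RintegralZl//; exact: Zi.
under eq_Rintegral do rewrite ImM.
by rewrite RintegralD ?RintegralZl//; exact: Zi.
Qed.

Lemma cintegralN f : cintegrable mu f ->
  cintegral mu (fun x => - f x) = - cintegral mu f.
Proof.
move=> If; rewrite -mulN1r -cintegralZ//.
by apply: eq_cintegral => x; rewrite mulN1r.
Qed.

Lemma cintegralB f g : cintegrable mu f -> cintegrable mu g ->
  cintegral mu (fun x => f x - g x) = cintegral mu f - cintegral mu g.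
Proof.
move=> If Ig; rewrite cintegralD//; first by rewrite cintegralN.
exact: cintegrableN.
Qed.

Lemma cintegral0 : cintegral mu (fun _ => 0) = 0.
Proof. by apply: complexP => /=; rewrite /Rintegral integral0. Qed.

Lemma cintegrable_sum I (r : seq I) (F : I -> T -> 'C[R]) :
  (forall i, cintegrable mu (F i)) ->
  cintegrable mu (fun x => \sum_(i <- r) F i x).
Proof.
move=> IF; elim: r => [|i r ih].
  by under eq_fun do rewrite big_nil; exact: cintegrable0.
by under eq_fun do rewrite big_cons; exact: cintegrableD.
Qed.

Lemma cintegral_sum I (r : seq I) (F : I -> T -> 'C[R]) :
  (forall i, cintegrable mu (F i)) ->
  cintegral mu (fun x => \sum_(i <- r) F i x) =
  \sum_(i <- r) cintegral mu (F i).
Proof.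
move=> IF; elim: r => [|i r ih].
  by rewrite big_nil -[RHS]cintegral0; apply: eq_cintegral => x; rewrite big_nil.
rewrite big_cons -ih -cintegralD//; last exact: cintegrable_sum.
by apply: eq_cintegral => x; rewrite big_cons.
Qed.

(* after multiplying f by a unimodular constant, its integral is real *)
Lemma modulus_cintegral f : cintegrable mu f ->
  modulus (cintegral mu f) <= \int[mu]_x modulus (f x).
Proof.
move=> If; set I := cintegral mu f.
have [I0|I0] := eqVneq I 0.
  by rewrite I0 modulus0 Rintegral_ge0// => x _; exact: modulus_ge0.
pose c : 'C[R] := (modulus I)%:C%C / I.
have m0 : modulus I != 0 by rewrite modulus_eq0.
have c1 : modulus c = 1.
  by rewrite modulusM modulusV modulus_real ger0_norm ?modulus_ge0// divff.
have cI : c * I = (modulus I)%:C%C by rewrite /c divfK.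
have -> : modulus I = complex.Re (c * I) by rewrite cI.
have Icf := cintegrableZ c If.
rewrite /I -cintegralZ//= le_Rintegral//.
- by case: Icf.
- exact: integrable_modulus.
- move=> x _; rewrite (le_trans (ler_norm _))// (le_trans (le_Re_modulus _))//.
  by rewrite modulusM c1 mul1r.
Qed.

Lemma modulus_cintegral_le f (g : T -> R) : cmeasurable f ->
  mu.-integrable setT (EFin \o g) -> (forall x, modulus (f x) <= g x) ->
  modulus (cintegral mu f) <= \int[mu]_x g x.
Proof.
move=> mf ig fg; have If := cintegrable_le mf ig fg.
rewrite (le_trans (modulus_cintegral If))// le_Rintegral//.
exact: integrable_modulus.
Qed.

Lemma dominated_Rintegral (h_ : nat -> T -> R) (h g : T -> R) :
  (forall n, measurable_fun setT (h_ n)) -> measurable_fun setT h ->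
  (forall x, h_ ^~ x @ \oo --> h x) ->
  mu.-integrable setT (EFin \o g) -> (forall n x, `|h_ n x| <= g x) ->
  (fun n => \int[mu]_x h_ n x) @ \oo --> \int[mu]_x h x.
Proof.
move=> mh_ mh h_h ig hg.
have [] := @dominated_convergence _ _ _ mu setT measurableT
  (fun n x => (h_ n x)%:E) (fun x => (h x)%:E) (EFin \o g).
- by move=> n; exact/measurable_EFinP.
- exact/measurable_EFinP.
- by apply: aeW => x _; apply/fine_cvgP; split; [exact: nearW|exact: h_h].
- exact: ig.
- by apply: aeW => x n _; rewrite lee_fin.
by move=> ih _; rewrite -(fineK (integrable_fin_num measurableT ih)) => /fine_cvgP[_].
Qed.

Lemma dominated_cintegral (f_ : nat -> T -> 'C[R]) f (g : T -> R) :
  (forall n, cmeasurable (f_ n)) -> cmeasurable f ->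
  (forall x, f_ ^~ x @ \oo --> f x) ->
  mu.-integrable setT (EFin \o g) ->
  (forall n x, modulus (f_ n x) <= g x) ->
  (fun n => cintegral mu (f_ n)) @ \oo --> cintegral mu f.
Proof.
move=> mf_ mf ff ig fg; apply/cvg_complexP; split => /=; apply: dominated_Rintegral ig _ => //.
- by move=> n; case: (mf_ n).
- by case: mf.
- by move=> x; have /cvg_complexP[] := ff x.
- by move=> n x; rewrite (le_trans (le_Re_modulus _)).
- by move=> n; case: (mf_ n).
- by case: mf.
- by move=> x; have /cvg_complexP[] := ff x.
- by move=> n x; rewrite (le_trans (le_Im_modulus _)).
Qed.

End complex_integral_theory.

Section complex_fubini.
Context d1 d2 (T1 : measurableType d1) (T2 : measurableType d2) (R : realType).
Variable m1 : {sigma_finite_measure set T1 -> \bar R}.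
Variable m2 : {sigma_finite_measure set T2 -> \bar R}.

Lemma integrable_prod (g1 : T1 -> R) (g2 : T2 -> R) :
  m1.-integrable setT (EFin \o g1) -> m2.-integrable setT (EFin \o g2) ->
  (m1 \x m2)%E.-integrable setT (fun z => (g1 z.1 * g2 z.2)%:E).
Proof.
move=> ig1 ig2.
have mg1 : measurable_fun setT g1.
  by move/integrableP: ig1 => [/measurable_EFinP].
have mg2 : measurable_fun setT g2.
  by move/integrableP: ig2 => [/measurable_EFinP].
have mg : measurable_fun setT (fun z : T1 * T2 => (g1 z.1 * g2 z.2)%:E).
  apply/measurable_EFinP; apply: measurable_funM.
    exact: measurableT_comp.
  exact: measurableT_comp.
apply/(@integrable12ltyP _ _ _ _ _ m1 m2 _ mg).
rewrite (eq_integral (fun x => (`|g1 x|%:E * \int[m2]_y `|(g2 y)%:E|)%E)).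
  rewrite ge0_integralZr//.
  - rewrite lte_mul_pinfty//.
    + exact: integral_ge0.
    + rewrite ge0_fin_numE; last exact: integral_ge0.
      by move/integrableP: ig1 => [].
    + by move/integrableP: ig2 => [].
  - exact/measurable_EFinP/measurableT_comp.
  - exact: integral_ge0.
move=> x _ /=; rewrite -ge0_integralZl//.
  by apply: eq_integral => y _; rewrite normrM EFinM.
exact/measurable_EFinP/measurableT_comp.
Qed.

(** Domination by a product makes every section integrable, not just almost every one, so the inner
    [Rintegral] never takes the default value of [fine] at an infinite integral. *)
Lemma Rintegral_fubini (f : T1 * T2 -> R) (g1 : T1 -> R) (g2 : T2 -> R) :
  measurable_fun setT f ->
  m1.-integrable setT (EFin \o g1) -> m2.-integrable setT (EFin \o g2) ->
  (forall x y, `|f (x, y)| <= g1 x * g2 y) ->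
  [/\ (m1 \x m2)%E.-integrable setT (EFin \o f),
      m1.-integrable setT (fun x => (\int[m2]_y f (x, y))%:E),
      \int[m1]_x (\int[m2]_y f (x, y)) = \int[(m1 \x m2)%E]_z f z &
      \int[m2]_y (\int[m1]_x f (x, y)) = \int[(m1 \x m2)%E]_z f z].
Proof.
move=> mf ig1 ig2 fg.
have If : (m1 \x m2)%E.-integrable setT (EFin \o f).
  apply: le_integrable (integrable_prod ig1 ig2) => //.
    exact/measurable_EFinP.
  move=> [x y] _ /=; rewrite lee_fin (le_trans (fg x y))//.
  exact: ler_norm.
have I2 x : m2.-integrable setT (fun y => (f (x, y))%:E).
  apply: le_integrable (integrableZl measurableT (g1 x) ig2) => //.
    by apply/measurable_EFinP; exact: measurableT_comp.
  by move=> y _ /=; rewrite lee_fin (le_trans (fg x y))// ler_norm.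
have I1 y : m1.-integrable setT (fun x => (f (x, y))%:E).
  apply: le_integrable (integrableZr measurableT (g2 y) ig1) => //.
    by apply/measurable_EFinP; exact: measurableT_comp.
  by move=> x _ /=; rewrite lee_fin (le_trans (fg x y))// ler_norm.
have E2 x : (\int[m2]_y f (x, y))%:E = (\int[m2]_y (f (x, y))%:E)%E.
  by rewrite fineK//; exact: integrable_fin_num.
have E1 y : (\int[m1]_x f (x, y))%:E = (\int[m1]_x (f (x, y))%:E)%E.
  by rewrite fineK//; exact: integrable_fin_num.
split => //.
- by under eq_fun do rewrite E2; exact: integrable_fubini_F If.
- congr fine; under eq_integral do rewrite E2.
  exact: (integral12_prod_meas1 If).
- congr fine; under eq_integral do rewrite E1.
  exact: (integral21_prod_meas1 If).
Qed.

Lemma cintegral_fubini (f : T1 * T2 -> 'C[R]) (g1 : T1 -> R) (g2 : T2 -> R) :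
  cmeasurable f ->
  m1.-integrable setT (EFin \o g1) -> m2.-integrable setT (EFin \o g2) ->
  (forall x y, modulus (f (x, y)) <= g1 x * g2 y) ->
  [/\ cintegrable (m1 \x m2)%E f,
      cintegrable m1 (fun x => cintegral m2 (fun y => f (x, y))),
      cintegral m1 (fun x => cintegral m2 (fun y => f (x, y))) =
        cintegral (m1 \x m2)%E f &
      cintegral m2 (fun y => cintegral m1 (fun x => f (x, y))) =
        cintegral (m1 \x m2)%E f].
Proof.
move=> [mR mI] ig1 ig2 fg.
have [|? ? R12 R21] := Rintegral_fubini mR ig1 ig2.
  by move=> x y; rewrite (le_trans (le_Re_modulus _)).
have [|? ? I12 I21] := Rintegral_fubini mI ig1 ig2.
  by move=> x y; rewrite (le_trans (le_Im_modulus _)).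
split=> //.
- by rewrite /cintegral/= R12 I12.
- by rewrite /cintegral/= R21 I21.
Qed.

(** Used with the Fourier kernel, where it is the multiplication formula, and with the Poisson
    kernel. A bounded kernel leaves the integrand dominated by a product. *)
Lemma cintegral_exchange (f : T1 -> 'C[R]) (g : T2 -> 'C[R])
    (k : T1 * T2 -> 'C[R]) (M : R) :
  cintegrable m1 f -> cintegrable m2 g -> cmeasurable k ->
  (forall z, modulus (k z) <= M) ->
  cintegral m1 (fun x => f x * cintegral m2 (fun y => g y * k (x, y))) =
  cintegral m2 (fun y => g y * cintegral m1 (fun x => f x * k (x, y))).
Proof.
move=> If Ig mk kM.
have mf := cintegrable_measurable If; have mg := cintegrable_measurable Ig.
have mF : cmeasurable (fun z : T1 * T2 => f z.1 * g z.2 * k z).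
  by apply: cmeasurableM => //; apply: cmeasurableM; apply: cmeasurableT_comp.
have [|_ _ E1 E2] := cintegral_fubini mF
  (integrableZl measurableT M (integrable_modulus If)) (integrable_modulus Ig).
  move=> x y; rewrite 2!modulusM [leLHS]mulrC -[leRHS]mulrA.
  by apply: ler_wpM2r; rewrite ?mulr_ge0 ?modulus_ge0.
transitivity (cintegral (m1 \x m2)%E (fun z => f z.1 * g z.2 * k z)).
  rewrite -E1; apply: eq_cintegral => x; rewrite -cintegralZ.
    by apply: eq_cintegral => y /=; rewrite mulrA.
  apply: (cintegrableM Ig _ (fun y => kM (x, y))).
  by apply: cmeasurableT_comp => //; exact: pair1_measurable.
rewrite -E2; apply: eq_cintegral => y; rewrite -cintegralZ.
  by apply: eq_cintegral => x /=; rewrite mulrCA mulrA.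
apply: (cintegrableM If _ (fun x => kM (x, y))).
by apply: cmeasurableT_comp => //; exact: pair2_measurable.
Qed.

End complex_fubini.

(** * Integration on R^d *)

Section integral_rV.
Context (R : realType).

Lemma integrable_rV_cons d (f : 'rV[R]_d.+1 -> R) : measurable_fun setT f ->
  (@lebesgue_measure R \x lebesgue_rV R d)%E.-integrable setT
    (fun z => (f (rV_cons z))%:E) ->
  (lebesgue_rV R d.+1).-integrable setT (EFin \o f).
Proof.
move=> mf If.
apply: (integrable_pushforward (@measurable_rV_cons R d)) => //.
exact/measurable_EFinP.
Qed.

Lemma Rintegral_rV_cons d (f : 'rV[R]_d.+1 -> R) : measurable_fun setT f ->
  (@lebesgue_measure R \x lebesgue_rV R d)%E.-integrable setT
    (fun z => (f (rV_cons z))%:E) ->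
  \int[lebesgue_rV R d.+1]_x f x =
  \int[(@lebesgue_measure R \x lebesgue_rV R d)%E]_z f (rV_cons z).
Proof.
move=> mf If; congr fine.
rewrite (integral_pushforward (@measurable_rV_cons R d))//.
exact/measurable_EFinP.
Qed.

Lemma measurable_fun_rV0 (f : 'rV[R]_0 -> R) : measurable_fun setT f.
Proof.
rewrite (_ : f = cst (f 0)); first exact: measurable_cst.
by apply/funext => x; rewrite /cst; congr f; apply/rowP => -[].
Qed.

Lemma Rintegral_rV0 (f : 'rV[R]_0 -> R) : \int[lebesgue_rV R 0]_x f x = f 0.
Proof.
rewrite /Rintegral /= integral_dirac//; first by rewrite diracT mul1e.
by apply/measurable_EFinP; exact: measurable_fun_rV0.
Qed.

Lemma integrable_rV0 (f : 'rV[R]_0 -> R) :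
  (lebesgue_rV R 0).-integrable setT (EFin \o f).
Proof.
apply/integrableP; split.
  by apply/measurable_EFinP; exact: measurable_fun_rV0.
rewrite /= integral_dirac//; first by rewrite diracT mul1e ltry.
by apply/measurable_EFinP; exact: measurable_fun_rV0.
Qed.

Lemma rV_consE0 d (a : R) (y : 'rV[R]_d) : rV_cons (a, y) ord0 ord0 = a.
Proof. by rewrite mxE unlift_none. Qed.

Lemma rV_consEl d (a : R) (y : 'rV[R]_d) i :
  rV_cons (a, y) ord0 (lift ord0 i) = y ord0 i.
Proof. by rewrite mxE liftK. Qed.

Local Notation leb := (@lebesgue_measure R).

(** Induction on the dimension through [rV_cons]. Weights, Abel factors, Poisson kernels and boxes
    are products over the coordinates, so their integrals reduce to dimension one. *)
Lemma cintegral_rV_prod d (g : 'I_d -> R -> 'C[R]) :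
  (forall i, cintegrable leb (g i)) ->
  cintegrable (lebesgue_rV R d) (fun x => \prod_i g i (x ord0 i)) /\
  cintegral (lebesgue_rV R d) (fun x => \prod_i g i (x ord0 i)) =
    \prod_i cintegral leb (g i).
Proof.
elim: d g => [|d ih] g Ig.
  split; first by split; exact: integrable_rV0.
  by apply: complexP; rewrite /= Rintegral_rV0 !big_ord0.
have [I2 E2] := ih (fun i => g (lift ord0 i)) (fun i => Ig (lift ord0 i)).
set G := fun y : 'rV_d => _ in I2 E2.
have mG := cintegrable_measurable I2.
have mg := cintegrable_measurable (Ig ord0).
have consE (z : measurableTypeR R * 'rV[R]_d) :
    \prod_i g i (rV_cons z ord0 i) = g ord0 z.1 * G z.2.
  case: z => a y; rewrite big_ord_recl rV_consE0; congr (_ * _).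
  by apply: eq_bigr => i _; rewrite rV_consEl.
have mF : cmeasurable (fun x : 'rV[R]_d.+1 => \prod_i g i (x ord0 i)).
  apply: cmeasurable_prod => i; apply: cmeasurableT_comp.
    exact: cintegrable_measurable (Ig i).
  exact: measurable_coord.
have mH : cmeasurable (fun z : measurableTypeR R * 'rV[R]_d => g ord0 z.1 * G z.2).
  by apply: cmeasurableM; apply: cmeasurableT_comp.
have [|[IR II] _ E1 _] := cintegral_fubini mH (integrable_modulus (Ig ord0))
    (integrable_modulus I2).
  by move=> x y /=; rewrite modulusM.
have [mFR mFI] := mF.
have IR' : (leb \x lebesgue_rV R d)%E.-integrable setT
    (fun z => (complex.Re (\prod_i g i (rV_cons z ord0 i)))%:E).
  by under eq_fun do rewrite consE.
have II' : (leb \x lebesgue_rV R d)%E.-integrable setT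
    (fun z => (complex.Im (\prod_i g i (rV_cons z ord0 i)))%:E).
  by under eq_fun do rewrite consE.
split; first by split; exact: integrable_rV_cons.
rewrite big_ord_recl -E2 mulrC -cintegralZ//.
transitivity (cintegral (leb \x lebesgue_rV R d)%E (fun z => g ord0 z.1 * G z.2)).
  by apply: complexP => /=; rewrite Rintegral_rV_cons//; congr fine;
    apply: eq_integral => z _; rewrite consE.
rewrite -E1; apply: eq_cintegral => x.
by rewrite /= cintegralZ// mulrC.
Qed.

Lemma Rintegral_rV_prod d (g : 'I_d -> R -> R) :
  (forall i, leb.-integrable setT (EFin \o g i)) ->
  (lebesgue_rV R d).-integrable setT (fun x => (\prod_i g i (x ord0 i))%:E) /\
  \int[lebesgue_rV R d]_x (\prod_i g i (x ord0 i)) = \prod_i \int[leb]_t g i t.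
Proof.
move=> Ig.
have Ic i : cintegrable leb (fun t => (g i t)%:C%C).
  by split; [exact: Ig|exact: integrable0].
have [[IR _] E] := cintegral_rV_prod Ic.
have pE x : \prod_i ((g i (x ord0 i))%:C%C : 'C[R]) =
    (\prod_i g i (x ord0 i))%:C%C by rewrite rmorph_prod.
have cE i : cintegral leb (fun t => (g i t)%:C%C) = (\int[leb]_t g i t)%:C%C.
  by apply: complexP => //=; rewrite /Rintegral integral0.
split.
  by apply: eq_integrable IR => // x _; rewrite pE.
have := congr1 (@complex.Re _) E; rewrite (eq_bigr _ (fun i _ => cE i)).
rewrite -rmorph_prod /= => <-; apply: eq_Rintegral => x _; by rewrite pE.
Qed.

End integral_rV.

Section rV_topology.
Context (R : realType) (d : nat).

Lemma cvg_rV T (F : set_system T) {FF : Filter F} (u : T -> 'rV[R]_d)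
    (l : 'rV[R]_d) :
  (forall i, (fun t => u t ord0 i) @ F --> l ord0 i) -> u @ F --> l.
Proof.
move=> ul; apply/cvg_ballP => e e0.
have h i : \forall t \near F, ball (l ord0 i) e (u t ord0 i).
  by move/cvg_ballP : (ul i); exact.
by apply: filterS (filter_forall FF h) => t ht; split=> // i j; rewrite ord1.
Qed.

(** The difference quotients of [f] and of [f \o p] are the same function of [h], so a derivative
    along the single line suffices. *)
Lemma is_derive_line (U W : normedModType R) (f : W -> R) (p : U -> W)
    (u a : U) (v : W) (df : R) :
  (forall h : R, p (h *: u + a) = h *: v + p a) ->
  is_derive (p a) v f df -> is_derive a u (f \o p) df.
Proof.
move=> pE [fd fE].
have E : (fun h => h^-1 *: ((f \o shift (p a)) (h *: v) - f (p a))) =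
    (fun h : R => h^-1 *: (((f \o p) \o shift a) (h *: u) - (f \o p) a)).
  by apply/funext => h /=; rewrite pE.
split; first by rewrite /derivable -E.
by rewrite -fE /derive -E.
Qed.

Lemma cvg_floor_div (t : R) :
  (fun n => (Num.floor (t * n.+1%:R))%:~R / n.+1%:R) @ \oo --> t.
Proof.
apply/cvgrPdist_le => e e0.
near=> n.
have n0 : 0 < n.+1%:R :> R by [].
have /andP[f1 f2] := floor_itv (t * n.+1%:R).
rewrite -[X in `|X - _|](@mulfK _ n.+1%:R)// -mulrBl normrM (@gtr0_norm _ _^-1) ?invr_gt0//.
rewrite ler_pdivrMr// ger0_norm ?subr_ge0//.
rewrite (@le_trans _ _ 1)//.
  by rewrite lerBlDl ltW//; rewrite intrD in f2.
rewrite mulrC -ler_pdivrMr// div1r.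
near: n; exists (Num.bound e^-1) => // n /= en.
rewrite ltW// (lt_le_trans (archi_boundP _)) ?invr_ge0 ?ltW//.
by rewrite ltr_nat ltnS.
Unshelve. all: by end_near. Qed.

(** The sigma-algebra is generated by the coordinates. [f] is the pointwise limit of its values at
    the corners [q n (k n x)] of a grid of mesh 1/(n+1), and each approximation is constant on
    countably many cells cut out by conditions on coordinates. *)
Lemma continuous_rV_measurable (f : 'rV[R]_d -> R) :
  continuous f -> measurable_fun [set: 'rV[R]_d] f.
Proof.
move=> cf.
pose k n (x : 'rV[R]_d) : 'rV[int]_d := \row_j Num.floor (x ord0 j * n.+1%:R).
pose q n (m : 'rV[int]_d) : 'rV[R]_d := \row_j ((m ord0 j)%:~R / n.+1%:R).
apply: (@measurable_fun_cvg _ _ _ setT (fun n x => f (q n (k n x)))); last first.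
  move=> x _; apply: (@cvg_comp _ _ _ (fun n => q n (k n x)) f _ (nbhs x)).
    apply: cvg_rV => j; under eq_fun do rewrite !mxE.
    exact: cvg_floor_div.
  exact: cf.
move=> n _ Y mY; rewrite setTI.
rewrite (_ : _ @^-1` _ = \bigcup_(m in [set m | Y (f (q n m))]) [set x | k n x = m]).
  rewrite bigcup_mkcond; apply: countable_bigcupT_measurable => [|m].
    exact: countableP.
  case: ifPn => // _.
  rewrite (_ : [set x | _ ] = \bigcap_(j in [set: 'I_d])
     ((fun x : 'rV[R]_d => x ord0 j) @^-1` [set t | Num.floor (t * n.+1%:R) = m ord0 j])).
    apply: fin_bigcap_measurable => [|j _]; first exact: finite_finset.
    rewrite -[X in measurable X]setTI; apply: measurable_coord => //.
    rewrite (_ : mkset _ = (fun t : R => t * n.+1%:R) @^-1`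
        `[(m ord0 j)%:~R, (m ord0 j + 1)%:~R[).
      rewrite -[X in measurable X]setTI.
      have mM : measurable_fun setT (fun t : R => t * n.+1%:R).
        exact: measurable_funM.
      exact: mM.
    apply/seteqP; split=> t /=; rewrite in_itv/=.
      by move=> <-; exact: floor_itv.
    exact: floor_def.
  apply/seteqP; split=> [x /= <- j _|x h] /=; first by rewrite mxE.
  by apply/rowP => j; rewrite mxE; exact: h.
apply/seteqP; split=> [x Yx|x [m /= Ym km]] /=; last by rewrite km.
by exists (k n x).
Qed.

End rV_topology.


(** * Integrable weights and integration by parts *)

Section weight.
Context (R : realType).
Local Notation leb := (@lebesgue_measure R).

Lemma oneDsqr_gt0 (t : R) : 0 < oneDsqr t.
Proof. by rewrite (lt_le_trans ltr01)// oneDsqr_ge1. Qed.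

Lemma integrable_oneDsqrV :
  leb.-integrable setT (fun t : R => ((oneDsqr t)^-1)%:E).
Proof.
have m1 : measurable_fun setT (fun t : R => (oneDsqr t)^-1).
  by apply: continuous_measurable_fun; exact: continuous_oneDsqrV.
apply/integrableP; split; first exact/measurable_EFinP.
rewrite (eq_integral (fun t : measurableTypeR R => ((oneDsqr t)^-1)%:E)); last first.
  by move=> t _; rewrite gee0_abs// lee_fin invr_ge0 ltW// oneDsqr_gt0.
rewrite (@ge0_symfun_integralT R (fun t => (oneDsqr t)^-1)).
- by rewrite -set_itvcy integral0y_oneDsqr -EFinM ltry.
- by move=> t; rewrite invr_ge0 ltW// oneDsqr_gt0.
- exact: continuous_oneDsqrV.
- by move=> t; rewrite /oneDsqr /= sqrrN.
Qed.

(** A product over coordinates, not a power of 1 + |x|^2: it is integrable by factorisation and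
    splits along [rV_cons] in inductions on the dimension. *)
Definition weight d (x : 'rV[R]_d) : R := \prod_j (oneDsqr (x ord0 j))^-1.

Lemma weight_gt0 d (x : 'rV[R]_d) : 0 < weight x.
Proof. by apply: prodr_gt0 => j _; rewrite invr_gt0 oneDsqr_gt0. Qed.

Lemma weight_ge0 d (x : 'rV[R]_d) : 0 <= weight x.
Proof. exact/ltW/weight_gt0. Qed.

Lemma integrable_weight d :
  (lebesgue_rV R d).-integrable setT (EFin \o @weight d).
Proof. by have [] := Rintegral_rV_prod (fun _ : 'I_d => integrable_oneDsqrV). Qed.

Lemma weight_cons d a (y : 'rV[R]_d) :
  weight (rV_cons (a, y)) = (oneDsqr a)^-1 * weight y.
Proof.
rewrite /weight big_ord_recl rV_consE0; congr (_ * _).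
by apply: eq_bigr => j _; rewrite rV_consEl.
Qed.

Lemma cvg_oneDsqrV_nat : (fun n => (oneDsqr n%:R)^-1 : R) @ \oo --> (0 : R).
Proof.
apply: (@squeeze_cvgr _ _ _ _ (fun=> 0) (fun n : nat => n.+1%:R^-1)).
- near=> n; rewrite invr_ge0 ltW ?oneDsqr_gt0//=.
  rewrite lef_pV2 ?posrE ?oneDsqr_gt0// /oneDsqr -natr1 addrC lerD2l.
  rewrite expr2 ler_peMr// ler1n.
  by near: n; exists 1%N.
- exact: cvg_cst.
- exact: cvg_harmonic.
Unshelve. all: by end_near. Qed.

Lemma cvg0_oneDsqrV_le (u : nat -> R) (C : R) :
  (forall n, `|u n| <= C * (oneDsqr n.+1%:R)^-1) -> u @ \oo --> (0 : R).
Proof.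
move=> uC; apply/norm_cvg0P.
apply: (@squeeze_cvgr _ _ _ _ (fun=> 0) (fun n => C * (oneDsqr n.+1%:R)^-1)).
- by apply: nearW => n; rewrite normr_ge0 uC.
- exact: cvg_cst.
- rewrite -(mulr0 C); apply: cvgMr.
  by rewrite (cvg_shiftS (fun n => (oneDsqr n%:R)^-1)); exact: cvg_oneDsqrV_nat.
Qed.

(** [F] is an antiderivative on the right half-line and [G] on the left one, as integrands in |t|
    require. On [-n-1, n+1] the fundamental theorem leaves G(0) - F(0) plus boundary terms, which
    the decay sends to 0. *)
Lemma Rintegral_FTC_split (h F G : R -> R) (C : R) : continuous h ->
  continuous F -> continuous G ->
  (forall t : R, 0 < t -> is_derive t (1 : R) F (h t)) ->
  (forall t : R, t < 0 -> is_derive t (1 : R) G (h t)) ->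
  (forall t, `|h t| <= C * (oneDsqr t)^-1) ->
  (forall t, 0 <= t -> `|F t| <= C * (oneDsqr t)^-1) ->
  (forall t, t <= 0 -> `|G t| <= C * (oneDsqr t)^-1) ->
  \int[leb]_t h t = G 0 - F 0.
Proof.
move=> ch cF cG Fh Gh hC FC GC.
have mh : measurable_fun setT h by exact: continuous_measurable_fun.
have Ih : leb.-integrable setT (EFin \o h).
  apply: le_integrable (integrableZl measurableT C integrable_oneDsqrV) => //.
    exact/measurable_EFinP.
  by move=> t _ /=; rewrite lee_fin (le_trans (hC t))// ler_norm.
pose A n : set R := `[- n.+1%:R, n.+1%:R]%classic.
have An n : \int[leb]_t (h \_ (A n)) t = (G 0 - F 0) + (F n.+1%:R - G (- n.+1%:R)).
  rewrite -Rintegral_mkcond.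
  have IA (i : interval R) : leb.-integrable [set` i] (EFin \o h).
    by apply: integrableS Ih => //; exact: measurable_itv.
  have := @Rintegral_itvB R h (BLeft (- n.+1%:R)) (BRight n.+1%:R) 0 (IA _).
  rewrite !bnd_simp oppr_le0 ler0n => /(_ isT isT)/eqP; rewrite subr_eq => /eqP ->.
  rewrite Rintegral_itv_obnd_cbnd//.
  rewrite [X in X + _](_ : _ = F n.+1%:R - F 0); last first.
    rewrite /Rintegral (@continuous_FTC2 _ h F)//.
    - exact: continuous_subspaceT.
    - split.
      + by move=> t; rewrite in_itv/= => /andP[t0 _]; case: (Fh t t0).
      + by apply: cvg_at_right_filter; exact: cF.
      + by apply: cvg_at_left_filter; exact: cF.
    - move=> t; rewrite in_itv/= => /andP[t0 _].
      by rewrite derive1E; have := Fh t t0 => ?; exact: derive_val.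
  rewrite [X in _ + X](_ : _ = G 0 - G (- n.+1%:R)); last first.
    rewrite /Rintegral (@continuous_FTC2 _ h G)//.

    - exact: continuous_subspaceT.
    - split.
      + by move=> t; rewrite in_itv/= => /andP[_ t0]; case: (Gh t t0).
      + by apply: cvg_at_right_filter; exact: cG.
      + by apply: cvg_at_left_filter; exact: cG.
    - move=> t; rewrite in_itv/= => /andP[_ t0].
      by rewrite derive1E; have := Gh t t0 => ?; exact: derive_val.
  by rewrite addrC addrACA [- G _ - _]addrC addrACA.
have lim1 : (fun n => \int[leb]_t (h \_ (A n)) t) @ \oo --> \int[leb]_t h t.
  apply: (@dominated_Rintegral _ _ _ leb (fun n => h \_ (A n)) h
    (fun t => C * (oneDsqr t)^-1)) => //.
  - move=> n; apply/(measurable_restrictT _ _).1; first exact: measurable_itv.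
    exact: measurable_funTS.
  - move=> t; apply: cvg_near_cst.
    near=> n; rewrite patchE mem_set// /A/= in_itv/= -ler_norml.
    rewrite ltW// (lt_le_trans (archi_boundP _))// ler_nat ltnW//.
    by near: n; exists (Num.bound `|t|).
  - exact: integrableZl integrable_oneDsqrV.
  - move=> n t; rewrite patchE; case: ifPn => _ //.
    by rewrite normr0 (le_trans _ (hC t)).
have lim2 : (fun n => \int[leb]_t (h \_ (A n)) t) @ \oo --> (G 0 - F 0).
  under eq_fun do rewrite An.
  suff : (fun n => G 0 - F 0 + (F n.+1%:R - G (- n.+1%:R))) @ \oo -->
      G 0 - F 0 + (0 - 0) by rewrite subrr addr0.
  apply: cvgD; first exact: cvg_cst.
  apply: cvgB; apply: (@cvg0_oneDsqrV_le _ C) => n; first exact: FC.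
  by rewrite (le_trans (GC _ _)) ?oppr_le0// /oneDsqr sqrrN.
exact: cvg_unique lim1 lim2.
Unshelve. all: by end_near. Qed.

Lemma Rintegral_derive0 (h dh : R -> R) (C : R) : continuous dh ->
  (forall t : R, is_derive t (1 : R) h (dh t)) ->
  (forall t, `|h t| <= C * (oneDsqr t)^-1) ->
  (forall t, `|dh t| <= C * (oneDsqr t)^-1) -> \int[leb]_t dh t = 0.
Proof.
move=> cdh hdh hC dhC.
have ch : continuous h.
  by move=> t; apply: differentiable_continuous; apply/derivable1_diffP; case: (hdh t).
by rewrite (@Rintegral_FTC_split dh h h C) ?subrr.
Qed.

(** Fubini with the direction [j] on the inside: for [ord0] the inner integral is one-dimensional;
    otherwise the slice at first coordinate [a] satisfies the hypotheses with the constant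
    [C / oneDsqr a]. *)
Lemma Rintegral_partial0 d (j : 'I_d) (h dh : 'rV[R]_d -> R) (C : R) :
  continuous dh -> (forall x, is_derive x (delta_mx ord0 j) h (dh x)) ->
  (forall x, `|h x| <= C * weight x) ->
  (forall x, `|dh x| <= C * weight x) ->
  \int[lebesgue_rV R d]_x dh x = 0.
Proof.
elim: d j h dh C => [[]//|d ih] j h dh C cdh hdh hC dhC.
have mdh := continuous_rV_measurable cdh.
have mF : measurable_fun setT (fun z : measurableTypeR R * 'rV[R]_d => dh (rV_cons z)).
  by apply: (measurableT_comp mdh); exact: measurable_rV_cons.
have IC := integrableZl measurableT C integrable_oneDsqrV.
have [|If _ E1 E2] := Rintegral_fubini mF IC (@integrable_weight d).
  by move=> a y; rewrite -mulrA -weight_cons.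
rewrite Rintegral_rV_cons//.
have ccons0 (y : 'rV[R]_d) : continuous (fun a : R => rV_cons (a, y)).
  move=> a; apply: cvg_rV => i; case: (unliftP ord0 i) => [k ->|->].
    by under eq_fun do rewrite rV_consEl; rewrite rV_consEl; exact: cvg_cst.
  by under eq_fun do rewrite rV_consE0; rewrite rV_consE0; exact: cvg_id.
have cconsl (a : R) : continuous (fun y : 'rV[R]_d => rV_cons (a, y)).
  move=> y; apply: (@cvg_rV _ _ _ _ (nbhs_filter y)) => i.
  case: (unliftP ord0 i) => [k ->|->].
    by under eq_fun do rewrite rV_consEl; rewrite rV_consEl; exact: coord_continuous.
  by under eq_fun do rewrite rV_consE0; rewrite rV_consE0; exact: cvg_cst.
have [k|] := unliftP ord0 j => jE; subst j.
  rewrite -E1 /Rintegral integral0_eq// => a _; congr EFin.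
  apply: (ih k (fun y => h (rV_cons (a, y))) _ (C * (oneDsqr a)^-1)).
  - by move=> y; apply: continuous_comp; [exact: cconsl|exact: cdh].
  - move=> y; apply: (@is_derive_line _ _ _ h (fun y => rV_cons (a, y)) _ _ _ _ _
      (hdh (rV_cons (a, y)))) => t.
    apply/rowP => i; case: (unliftP ord0 i) => [l ->|->].
      by rewrite rV_consEl !mxE liftK /= (inj_eq lift_inj).
    by rewrite rV_consE0 !mxE unlift_none (negbTE (neq_lift ord0 k)) andbF mulr0 add0r.
  - by move=> y; rewrite -mulrA -weight_cons.
  - by move=> y; rewrite -mulrA -weight_cons.
rewrite -E2 /Rintegral integral0_eq// => y _; congr EFin.
apply: (@Rintegral_derive0 (fun a => h (rV_cons (a, y))) _ (C * weight y)).
- by move=> a; apply: continuous_comp; [exact: ccons0|exact: cdh].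
- move=> a; apply: (@is_derive_line _ _ _ h (fun a => rV_cons (a, y)) _ _ _ _ _
    (hdh (rV_cons (a, y)))) => t.
  apply/rowP => i; case: (unliftP ord0 i) => [l ->|->].
    by rewrite rV_consEl !mxE liftK [lift _ _ == _]eq_sym (negbTE (neq_lift _ _)) andbF mulr0 add0r.
  by rewrite rV_consE0 !mxE unlift_none !eqxx.
- by move=> a; rewrite -mulrA [weight _ * _]mulrC -weight_cons.
- by move=> a; rewrite -mulrA [weight _ * _]mulrC -weight_cons.
Qed.

End weight.

(** * Fourier inversion for integrable functions *)

Section fourier_operators.
Context (R : realType) (d : nat).
Local Notation leb := (lebesgue_rV R d).
Implicit Types (u h : 'rV[R]_d -> 'C[R]) (x l : 'rV[R]_d).

(** The transform without its normalisation, so that [ift] after [ft] produces the factor (2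
    pi)^d. *)
Definition ft u l : 'C[R] := cintegral leb (fun x => u x * expi (- dot l x)).
Definition ift h x : 'C[R] := cintegral leb (fun l => h l * expi (dot l x)).

Lemma dotC x l : dot x l = dot l x.
Proof. by apply: eq_bigr => j _; rewrite mulrC. Qed.

Lemma dotDr x y l : dot l (x + y) = dot l x + dot l y.
Proof. by rewrite -big_split; apply: eq_bigr => j _; rewrite mxE mulrDr. Qed.

Lemma dotNr x l : dot l (- x) = - dot l x.
Proof. by rewrite -sumrN; apply: eq_bigr => j _; rewrite mxE mulrN. Qed.

Lemma dotZr (t : R) x l : dot l (t *: x) = t * dot l x.
Proof. by rewrite mulr_sumr; apply: eq_bigr => j _; rewrite mxE mulrCA. Qed.

Lemma dot_delta (j : 'I_d) l : dot l (delta_mx ord0 j) = l ord0 j.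
Proof.
rewrite /dot (bigD1 j)//= !mxE !eqxx mulr1 big1 ?addr0// => i ij.
by rewrite mxE (negbTE ij) andbF mulr0.
Qed.

Lemma measurable_dot d0 (T : measurableType d0) (f g : T -> 'rV[R]_d) :
  measurable_fun setT f -> measurable_fun setT g ->
  measurable_fun setT (fun z => dot (f z) (g z) : R).
Proof.
move=> mf mg; apply: measurable_sum => j; apply: measurable_funM.
  exact: (measurableT_comp (@measurable_coord R d j) mf).
exact: (measurableT_comp (@measurable_coord R d j) mg).
Qed.

Lemma cmeasurable_wave (s : R) l : cmeasurable (fun x => expi (s * dot l x)).
Proof.
by apply: cmeasurable_expi; apply: measurable_funM => //; exact: measurable_dot.
Qed.

Lemma cmeasurable_waveN l : cmeasurable (fun x => expi (- dot l x)).
Proof. by under eq_fun do rewrite -mulN1r; exact: cmeasurable_wave. Qed.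

Lemma cintegrable_ft u l : cintegrable leb u ->
  cintegrable leb (fun x => u x * expi (- dot l x)).
Proof.
move=> Iu; apply: (cintegrableM Iu (cmeasurable_waveN l) (M := 1)) => x.
by rewrite modulus_expi.
Qed.

Lemma iftE h x : ift h x = ft h (- x).
Proof.
by apply: eq_cintegral => l; rewrite [dot (- x) l]dotC dotNr opprK.
Qed.

Lemma cintegrable_ift h x : cintegrable leb h ->
  cintegrable leb (fun l => h l * expi (dot l x)).
Proof.
move=> Ih; have := cintegrable_ft (- x) Ih; congr cintegrable.
by apply/funext => l; rewrite [dot (- x) l]dotC dotNr opprK.
Qed.

Lemma modulus_ft u l : cintegrable leb u ->
  modulus (ft u l) <= \int[leb]_x modulus (u x).
Proof.
move=> Iu; apply: modulus_cintegral_le; [|exact: integrable_modulus|].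
  exact: cintegrable_measurable (cintegrable_ft l Iu).
by move=> x; rewrite modulusM modulus_expi mulr1.
Qed.

Lemma modulus_ift h x : cintegrable leb h ->
  modulus (ift h x) <= \int[leb]_l modulus (h l).
Proof. by move=> Ih; rewrite iftE modulus_ft. Qed.

Lemma ftD u1 u2 l : cintegrable leb u1 -> cintegrable leb u2 ->
  ft (fun x => u1 x + u2 x) l = ft u1 l + ft u2 l.
Proof.
move=> I1 I2; rewrite -cintegralD; [|exact: cintegrable_ft..].
by apply: eq_cintegral => x; rewrite mulrDl.
Qed.

Lemma ftZ a u l : cintegrable leb u -> ft (fun x => a * u x) l = a * ft u l.
Proof.
move=> Iu; rewrite -cintegralZ; last exact: cintegrable_ft.
by apply: eq_cintegral => x; rewrite mulrA.
Qed.

Lemma iftD u1 u2 x : cintegrable leb u1 -> cintegrable leb u2 ->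
  ift (fun x => u1 x + u2 x) x = ift u1 x + ift u2 x.
Proof. by move=> *; rewrite !iftE ftD. Qed.

Lemma iftZ a u x : cintegrable leb u -> ift (fun x => a * u x) x = a * ift u x.
Proof. by move=> *; rewrite !iftE ftZ. Qed.

(** An integral with a parameter is measurable by Fubini once the integrand is integrable on the
    product. The factor [weight x] makes it so and is divided out afterwards. *)
Lemma cmeasurable_ift h : cintegrable leb h -> cmeasurable (ift h).
Proof.
move=> Ih.
have mF : cmeasurable (fun z : 'rV[R]_d * 'rV[R]_d =>
    (weight z.1)%:C%C * (h z.2 * expi (dot z.2 z.1))).
  have mw : measurable_fun setT (@weight R d).
    by case/integrableP : (@integrable_weight R d) => /measurable_EFinP.
  apply: cmeasurableM; first exact/cmeasurable_real/measurableT_comp.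
  apply: cmeasurableM.
    by apply: cmeasurableT_comp => //; exact: cintegrable_measurable Ih.
  exact/cmeasurable_expi/measurable_dot.
have [|_ Iw _ _] := cintegral_fubini mF (@integrable_weight R d)
  (integrable_modulus Ih).
  move=> x l /=; rewrite 2!modulusM modulus_real modulus_expi mulr1.
  by rewrite ger0_norm// weight_ge0.
rewrite (_ : ift h = fun x => \prod_j (oneDsqr (x ord0 j))%:C%C *
    cintegral leb (fun l => (weight x)%:C%C * (h l * expi (dot l x)))).
  apply: cmeasurableM; last exact: cintegrable_measurable Iw.
  apply: cmeasurable_prod => j; apply: cmeasurable_real.
  apply: (measurableT_comp _ (@measurable_coord R d j)).
  by apply: continuous_measurable_fun; exact: continuous_oneDsqr.
apply/funext => x; rewrite cintegralZ; last exact: cintegrable_ift.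
rewrite mulrA -rmorph_prod -rmorphM/= /weight -big_split/= big1 ?mul1r// => j _.
by rewrite divff// gt_eqF// oneDsqr_gt0.
Qed.

End fourier_operators.

(** * The Poisson kernel as transform of the Abel factor *)

Section poisson_kernel.
Context (R : realType).
Local Notation leb := (@lebesgue_measure R).
Implicit Types (e t l : R).

(** exp(et) >= (1 + et/2)^2 >= 1 + (et)^2/4, and the constant is chosen so that its product with the
    last term is at least 1 + t^2. *)
Lemma expRN_le e : 0 < e -> forall t, 0 <= t ->
  expR (- e * t) <= (1 + 4 / e ^+ 2) * (oneDsqr t)^-1.
Proof.
move=> e0 t t0; rewrite mulNr expRN ler_pdivlMr ?oneDsqr_gt0//.
rewrite mulrC ler_pdivrMr ?expR_gt0//.
have et0 : 0 <= e * t by rewrite mulr_ge0// ltW.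
have h : 1 + (e * t) ^+ 2 / 4 <= expR (e * t).
  rewrite (_ : e * t = e * t / 2 + e * t / 2); last by rewrite -splitr.
  rewrite expRD.
  have h2 := expR_ge1Dx (e * t / 2).
  have p : 0 <= 1 + e * t / 2 by rewrite addr_ge0// divr_ge0.
  apply: le_trans (ler_pM p p h2 h2); rewrite -splitr.
  rewrite -subr_ge0 (_ : _ - _ = e * t) //; by field.
have c0 : 0 <= 1 + 4 / e ^+ 2 by rewrite addr_ge0// divr_ge0// sqr_ge0.
apply: le_trans (ler_wpM2l c0 h).
rewrite /oneDsqr -subr_ge0 (_ : _ - _ = 4 / e ^+ 2 + (e * t) ^+ 2 / 4).
  by rewrite addr_ge0// divr_ge0// sqr_ge0.
by field; rewrite gt_eqF.
Qed.

Definition abel e l : R := expR (- e * `|l|).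

Lemma continuous_abel e : continuous (abel e).
Proof.
move=> l; apply: continuous_comp; last exact: continuous_expR.
by apply: cvgMr; exact: norm_continuous.
Qed.

Lemma abel_le e l : 0 < e ->
  `|abel e l| <= (1 + 4 / e ^+ 2) * (oneDsqr l)^-1.
Proof.
move=> e0; rewrite gtr0_norm ?expR_gt0// (le_trans (expRN_le e0 (normr_ge0 l)))//.
by rewrite /oneDsqr real_normK// num_real.
Qed.

Lemma abel_le1 e l : 0 < e -> abel e l <= 1.
Proof. by move=> e0; rewrite -expR0 ler_expR mulNr oppr_le0 mulr_ge0// ltW. Qed.

Lemma integrable_abel e : 0 < e -> leb.-integrable setT (EFin \o abel e).
Proof.
move=> e0.
apply: le_integrable (integrableZl measurableT (1 + 4 / e ^+ 2)
  (@integrable_oneDsqrV R)) => //.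
  apply/measurable_EFinP; apply: continuous_measurable_fun.
  exact: continuous_abel.
by move=> t _ /=; rewrite lee_fin (le_trans (abel_le t e0))// ler_norm.
Qed.

(* antiderivatives of e^(cl) cos(tl) and e^(cl) sin(tl) *)
Let F c t l : R :=
  expR (c * l) * ((c * cos (t * l) + t * sin (t * l)) / (c ^+ 2 + t ^+ 2)).
Let G c t l : R :=
  expR (c * l) * ((c * sin (t * l) - t * cos (t * l)) / (c ^+ 2 + t ^+ 2)).

Let D_gt0 c t : c != 0 -> 0 < c ^+ 2 + t ^+ 2.
Proof. by move=> c0; rewrite ltr_pwDl ?sqr_ge0// exprn_even_gt0. Qed.

Let F_derive c t l : c != 0 ->
  is_derive l (1 : R) (F c t) (expR (c * l) * cos (t * l)).
Proof.
move=> c0; apply: is_derive_eq.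
rewrite /GRing.scale /=.
by field; rewrite gt_eqF// D_gt0.
Qed.

Let G_derive c t l : c != 0 ->
  is_derive l (1 : R) (G c t) (expR (c * l) * sin (t * l)).
Proof.
move=> c0; apply: is_derive_eq.
rewrite /GRing.scale /=.
by field; rewrite gt_eqF// D_gt0.
Qed.

(** The hypothesis on [c * l] says that the exponential decays on the side of [l]; [a] and [b] stand
    for values of sine and cosine up to sign. *)
Let antiderivative_le c t l (a b : R) : c != 0 -> c * l = - `|c| * `|l| ->
  `|a| <= 1 -> `|b| <= 1 ->
  `|expR (c * l) * ((c * a + t * b) / (c ^+ 2 + t ^+ 2))| <=
  (1 + 4 / `|c| ^+ 2) * (1 + (`|c| + `|t|) / (c ^+ 2 + t ^+ 2)) *
    (oneDsqr l)^-1.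
Proof.
move=> c0 cl a1 b1; have D0 := D_gt0 t c0.
rewrite normrM gtr0_norm ?expR_gt0// mulrAC ler_pM//.
- have := abel_le l (e := `|c|); rewrite normr_gt0 => /(_ c0).
  by rewrite /abel -cl gtr0_norm ?expR_gt0.
- rewrite normrM normfV [`|c ^+ 2 + _|]gtr0_norm//.
  rewrite (@le_trans _ _ ((`|c| + `|t|) / (c ^+ 2 + t ^+ 2))) ?lerDr//.
  apply: ler_wpM2r; first by rewrite invr_ge0 ltW.
  rewrite (le_trans (ler_normD _ _))//.
  by rewrite !normrM lerD// ler_piMr.
Qed.

Let continuousF c t : c != 0 -> continuous (F c t).
Proof.
move=> c0 l; apply: differentiable_continuous; apply/derivable1_diffP.
by case: (F_derive t l c0).
Qed.

Let continuousG c t : c != 0 -> continuous (G c t).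
Proof.
move=> c0 l; apply: differentiable_continuous; apply/derivable1_diffP.
by case: (G_derive t l c0).
Qed.

Let normN1 (a : R) : `|a| <= 1 -> `|- a| <= 1.
Proof. by rewrite normrN. Qed.

(** The antiderivatives are those with [c = - e] on the right half-line and [c = e] on the left one;
    the Poisson kernel is their jump at 0. *)
Lemma cintegral_abel e t : 0 < e ->
  cintegral leb (fun l => (abel e l)%:C%C * expi (l * t)) =
  (2 * e / (e ^+ 2 + t ^+ 2))%:C%C.
Proof.
move=> e0; have en0 : e != 0 by rewrite gt_eqF.
have Nen0 : - e != 0 by rewrite oppr_eq0.
have D0 := D_gt0 t en0.
have eN : `|- e| = e by rewrite normrN gtr0_norm.
have ee : `|e| = e by rewrite gtr0_norm.
pose C := (1 + 4 / e ^+ 2) * (1 + (e + `|t|) / (e ^+ 2 + t ^+ 2)).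
have C1 l : (1 + 4 / e ^+ 2) * (oneDsqr l)^-1 <= C * (oneDsqr l)^-1.
  apply: ler_wpM2r; first by rewrite invr_ge0 ltW// oneDsqr_gt0.
  rewrite /C ler_peMr//.
    by rewrite addr_ge0// divr_ge0// sqr_ge0.
  by rewrite lerDl divr_ge0 ?ltW// ltr_pwDl.
have cw (f : R -> R) l : `|f (t * l)| <= 1 ->
    `|abel e l * f (t * l)| <= C * (oneDsqr l)^-1.
  move=> f1; rewrite normrM (le_trans _ (C1 l))// (le_trans _ (abel_le l e0))//.
  by rewrite ler_piMr.
have cts (f : R -> R) : continuous f -> continuous (fun l => abel e l * f (t * l)).
  move=> cf l; apply: cvgM; first exact: continuous_abel.
  apply: (@cvg_comp _ _ _ ( *%R t) f _ (nbhs (t * l))); last exact: cf.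
  by apply: cvgMr; exact: cvg_id.
apply: complexP => /=.
  transitivity (\int[leb]_l (abel e l * cos (t * l))).
    by apply: eq_Rintegral => l _; rewrite mul0r subr0 [l * t]mulrC.
  transitivity (F e t 0 - F (- e) t 0); last first.
    rewrite /F !mulr0 expR0 sin0 cos0 !mulr0 !addr0 !mulr1 !mul1r sqrrN mulNr opprK.
    by field; rewrite gt_eqF.
  have h1 l : 0 < l -> is_derive l (1 : R) (F (- e) t) (abel e l * cos (t * l)).
    by move=> l0; rewrite /abel gtr0_norm//; exact: F_derive.
  have h2 l : l < 0 -> is_derive l (1 : R) (F e t) (abel e l * cos (t * l)).
    by move=> l0; rewrite /abel ltr0_norm// mulrNN; exact: F_derive.
  have h3 l : 0 <= l -> `|F (- e) t l| <= C * (oneDsqr l)^-1.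
    move=> l0; have := antiderivative_le t (l := l) Nen0 _ (cos_max (t * l)) (sin_max (t * l)).
    by rewrite eN /F !sqrrN (ger0_norm l0); apply.
  have h4 l : l <= 0 -> `|F e t l| <= C * (oneDsqr l)^-1.
    move=> l0; have := antiderivative_le t (l := l) en0 _ (cos_max (t * l)) (sin_max (t * l)).
    by rewrite ee (ler0_norm l0) mulrNN; apply.
  exact: (Rintegral_FTC_split (cts _ (@continuous_cos R)) (@continuousF _ t Nen0)
    (@continuousF _ t en0) h1 h2 (fun l => cw _ l (cos_max _)) h3 h4).
transitivity (\int[leb]_l (abel e l * sin (t * l))).
  by apply: eq_Rintegral => l _; rewrite mul0r addr0 [l * t]mulrC.
transitivity (G e t 0 - G (- e) t 0); last first.
  rewrite /G !mulr0 expR0 sin0 cos0 !mulr0 !sqrrN.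
  by field; rewrite gt_eqF.
have h1 l : 0 < l -> is_derive l (1 : R) (G (- e) t) (abel e l * sin (t * l)).
  by move=> l0; rewrite /abel gtr0_norm//; exact: G_derive.
have h2 l : l < 0 -> is_derive l (1 : R) (G e t) (abel e l * sin (t * l)).
  by move=> l0; rewrite /abel ltr0_norm// mulrNN; exact: G_derive.
have h3 l : 0 <= l -> `|G (- e) t l| <= C * (oneDsqr l)^-1.
  move=> l0; have := antiderivative_le t (l := l) Nen0 _ (sin_max (t * l))
    (normN1 (cos_max (t * l))).
  by rewrite eN /G !sqrrN (ger0_norm l0) mulrN; apply.
have h4 l : l <= 0 -> `|G e t l| <= C * (oneDsqr l)^-1.
  move=> l0; have := antiderivative_le t (l := l) en0 _ (sin_max (t * l))
    (normN1 (cos_max (t * l))).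
  by rewrite ee (ler0_norm l0) mulrNN mulrN; apply.
exact: (Rintegral_FTC_split (cts _ (@continuous_sin R)) (@continuousG _ t Nen0)
  (@continuousG _ t en0) h1 h2 (fun l => cw _ l (sin_max _)) h3 h4).
Qed.

Lemma Rintegral_poisson e x a b : 0 < e -> a < b ->
  \int[leb]_(y in `]a, b]) (2 * e / (e ^+ 2 + (y - x) ^+ 2)) =
  2 * (atan ((b - x) / e) - atan ((a - x) / e)).
Proof.
move=> e0 ab; have en0 : e != 0 by rewrite gt_eqF.
pose H y : R := 2 * atan ((y - x) / e).
have H1 (y : R) : is_derive y (1 : R) H (2 * e / (e ^+ 2 + (y - x) ^+ 2)).
  apply: is_derive_eq.
  rewrite /GRing.scale /=.
  field; rewrite en0/= gt_eqF//= ?D_gt0//.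
have cp : continuous (fun y => 2 * e / (e ^+ 2 + (y - x) ^+ 2)).
  move=> y; apply: cvgM; first exact: cvg_cst.
  apply: cvgV; first by rewrite gt_eqF// D_gt0.
  apply: cvgD; first exact: cvg_cst.
  by apply: cvgM; (apply: cvgB; [exact: cvg_id|exact: cvg_cst]).
rewrite Rintegral_itv_obnd_cbnd.
  rewrite /Rintegral (@continuous_FTC2 _ _ H)//.
  - by rewrite /= mulrBr.
  - exact: continuous_subspaceT.
  - have cH : continuous H.
      move=> y; apply: differentiable_continuous; apply/derivable1_diffP.
      by case: (H1 y).
    split.
    + by move=> y _; case: (H1 y).
    + by apply: cvg_at_right_filter; exact: cH.
    + by apply: cvg_at_left_filter; exact: cH.
  - by move=> y _; rewrite derive1E; have := H1 y => ?; exact: derive_val.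
apply: (@integrableS _ _ _ leb `[a, b]%classic) => //.
  by move=> y /=; rewrite !in_itv/= => /andP[/ltW -> ->].
apply: continuous_compact_integrable; first exact: segment_compact.
exact: continuous_subspaceT.
Qed.

End poisson_kernel.

(** * Half-open boxes *)

Section boxes.
Context (R : realType).

(** A real-valued indicator, so that the indicator of a box is a product. Half-open intervals give
    boxes that are stable under intersection. *)
Definition oc (a b t : R) : R := (a < t <= b)%R%:R.

Definition box d (a b x : 'rV[R]_d) : R :=
  \prod_j oc (a ord0 j) (b ord0 j) (x ord0 j).

Lemma oc_ge0 a b t : 0 <= oc a b t. Proof. exact: ler0n. Qed.

Lemma oc_le1 a b t : oc a b t <= 1. Proof. by rewrite /oc; case: (_ && _). Qed.

Lemma box_ge0 d (a b x : 'rV[R]_d) : 0 <= box a b x.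
Proof. by apply: prodr_ge0 => j _; exact: oc_ge0. Qed.

Lemma box_le1 d (a b x : 'rV[R]_d) : box a b x <= 1.
Proof. by apply: prodr_ile1 => j _; rewrite oc_ge0 oc_le1. Qed.

Lemma oc_patch (f : R -> R) a b : (fun t => oc a b t * f t) = f \_ `]a, b].
Proof.
apply/funext => t; rewrite patchE /oc; have [tab|tab] := boolP (a < t <= b).
  by rewrite mem_set ?mul1r//= in_itv.
by rewrite memNset ?mul0r//= in_itv/=; exact/negP.
Qed.

Let oc_indic a b : oc a b = (cst 1 : R -> R) \_ `]a, b].
Proof. by rewrite -oc_patch; apply/funext => t; rewrite mulr1. Qed.

Lemma measurable_oc a b : measurable_fun setT (oc a b).
Proof. by rewrite oc_indic; apply/(measurable_restrictT _ _).1. Qed.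

Lemma integrable_oc a b : (@lebesgue_measure R).-integrable setT (EFin \o oc a b).
Proof.
rewrite (_ : EFin \o oc a b = (EFin \o (cst 1 : R -> R)) \_ `]a, b]).
  apply/(integrable_mkcond _ _).1 => //.
  apply: (@integrableS _ _ _ (@lebesgue_measure R) `[a, b]%classic) => //.
    by move=> y /=; rewrite !in_itv/= => /andP[/ltW -> ->].
  apply: continuous_compact_integrable; first exact: segment_compact.
  by apply: continuous_subspaceT => x; exact: cvg_cst.
by rewrite oc_indic restrict_EFin.
Qed.

Lemma measurable_box d (a b : 'rV[R]_d) : measurable_fun setT (box a b).
Proof.
have := @cmeasurable_prod _ 'rV[R]_d R _ (index_enum 'I_d)
  (fun j x => (oc (a ord0 j) (b ord0 j) (x ord0 j))%:C%C).
move=> [j|+ _]; first apply: cmeasurable_real.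
  exact: measurableT_comp (measurable_oc _ _) (@measurable_coord R d j).
by under eq_fun do rewrite -rmorph_prod.
Qed.

Lemma integrable_box d (a b : 'rV[R]_d) :
  (lebesgue_rV R d).-integrable setT (EFin \o box a b).
Proof.
by have [] := Rintegral_rV_prod (fun j => integrable_oc (a ord0 j) (b ord0 j)).
Qed.

Lemma cintegral_real d (T : measurableType d) (mu : {measure set T -> \bar R})
  (u : T -> R) : cintegral mu (fun x => (u x)%:C%C) = (\int[mu]_x u x)%:C%C.
Proof. by apply: complexP => //=; rewrite /Rintegral integral0. Qed.

Lemma cintegrable_real d (T : measurableType d) (mu : {measure set T -> \bar R})
  (u : T -> R) : mu.-integrable setT (EFin \o u) ->
  cintegrable mu (fun x => (u x)%:C%C).
Proof. by move=> ?; split; [|exact: integrable0]. Qed.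

Lemma cvg_prod_nat I (r : seq I) (u : I -> nat -> R) (l : I -> R) :
  (forall i, u i @ \oo --> l i) ->
  (fun n => \prod_(i <- r) u i n) @ \oo --> \prod_(i <- r) l i.
Proof.
move=> ul; elim: r => [|i r ih].
  by under eq_fun do rewrite big_nil; rewrite big_nil; exact: cvg_cst.
by under eq_fun do rewrite big_cons; rewrite big_cons; exact: cvgM.
Qed.

Lemma cvg_real_complex T (F : set_system T) {FF : Filter F} (u : T -> R) (l : R) :
  u @ F --> l -> (fun t => (u t)%:C%C : 'C[R]) @ F --> (l%:C%C : 'C[R]).
Proof. by move=> ul; apply/cvg_complexP; split => //=; exact: cvg_cst. Qed.

Let N n : R := n.+1%:R.

(** The quotient equals N(N(c - t) + 1): the shift 1/N outweighs the width 1/N^2, so that at t = c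
    it is N and the limit is pi/2 there too. Hence convergence holds at every point, endpoints
    included. *)
Lemma cvg_atan_shift (c t : R) :
  (fun n => atan ((c + (N n)^-1 - t) / (N n)^-2)) @ \oo -->
  (if t <= c then pi / 2 else - (pi / 2)).
Proof.
have NE (x : R) : x != 0 -> (c + x^-1 - t) / x ^- 2 = x * (x * (c - t) + 1).
  by move=> x0; field.
have Ngt0 n : 0 < N n by rewrite ltr0n.
have cN : N n @[n --> \oo] --> +oo.
  rewrite (cvg_shiftS (fun n => n%:R : R)); exact: cvgr_idn.
under eq_fun do rewrite NE ?pnatr_eq0//.
case: leP => [tc|ct].
  apply: (@cvg_comp _ _ _ (fun n => N n * (N n * (c - t) + 1)) atan _ +oo).
    apply/cvgryPge => A; near=> n.
    rewrite (@le_trans _ _ (N n))//; first by near: n; move: cN => /cvgryPge; exact.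
    by rewrite ler_peMr ?(ltW (Ngt0 n))// lerDr mulr_ge0 ?subr_ge0// (ltW (Ngt0 n)).
  exact: cvgy_atan.
rewrite (_ : (fun _ => _) = fun n => - atan (N n * (N n * (t - c) - 1))); last first.
  apply/funext => n; rewrite -atanN -mulrN; congr (atan (_ * _)).
  by rewrite opprB addrC -mulrN opprB.
apply: cvgN.
apply: (@cvg_comp _ _ _ (fun n => N n * (N n * (t - c) - 1)) atan _ +oo).
  apply/cvgryPge => A; near=> n.
  rewrite (@le_trans _ _ (N n))//; first by near: n; move: cN => /cvgryPge; exact.
  rewrite ler_peMr ?(ltW (Ngt0 n))// lerBrDr -ler_pdivrMr ?subr_gt0//.
  by near: n; move: cN => /cvgryPge; exact.
exact: cvgy_atan.
Unshelve. all: by end_near. Qed.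

End boxes.

(** * Inversion tested on boxes *)

Section inversion.
Context (R : realType) (d : nat).
Local Notation leb := (lebesgue_rV R d).
Variables (u : 'rV[R]_d -> 'C[R]) (a b : 'rV[R]_d).
Hypotheses (Iu : cintegrable leb u) (Ift : cintegrable leb (ft u)).
Hypothesis ab : forall j, a ord0 j < b ord0 j.

Let N n : R := n.+1%:R.
Let N_gt0 n : 0 < N n. Proof. by rewrite ltr0n. Qed.
Let e n : R := (N n)^-2.
Let e_gt0 n : 0 < e n. Proof. by rewrite invr_gt0 exprn_gt0. Qed.

Let K n (l : 'rV[R]_d) : R := \prod_j abel (e n) (l ord0 j).

Let K_ge0 n l : 0 <= K n l.
Proof. by apply: prodr_ge0 => j _; exact: expR_ge0. Qed.

Let K_le1 n l : K n l <= 1.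
Proof. by apply: prodr_ile1 => j _; rewrite expR_ge0 abel_le1. Qed.

Let IK n : leb.-integrable setT (EFin \o K n).
Proof. by have [] := Rintegral_rV_prod (fun _ : 'I_d => integrable_abel (e_gt0 n)). Qed.

Let cvgK l : (fun n => K n l) @ \oo --> (1 : R).
Proof.
rewrite (_ : 1 = \prod_(j < d) 1); last by rewrite big1.
apply: cvg_prod_nat => j; rewrite -expR0.
apply: (@cvg_comp _ _ _ (fun n => - e n * `|l ord0 j|) expR _ (nbhs (0 : R))); last first.
  exact: continuous_expR.
rewrite -(mul0r `|l ord0 j|); apply: cvgMl; rewrite -oppr0; apply: cvgN.
rewrite (_ : e = fun n => n.+1%:R^-1 * n.+1%:R^-1); last first.
  by apply/funext => n; rewrite -expr2 exprVn.
by rewrite -(mulr0 0); apply: cvgM; exact: cvg_harmonic.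
Qed.

(** A product of Poisson kernels of width [e n], each of total mass 2 pi; it is the transform of the
    Abel factor [K n]. *)
Let p n (z : 'rV[R]_d) : R := \prod_j (2 * e n / (e n ^+ 2 + z ord0 j ^+ 2)).

Let D_gt0 n (t : R) : 0 < e n ^+ 2 + t ^+ 2.
Proof. by rewrite ltr_pwDl ?sqr_ge0// exprn_gt0. Qed.

Let pfactor_ge0 n t : 0 <= 2 * e n / (e n ^+ 2 + t ^+ 2).
Proof. by rewrite divr_ge0 ?(ltW (D_gt0 _ _))// mulr_ge0// (ltW (e_gt0 n)). Qed.

Let p_ge0 n z : 0 <= p n z.
Proof. by apply: prodr_ge0 => j _; exact: pfactor_ge0. Qed.

Let pfactor_le n t : 2 * e n / (e n ^+ 2 + t ^+ 2) <= 2 / e n.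
Proof.
rewrite ler_pdivrMr// mulrDr -subr_ge0 (_ : _ - _ = 2 / e n * t ^+ 2).
  by rewrite mulr_ge0 ?sqr_ge0// divr_ge0// (ltW (e_gt0 n)).
by field; rewrite gt_eqF.
Qed.

Let p_le n z : p n z <= (2 / e n) ^+ d.
Proof.
rewrite -[in leRHS](card_ord d) -prodr_const; apply: ler_prod => j _.
by rewrite pfactor_ge0 pfactor_le.
Qed.

Let measurable_pfactor n : measurable_fun setT (fun t : R => 2 * e n / (e n ^+ 2 + t ^+ 2)).
Proof.
apply: continuous_measurable_fun => t; apply: cvgM; first exact: cvg_cst.
apply: cvgV; first by rewrite gt_eqF.
apply: cvgD; first exact: cvg_cst.
by apply: cvgM; exact: cvg_id.
Qed.

Let measurable_p n : measurable_fun setT (p n).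
Proof.
apply: measurable_prod => j _.
exact: (measurableT_comp (measurable_pfactor n) (@measurable_coord R d j)).
Qed.

Let pE n z : cintegral leb (fun l => (K n l)%:C%C * expi (dot l z)) = (p n z)%:C%C.
Proof.
have Ij (j : 'I_d) : cintegrable (@lebesgue_measure R)
    (fun t => (abel (e n) t)%:C%C * expi (t * z ord0 j)).
  apply: (@cintegrableM _ _ _ _ _ _ 1).
  - exact/cintegrable_real/integrable_abel.
  - by apply: cmeasurable_expi; exact: measurable_funM.
  - by move=> t; rewrite modulus_expi.
have [_] := cintegral_rV_prod Ij.
under eq_bigr do rewrite cintegral_abel//.
rewrite -rmorph_prod => <-; apply: eq_cintegral => l.
by rewrite expi_sum rmorph_prod -big_split.
Qed.

Let an n : 'rV[R]_d := \row_j (a ord0 j + (N n)^-1).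
Let bn n : 'rV[R]_d := \row_j (b ord0 j + (N n)^-1).

Let Q n (x : 'rV[R]_d) : R := \prod_j (2 *
  (atan ((b ord0 j + (N n)^-1 - x ord0 j) / e n) -
   atan ((a ord0 j + (N n)^-1 - x ord0 j) / e n))).

Let QE n x : cintegral leb (fun y => (box (an n) (bn n) y)%:C%C * (p n (y - x))%:C%C) =
  (Q n x)%:C%C.
Proof.
pose g (j : 'I_d) (t : R) := oc (an n ord0 j) (bn n ord0 j) t *
  (2 * e n / (e n ^+ 2 + (t - x ord0 j) ^+ 2)).
have Ig j : (@lebesgue_measure R).-integrable setT (EFin \o g j).
  apply: le_integrable (integrableZl measurableT (2 / e n)
    (integrable_oc (an n ord0 j) (bn n ord0 j))) => //.
    apply/measurable_EFinP; apply: measurable_funM; first exact: measurable_oc.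
    apply: (measurableT_comp (measurable_pfactor n)).
    exact: measurable_funB.
  move=> t _; rewrite /= lee_fin /g normrM (ger0_norm (pfactor_ge0 n _)).
  rewrite (ger0_norm (oc_ge0 _ _ _)) (le_trans _ (ler_norm _))// mulrC.
  by rewrite ler_wpM2r// oc_ge0.
rewrite (@eq_cintegral _ _ _ _ _ (fun y : 'rV[R]_d => (\prod_j g j (y ord0 j))%:C%C)); last first.
  move=> y; rewrite -rmorphM -big_split; congr (_%:C)%C.
  by apply: eq_bigr => j _; rewrite /g !mxE.
rewrite cintegral_real (Rintegral_rV_prod Ig).2; congr (_%:C)%C.
apply: eq_bigr => j _; rewrite /g oc_patch -Rintegral_mkcond Rintegral_poisson ?mxE//.
by rewrite ltrD2r.
Qed.

Let exchange1 n y :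
  cintegral leb (fun l => (K n l)%:C%C * ft u l * expi (dot l y)) =
  cintegral leb (fun x => u x * (p n (y - x))%:C%C).
Proof.
have IKe : cintegrable leb (fun l => (K n l)%:C%C * expi (dot l y)).
  by apply: cintegrable_ift; exact: cintegrable_real.
have mk : cmeasurable (fun z : 'rV[R]_d * 'rV[R]_d => expi (- dot z.1 z.2)).
  by apply/cmeasurable_expi/measurableT_comp => //; exact: measurable_dot.
transitivity (cintegral leb (fun l => (K n l)%:C%C * expi (dot l y) *
    cintegral leb (fun x => u x * expi (- dot (l, x).1 (l, x).2)))).
  by apply: eq_cintegral => l; rewrite mulrAC.
rewrite (cintegral_exchange IKe Iu mk (M := 1)); last first.
  by move=> z; rewrite modulus_expi.
apply: eq_cintegral => x; congr (_ * _); rewrite -pE.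
apply: eq_cintegral => l; rewrite /= -mulrA -expiD; congr (_ * expi _).
by rewrite dotDr dotNr.
Qed.

(** The Abel-regularised inversion integral over the shifted box. Its limit is computed twice: with
    the Abel factor carried over to [u] as a Poisson kernel ([lim1]), and by letting the factor tend
    to 1 under the integral ([lim2]). *)
Let I n := cintegral leb (fun y => (box (an n) (bn n) y)%:C%C *
  cintegral leb (fun l => (K n l)%:C%C * ft u l * expi (dot l y))).

Let exchange2 n : I n = cintegral leb (fun x => u x * (Q n x)%:C%C).
Proof.
have IB : cintegrable leb (fun y => (box (an n) (bn n) y)%:C%C).
  by apply: cintegrable_real; exact: integrable_box.
have mk : cmeasurable (fun z : 'rV[R]_d * 'rV[R]_d => (p n (z.1 - z.2))%:C%C).
  apply: cmeasurable_real; apply: (measurableT_comp (measurable_p n)).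
  apply: measurable_fun_coordP => i; under eq_fun do rewrite !mxE.
  apply: measurable_funB.
    exact: (measurableT_comp (@measurable_coord R d i) measurable_fst).
  exact: (measurableT_comp (@measurable_coord R d i) measurable_snd).
transitivity (cintegral leb (fun y => (box (an n) (bn n) y)%:C%C *
    cintegral leb (fun x => u x * (p n ((y, x).1 - (y, x).2))%:C%C))).
  by apply: eq_cintegral => y; rewrite exchange1.
rewrite (cintegral_exchange IB Iu mk (M := (2 / e n) ^+ d)); last first.
  by move=> z; rewrite modulus_real ger0_norm.
by apply: eq_cintegral => x; rewrite -QE.
Qed.

Let measurable_atan_shift (c : R) n (j : 'I_d) :
  measurable_fun setT (fun x : 'rV[R]_d => atan ((c + (N n)^-1 - x ord0 j) / e n)).
Proof.
apply: measurableT_comp.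
  by apply: continuous_measurable_fun; exact: continuous_atan.
apply: measurable_funM => //; apply: measurable_funB => //.
exact: (@measurable_coord R d j).
Qed.

Let measurable_Q n : measurable_fun setT (Q n).
Proof.
apply: measurable_prod => j _; apply: measurable_funM => //.
by apply: measurable_funB; exact: measurable_atan_shift.
Qed.

Let Q_le n x : `|Q n x| <= (2 * pi) ^+ d.
Proof.
rewrite normr_prod -[in leRHS](card_ord d) -prodr_const; apply: ler_prod => j _.
rewrite normr_ge0/= normrM ger0_norm// ler_pM2l//.
rewrite (splitr pi) (le_trans (ler_normB _ _))// lerD// ler_norml.
  by rewrite !ltW ?atan_gtNpi2 ?atan_ltpi2.
by rewrite !ltW ?atan_gtNpi2 ?atan_ltpi2.
Qed.

Let cvgQ x : (fun n => Q n x) @ \oo --> (2 * pi) ^+ d * box a b x.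
Proof.
have -> : (2 * pi) ^+ d * box a b x =
    \prod_j (2 * pi * oc (a ord0 j) (b ord0 j) (x ord0 j)).
  by rewrite big_split prodr_const card_ord.
apply: cvg_prod_nat => j.
rewrite (_ : 2 * pi * oc _ _ _ = 2 * ((if x ord0 j <= b ord0 j then pi / 2 else - (pi / 2)) -
    (if x ord0 j <= a ord0 j then pi / 2 else - (pi / 2)))).
  apply: cvgMr; apply: cvgB; exact: cvg_atan_shift.
rewrite /oc; have abj := ab j.
case: (leP (x ord0 j) (a ord0 j)) => [xa|ax] /=.
  by rewrite (le_trans xa (ltW abj)) mulr0 subrr mulr0.
by case: ifP => _; [rewrite mulr1; field|rewrite mulr0 subrr mulr0].
Qed.

Let lim1 : I @ \oo --> cintegral leb (fun x => u x * ((2 * pi) ^+ d * box a b x)%:C%C).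
Proof.
rewrite (funext exchange2).
apply: (@dominated_cintegral _ _ _ _ _ _ (fun x => (2 * pi) ^+ d * modulus (u x))).
- move=> n; apply: cmeasurableM; first exact: cintegrable_measurable Iu.
  exact: cmeasurable_real.
- apply: cmeasurableM; first exact: cintegrable_measurable Iu.
  by apply: cmeasurable_real; apply: measurable_funM => //; exact: measurable_box.
- by move=> x; apply: cvgM; [exact: cvg_cst|apply: cvg_real_complex; exact: cvgQ].
- exact: integrableZl (integrable_modulus Iu).
- by move=> n x; rewrite modulusM mulrC modulus_real ler_wpM2r ?modulus_ge0.
Qed.

(** The shifts are at most 1, so the box from [a] to [b1] contains all shifted boxes and provides a
    dominating function. *)
Let b1 : 'rV[R]_d := \row_j (b ord0 j + 1).

Let box_le n y : box (an n) (bn n) y <= box a b1 y.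
Proof.
apply: ler_prod => j _; rewrite oc_ge0/= /oc !mxE.
case: (boolP (_ < _ <= _)) => // /andP[h1 h2].
rewrite (lt_trans _ h1) ?ltrDl ?invr_gt0//= (le_trans h2)//.
by rewrite lerD2l invf_le1// ler1n.
Qed.

(** At each point the indicators are eventually constant. Half-openness settles the endpoints:
    [a ord0 j] lies outside every shifted interval, [b ord0 j] eventually inside. *)
Let cvg_box y : (fun n => box (an n) (bn n) y) @ \oo --> box a b y.
Proof.
apply: cvg_prod_nat => j; apply: cvg_near_cst; rewrite /oc.
have cN : (fun n => (N n)^-1) @ \oo --> (0 : R) by exact: cvg_harmonic.
case: (ltP (a ord0 j) (y ord0 j)) => /= [ay|ya]; last first.
  by apply: nearW => n; rewrite !mxE ltNge (le_trans ya) ?lerDl ?invr_ge0.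
have d0 : 0 < y ord0 j - a ord0 j by rewrite subr_gt0.
have : \forall n \near \oo, (N n)^-1 < y ord0 j - a ord0 j.
  by move/cvgrPdist_lt : cN => /(_ _ d0); apply: filterS => n;
    rewrite sub0r normrN ger0_norm// invr_ge0.
case: (leP (y ord0 j) (b ord0 j)) => [yb|byj].
  apply: filterS => n h; rewrite !mxE -ltrBrDl h/= (le_trans yb)//.
  by rewrite lerDl invr_ge0.
have d1 : 0 < y ord0 j - b ord0 j by rewrite subr_gt0.
move=> _; move/cvgrPdist_lt : cN => /(_ _ d1); apply: filterS => n.
rewrite sub0r normrN ger0_norm ?invr_ge0// !mxE => h.
have -> : (y ord0 j <= b ord0 j + (N n)^-1) = false.
  by apply/negbTE; rewrite -ltNge -ltrBrDl.
by rewrite andbF.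
Qed.

Let Ih n : cintegrable leb (fun l => (K n l)%:C%C * ft u l).
Proof.
under eq_fun do rewrite mulrC.
apply: (@cintegrableM _ _ _ _ _ _ 1) => //.
  by apply: cmeasurable_real; case/integrableP : (IK n) => /measurable_EFinP.
by move=> l; rewrite modulus_real ger0_norm.
Qed.

Let lim2 : I @ \oo --> cintegral leb (fun y => (box a b y)%:C%C * ift (ft u) y).
Proof.
pose c := \int[leb]_l modulus (ft u l).
have c0 : 0 <= c by apply: Rintegral_ge0 => l _; exact: modulus_ge0.
apply: (@dominated_cintegral _ _ _ _ _ _ (fun y => c * box a b1 y)).
- move=> n; apply: cmeasurableM.
    by apply: cmeasurable_real; exact: measurable_box.
  exact: (cmeasurable_ift (Ih n)).
- apply: cmeasurableM; last exact: cmeasurable_ift.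
  by apply: cmeasurable_real; exact: measurable_box.
- move=> y; apply: cvgM; first by apply: cvg_real_complex; exact: cvg_box.
  apply: (@dominated_cintegral _ _ _ _ _ _ (fun l => modulus (ft u l))).
  + by move=> n; apply: cintegrable_measurable; exact: cintegrable_ift (Ih n).
  + by apply: cintegrable_measurable; exact: cintegrable_ift Ift.
  + move=> l; apply: cvgM; last exact: cvg_cst.
    rewrite -[X in _ --> X]mul1r; apply: cvgM; last exact: cvg_cst.
    exact: cvg_real_complex (cvgK l).
  + exact: integrable_modulus.
  + move=> n l; rewrite 2!modulusM modulus_expi mulr1 modulus_real ger0_norm//.
    by rewrite ler_piMl// modulus_ge0.
- exact: integrableZl (integrable_box _ _).
- move=> n y; rewrite modulusM modulus_real (ger0_norm (box_ge0 _ _ _)) mulrC.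
  rewrite ler_pM ?modulus_ge0 ?box_ge0//.
  apply: modulus_cintegral_le.
  + by apply: cintegrable_measurable; exact: cintegrable_ift (Ih n).
  + exact: integrable_modulus.
  + move=> l; rewrite 2!modulusM modulus_expi mulr1 modulus_real ger0_norm//.
    by rewrite ler_piMl// modulus_ge0.
Qed.

(** Both sides are limits of the sequence [I]. *)
Lemma ift_ft_box :
  cintegral leb (fun y => (box a b y)%:C%C * ift (ft u) y) =
  ((2 * pi) ^+ d)%:C%C * cintegral leb (fun x => (box a b x)%:C%C * u x).
Proof.
rewrite -cintegralZ.
  transitivity (cintegral leb (fun x => u x * ((2 * pi) ^+ d * box a b x)%:C%C)).
    exact: (cvg_unique _ lim2 lim1).
  by apply: eq_cintegral => x; rewrite rmorphM mulrC mulrA.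
under eq_fun do rewrite mulrC.
apply: (@cintegrableM _ _ _ _ _ _ 1) => //.
  by apply: cmeasurable_real; exact: measurable_box.
by move=> x; rewrite modulus_real (ger0_norm (box_ge0 _ _ _)) box_le1.
Qed.

End inversion.

(** * From boxes to equality almost everywhere *)

Section integral_boxes.
Context (R : realType) (d : nat).
Local Notation leb := (lebesgue_rV R d).

Let setbox (a b : 'rV[R]_d) : set 'rV[R]_d :=
  [set x | forall j, a ord0 j < x ord0 j <= b ord0 j].

Let boxes : set (set 'rV[R]_d) := [set setbox p.1 p.2 | p in setT].

Let box_indic (a b x : 'rV[R]_d) : box a b x = \1_(setbox a b) x.
Proof.
rewrite indicE; have [/set_mem h|/negP h] := boolP (x \in setbox a b).
  by rewrite /box big1// => j _; rewrite /oc h.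
have [j /negbTE jh] : exists j, ~~ (a ord0 j < x ord0 j <= b ord0 j).
  apply/existsP; rewrite -negb_forall; apply/negP => /forallP f.
  by apply: h; apply/mem_set.
by rewrite /box (bigD1 j)//= /oc jh mul0r.
Qed.

Let setI_boxes : setI_closed boxes.
Proof.
move=> _ _ [[a b] _ <-] [[a' b'] _ <-].
exists (\row_j Num.max (a ord0 j) (a' ord0 j), \row_j Num.min (b ord0 j) (b' ord0 j)) => //.
apply/seteqP; split=> [x h|x [h h']].
  split=> j; have := h j; rewrite /= !mxE gt_max le_min.
    by move=> /andP[/andP[-> _] /andP[-> _]].
  by move=> /andP[/andP[_ ->] /andP[_ ->]].
move=> j; rewrite /= !mxE gt_max le_min.
by have /andP[-> ->] := h j; have /andP[-> ->] := h' j.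
Qed.

Let bigcup_setbox : \bigcup_n setbox (const_mx (- n%:R)) (const_mx n%:R) = setT.
Proof.
apply/seteqP; split=> // x _.
pose M := \sum_j `|x ord0 j|.
exists (Num.bound M) => // j; rewrite !mxE.
have xM : `|x ord0 j| < (Num.bound M)%:R.
  rewrite (le_lt_trans _ (archi_boundP _)) ?sumr_ge0//.
  by rewrite /M (bigD1 j)//= lerDl sumr_ge0.
move: xM; rewrite ltr_norml => /andP[-> /ltW ->] //.
Qed.

(** The sets of reals whose preimage under a coordinate is generated by boxes form a sigma-algebra;
    it contains the half-open intervals, because a slab is a countable union of boxes. *)
Let measurable_boxes : (rV_display default_measure_display).-measurable `<=` <<s boxes >>.
Proof.
apply: smallest_sub; first exact: smallest_sigma_algebra.
rewrite -bigcup_seq; apply: bigcup_sub => j _ A [B mB <-]; rewrite setTI.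
suff: (@measurable _ (measurableTypeR R)) `<=`
    [set B | <<s boxes >> ((fun x : 'rV[R]_d => x ord0 j) @^-1` B)] by apply.
apply: smallest_sub.
  split.
  - by rewrite /= preimage_set0; exact: sigma_algebra0.
  - move=> C mC; rewrite /= setTD preimage_setC -setTD.
    exact: sigma_algebraCD.
  - by move=> F mF; rewrite /= preimage_bigcup; exact: sigma_algebra_bigcup.
move=> _ [[p q] _ <-] /=.
rewrite (_ : _ @^-1` _ = \bigcup_n setbox
    (\row_i (if i == j then p else - n%:R)) (\row_i (if i == j then q else n%:R))).
  by apply: sigma_algebra_bigcup => n; apply: sub_sigma_algebra; eexists (_, _).
apply/seteqP; split=> [x /=|x [n _ /(_ j)]]; last first.
  by rewrite !mxE eqxx /= in_itv.
rewrite in_itv/= => xpq.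
have := bigcup_setbox; rewrite -subTset => /(_ x I)[n _ h].
exists n => // i; rewrite !mxE; case: eqP => [->//|_].
by have := h i; rewrite !mxE.
Qed.

Let measurable_setbox a b : measurable (setbox a b).
Proof.
rewrite (_ : setbox a b = \bigcap_(j in [set: 'I_d])
    ((fun x : 'rV[R]_d => x ord0 j) @^-1` `]a ord0 j, b ord0 j])).
  apply: fin_bigcap_measurable => [|j _]; first exact: finite_finset.
  by rewrite -[X in measurable X]setTI; apply: measurable_coord.
by apply/seteqP; split=> x h j; have := h j; rewrite /= in_itv/=; [|apply].
Qed.

(** Pi-lambda theorem: the measurable sets over which [w] integrates to 0 form a lambda-system, and
    the boxes are stable under intersection and generate. Vanishing integrals over all measurable
    sets give [w = 0] almost everywhere. *)
Lemma ae_eq_box_real (w : 'rV[R]_d -> R) : leb.-integrable setT (EFin \o w) ->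
  (forall a b, \int[leb]_x (box a b x * w x) = 0) ->
  {ae leb, forall x, w x = 0}.
Proof.
move=> Iw w0.
have IA A : measurable A -> leb.-integrable A (EFin \o w).
  by move=> mA; exact: integrableS Iw.
suff h A : measurable A -> \int[leb]_(x in A) w x = 0.
  have := @integral_ae_eq _ _ _ leb setT measurableT (cst 0%E) (EFin \o w) Iw.
  move=> /(_ _ _)/filterS; apply => //.
  - by move=> x /(_ I)[].
  - move=> E _ mE; rewrite integral0 -[LHS]fineK ?integrable_fin_num ?IA//.
    by congr EFin; exact: h.
(* Dominated convergence along increasing unions; it yields both the whole space, exhausted by
   boxes, and the closure condition of a lambda-system. *)
have lim F : nondecreasing_seq F -> (forall n, measurable (F n)) ->
    (forall n, \int[leb]_(x in F n) w x = 0) ->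
    \int[leb]_(x in \bigcup_n F n) w x = 0.
  move=> ndF mF F0.
  have mw : measurable_fun setT w by case/integrableP : Iw => /measurable_EFinP.
  have mU : measurable (\bigcup_n F n) by exact: bigcupT_measurable.
  have : (fun n => \int[leb]_x (w \_ (F n)) x) @ \oo -->
      \int[leb]_x (w \_ (\bigcup_n F n)) x.
    apply: (@dominated_Rintegral _ _ _ leb _ _ (fun x => `|w x|)).
    - by move=> n; apply/(measurable_restrictT _ _).1 => //; exact: measurable_funTS.
    - by apply/(measurable_restrictT _ _).1 => //; exact: measurable_funTS.
    - move=> x; apply: cvg_near_cst; rewrite patchE; case: ifPn => [/set_mem[k _ Fk]|xF].
        exists k => // n /= kn; rewrite patchE mem_set//.
        by move: Fk; apply/subsetPset/ndF.
      apply: nearW => n; rewrite patchE memNset// => Fn.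
      by move/negP : xF; apply; apply/mem_set; exists n.
    - exact: integrable_abse Iw.
    - by move=> n x; rewrite patchE; case: ifP => //; rewrite normr0.
  rewrite -Rintegral_mkcond => wF.
  have wF0 : (fun n => \int[leb]_x (w \_ (F n)) x) @ \oo --> (0 : R).
    by under eq_fun do rewrite -Rintegral_mkcond F0; exact: cvg_cst.
  exact: (cvg_unique _ wF wF0).
move/measurable_boxes.
pose L := [set A | measurable A /\ \int[leb]_(x in A) w x = 0].
have LB a b : L (setbox a b).
  split; first exact: measurable_setbox.
  rewrite -(w0 a b) Rintegral_mkcond; apply: eq_Rintegral => x _.
  by rewrite patchE box_indic indicE; case: ifP => _; rewrite ?mul1r ?mul0r.
suff LL : lambda_system setT L.
  move=> sA; suff [] : L A by [].
  apply: (lambda_system_subset setI_boxes LL) sA => //.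
  by move=> _ [[a b] _ <-]; exact: LB.
split => //.
- split=> //; rewrite -bigcup_setbox; apply: lim.
  + move=> n m nm; apply/subsetPset => x h j; have := h j; rewrite !mxE.
    have nmR : n%:R <= m%:R :> R by rewrite ler_nat.
    by move=> /andP[h1 h2]; rewrite (le_lt_trans _ h1) ?lerN2//= (le_trans h2).
  + by move=> n; exact: measurable_setbox.
  + by move=> n; have [_] := LB (const_mx (- n%:R)) (const_mx n%:R).
- move=> {}A B BA [mA A0] [mB B0]; split; first exact: measurableD.
  have AE : A = (A `\` B) `|` B by rewrite setUC setDUK.
  have := @Rintegral_setU _ _ _ leb (A `\` B) B w (measurableD mA mB) mB.
  rewrite -AE A0 B0 addr0 => /(_ (IA _ mA)) <-//.
  by apply/disj_setPS => x [[_ nB] /nB].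
- move=> F ndF LF; split; first by apply: bigcupT_measurable => n; case: (LF n).
  by apply: lim => // n; case: (LF n).
Qed.

Lemma ae_eq_box (u v : 'rV[R]_d -> 'C[R]) : cintegrable leb u -> cintegrable leb v ->
  (forall a b : 'rV[R]_d, (forall j, a ord0 j < b ord0 j) ->
    cintegral leb (fun x => (box a b x)%:C%C * u x) =
    cintegral leb (fun x => (box a b x)%:C%C * v x)) ->
  {ae leb, forall x, u x = v x}.
Proof.
move=> Iu Iv uv.
have Iw := cintegrableB Iu Iv.
have Ibox f a b : cintegrable leb f -> cintegrable leb (fun x => (box a b x)%:C%C * f x).
  move=> If; under eq_fun do rewrite mulrC.
  apply: (@cintegrableM _ _ _ _ _ _ 1) => //.
    by apply: cmeasurable_real; exact: measurable_box.
  by move=> x; rewrite modulus_real (ger0_norm (box_ge0 _ _ _)) box_le1.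
have w0 a b : cintegral leb (fun x => (box a b x)%:C%C * (u x - v x)) = 0.
  have [/forallP ab|] := boolP [forall j, a ord0 j < b ord0 j].
    under [X in cintegral _ X]eq_fun do rewrite mulrBr.
    by rewrite cintegralB; [rewrite uv ?subrr|exact: Ibox..].
  (* A box with [b ord0 j <= a ord0 j] for some j is empty, so its indicator is 0. *)
  rewrite negb_forall => /existsP[j]; rewrite -leNgt => ba.
  rewrite -[RHS](cintegral0 leb); apply: eq_cintegral => x.
  rewrite (_ : box a b x = 0) ?mul0r// /box (bigD1 j)//= /oc.
  by case: ltP => //= ax; rewrite ?mul0r// leNgt (le_lt_trans ba ax) mul0r.
have [IR II] := Iw.
have R0 := ae_eq_box_real IR _; have I0 := ae_eq_box_real II _.
apply: filterS2 (R0 _) (I0 _) => [x xR xI|a b|a b].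
- by apply/eqP; rewrite -subr_eq0; apply/eqP; exact: complexP.
- have := congr1 (@complex.Re _) (w0 a b) => /= <-; apply: eq_Rintegral => x _.
  by rewrite ReM /= mul0r subr0.
- have := congr1 (@complex.Im _) (w0 a b) => /= <-; apply: eq_Rintegral => x _.
  by rewrite ImM /= mul0r addr0.
Qed.

Lemma ift_ft (u : 'rV[R]_d -> 'C[R]) : cintegrable leb u ->
  cintegrable leb (ft u) -> cintegrable leb (ift (ft u)) ->
  {ae leb, forall x, ift (ft u) x = ((2 * pi) ^+ d)%:C%C * u x}.
Proof.
move=> Iu If Ii; apply: ae_eq_box => //; first exact: cintegrableZ.
move=> a b ab; rewrite ift_ft_box//.
rewrite -cintegralZ; first by apply: eq_cintegral => x; rewrite mulrCA.
under eq_fun do rewrite mulrC.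
apply: (@cintegrableM _ _ _ _ _ _ 1) => //.
  by apply: cmeasurable_real; exact: measurable_box.
by move=> x; rewrite modulus_real (ger0_norm (box_ge0 _ _ _)) box_le1.
Qed.

(** Inversion for [ft u = 0]: the transform and its inverse transform are integrable because they
    vanish. *)
Lemma ft_inj (u : 'rV[R]_d -> 'C[R]) : cintegrable leb u ->
  (forall l, ft u l = 0) -> {ae leb, forall x, u x = 0}.
Proof.
move=> Iu u0; have ft0 : ft u = fun _ => 0 by exact/funext.
have ift0 : ift (ft u) = fun _ => 0.
  apply/funext => x; rewrite ft0 -[RHS](cintegral0 leb).
  by apply: eq_cintegral => l; rewrite mul0r.
have := @ift_ft u Iu; rewrite ift0 ft0 => /(_ (cintegrable0 _) (cintegrable0 _)).
apply: filterS => x /esym/eqP; rewrite mulf_eq0 => /orP[|/eqP//].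
rewrite -(rmorph0 (real_complex R)) (inj_eq (@complexI R)) expf_eq0.
by rewrite mulf_eq0 pnatr_eq0/= gt_eqF ?andbF// pi_gt0.
Qed.

End integral_boxes.

(** * Test functions and weak derivatives *)

Section complex_derivative.
Context (R : realType) (V : normedModType R).
Implicit Types (f g : V -> 'C[R]) (x v : V) (a b : 'C[R]).

(** Componentwise, as [partial] is: the scalars of [V] are real, whereas ['C[R]] is normed over
    [R[i]]. *)
Definition cderive f x v a :=
  is_derive x v (fun y => complex.Re (f y)) (complex.Re a) /\
  is_derive x v (fun y => complex.Im (f y)) (complex.Im a).

Lemma cderive_cst a x v : cderive (fun _ => a) x v 0.
Proof. by split; exact: is_derive_cst. Qed.

Lemma cderiveD f g x v a b : cderive f x v a -> cderive g x v b ->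
  cderive (fun y => f y + g y) x v (a + b).
Proof.
move=> [fR fI] [gR gI]; split.
  by under eq_fun do rewrite ReD; rewrite ReD; exact: is_deriveD.
by under eq_fun do rewrite ImD; rewrite ImD; exact: is_deriveD.
Qed.

Lemma cderiveM f g x v a b : cderive f x v a -> cderive g x v b ->
  cderive (fun y => f y * g y) x v (a * g x + f x * b).
Proof.
move=> [fR fI] [gR gI]; split.
  under eq_fun do rewrite ReM; rewrite ReD !ReM.
  by apply: is_derive_eq; rewrite /GRing.scale/=; ring.
under eq_fun do rewrite ImM; rewrite ImD !ImM.
by apply: is_derive_eq; rewrite /GRing.scale/=; ring.
Qed.

Lemma cderiveZ c f x v a : cderive f x v a ->
  cderive (fun y => c * f y) x v (c * a).
Proof.
by move=> fa; have := cderiveM (cderive_cst c x v) fa; rewrite mul0r add0r.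
Qed.

Lemma is_deriveV_dir (f : V -> R) x v df : f x != 0 ->
  is_derive x v f df ->
  is_derive x v (fun y => (f y)^-1) (- (f x) ^- 2 * df).
Proof.
move=> fx0 [fd <-]; split; first exact: derivableV.
by rewrite deriveV.
Qed.

Lemma cderiveV f x v a : f x != 0 -> cderive f x v a ->
  cderive (fun y => (f y)^-1) x v (- a / (f x) ^+ 2).
Proof.
have ReV (z : 'C[R]) : complex.Re z^-1 =
    complex.Re z / (complex.Re z ^+ 2 + complex.Im z ^+ 2) by case: z.
have ImV (z : 'C[R]) : complex.Im z^-1 =
    - complex.Im z / (complex.Re z ^+ 2 + complex.Im z ^+ 2).
  by case: z => p q /=; rewrite mulNr.
move=> fx0 [fR fI].
have D0 : complex.Re (f x) ^+ 2 + complex.Im (f x) ^+ 2 != 0.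
  by rewrite -modulus_sqr sqrf_eq0 modulus_eq0.
(* The value in real and imaginary parts, in the shape that the product rule gives for Re f and - Im
   f divided by |f|^2. *)
have E : - a / f x ^+ 2 = Complex
  (complex.Re a / (complex.Re (f x) ^+ 2 + complex.Im (f x) ^+ 2) -
   complex.Re (f x) * (2 * complex.Re (f x) * complex.Re a + 2 * complex.Im (f x) * complex.Im a)
    / (complex.Re (f x) ^+ 2 + complex.Im (f x) ^+ 2) ^+ 2)
  (- complex.Im a / (complex.Re (f x) ^+ 2 + complex.Im (f x) ^+ 2) +
   complex.Im (f x) * (2 * complex.Re (f x) * complex.Re a + 2 * complex.Im (f x) * complex.Im a)
    / (complex.Re (f x) ^+ 2 + complex.Im (f x) ^+ 2) ^+ 2).
  apply: (mulIf (x := f x ^+ 2)); first by rewrite sqrf_eq0.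
  rewrite divfK ?sqrf_eq0//.
  by apply: complexP; case: (f x) D0 => p q /= D0; case: a {fR fI} => a1 a2 /=; field.
have dD : is_derive x v (fun y => complex.Re (f y) ^+ 2 + complex.Im (f y) ^+ 2)
    (2 * complex.Re (f x) * complex.Re a + 2 * complex.Im (f x) * complex.Im a).
  apply: is_derive_eq (is_deriveD (is_deriveX 2 fR) (is_deriveX 2 fI)) _.
  by rewrite /GRing.scale/= expr1; ring.
have dV := is_deriveV_dir D0 dD.
rewrite E; split.
  under eq_fun do rewrite ReV.
  apply: is_derive_eq (is_deriveM fR dV) _.
  by rewrite /GRing.scale/=; field.
under eq_fun do rewrite ImV.
apply: is_derive_eq (is_deriveM (is_deriveN fI) dV) _.
by rewrite !fctE /GRing.scale/=; field.
Qed.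

Lemma cderive_eq f x v a b : cderive f x v a -> a = b -> cderive f x v b.
Proof. by move=> ? <-. Qed.

Lemma cderive_near f g x v a : (\forall y \near x, f y = g y) ->
  cderive f x v a -> cderive g x v a.
Proof.
move=> fg [fR fI]; split; apply: near_eq_is_derive.
  by apply: filterS fg => y ->.
by apply: filterS fg => y ->.
Qed.

End complex_derivative.

Lemma cderive_line (R : realType) (U W : normedModType R) (f : W -> 'C[R])
    (p : U -> W) (u a : U) (v : W) (df : 'C[R]) :
  (forall h : R, p (h *: u + a) = h *: v + p a) ->
  cderive f (p a) v df -> cderive (f \o p) a u df.
Proof.
move=> pE [fR fI]; split.
  exact: (@is_derive_line R U W (fun y => complex.Re (f y))) fR.
exact: (@is_derive_line R U W (fun y => complex.Im (f y))) fI.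
Qed.

(** * Smooth cut-offs of characters on the line *)

Section bump.
Context (R : realType).
Implicit Types (p q : {poly R}) (t y : R).

Lemma exprn_expRN_le n y : 0 <= y -> y ^+ n * expR (- y) <= n%:R ^+ n.
Proof.
case: n => [|n] y0.
  by rewrite !expr0 mul1r -expR0 ler_expR oppr_le0.
have n0 : n.+1%:R != 0 :> R by rewrite pnatr_eq0.
rewrite expRN ler_pdivrMr ?expR_gt0//.
rewrite (_ : expR y = expR (y / n.+1%:R) ^+ n.+1); last by rewrite -expRM_natr divfK.
rewrite -exprMn lerXn2r ?nnegrE ?mulr_ge0 ?expR_ge0//.
by rewrite mulrC -ler_pdivrMr// (le_trans _ (expR_ge1Dx _))// lerDr.
Qed.

Lemma horner_expRN_le p : exists M, forall y, 0 <= y -> `|p.[y] * expR (- y)| <= M.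
Proof.
exists (\sum_(i < size p) `|p`_i| * i%:R ^+ i) => y y0.
rewrite horner_coef mulr_suml (le_trans (ler_norm_sum _ _ _))//.
apply: ler_sum => i _; rewrite -mulrA normrM ler_wpM2l// ger0_norm.
  exact: exprn_expRN_le.
by rewrite mulr_ge0 ?exprn_ge0 ?expR_ge0.
Qed.

(** The functions p(1/t) exp(-1/t), extended by 0, are stable under differentiation: in the variable
    y = 1/t the derivative replaces p by y^2 (p - p'), which is [flat']. *)
Definition flat p t : R := if 0 < t then p.[t^-1] * expR (- t^-1) else 0.

Definition flat' p : {poly R} := 'X^2 * (p - p^`()).

Lemma is_derive_flat p t : is_derive t 1 (flat p) (flat (flat' p) t).
Proof.
have [t0|t0|->] := ltgtP t 0.
- rewrite {2}/flat ltNge (ltW t0)/=.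
  apply: (@near_eq_is_derive _ _ _ (cst (0 : R))).
  near=> s; rewrite /flat ltNge (_ : s <= 0)//.
  by rewrite ltW//; near: s; exact: lt_nbhsl.
- have tn0 : t != 0 by rewrite gt_eqF.
  have dV : is_derive t (1 : R) (fun s : R => s^-1) (- t ^- 2).
    by have := is_deriveV tn0 (@is_derive_id _ _ t (1:R)); rewrite /GRing.scale/= mulr1.
  have d1 := @is_derive1_comp R (horner p) (fun s => s^-1) t _ _ (is_derive_poly p _) dV.
  have dN : is_derive t (1 : R) (fun s : R => - s^-1) (t ^- 2).
    by apply: is_derive_eq; rewrite opprK.
  have d2 := @is_derive1_comp R expR (fun s => - s^-1) t _ _ (is_derive_expR _) dN.
  have d : is_derive t (1 : R) (fun s => p.[s^-1] * expR (- s^-1)) (flat (flat' p) t).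
    apply: is_derive_eq (is_deriveM d1 d2) _.
    rewrite /flat t0 /flat' !hornerE /GRing.scale/=.
    by field.
  apply: (near_eq_is_derive _ d).
  near=> s; rewrite /flat (_ : 0 < s)//.
  by near: s; exact: lt_nbhsr.
(* At 0: boundedness of y^2 p(y) exp(-y) gives |flat p s| <= M s^2, so the difference quotient is at
   most M |h|. *)
- have [M pM] := horner_expRN_le ('X^2 * p).
  have M0 : 0 <= M by exact: le_trans (pM 0 (lexx _)).
  have fM s : `|flat p s| <= M * s ^+ 2.
    rewrite /flat; case: ltP => s0; last by rewrite normr0 mulr_ge0 ?sqr_ge0.
    rewrite -ler_pdivrMr ?exprn_gt0//.
    have := pM s^-1; rewrite invr_ge0 (ltW s0) => /(_ isT).
    rewrite hornerM hornerXn -mulrA normrM (ger0_norm (sqr_ge0 _)) exprVn mulrC.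
    by apply.
  have f0 : flat p 0 = 0 by rewrite /flat ltxx.
  have lim0 : (fun h : R => h^-1 *: ((flat p \o shift 0) (h *: (1 : R)) - flat p 0)) @ 0^' --> (0 : R).
    apply/norm_cvg0P; apply: (@squeeze_cvgr _ _ _ _ (fun=> 0) (fun h : R => M * `|h|)).
    + near=> h; rewrite normr_ge0/= f0 subr0 addr0 /GRing.scale/= mulr1 normrM.
      have hn0 : h != 0 by near: h; exact: nbhs_dnbhs_neq.
      rewrite normfV ler_pdivrMl ?normr_gt0// (le_trans (fM h))//.
      by rewrite -(real_normK (num_real h)) expr2 mulrCA.
    + exact: cvg_cst.
    + rewrite -[X in _ --> X](mulr0 M); apply: cvgMr.
      have h := @norm_continuous _ R (0 : R).
      by rewrite /continuous_at normr0 in h; exact: cvg_within_filter h.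
  split; first by apply/cvg_ex; exists 0.
  by rewrite /derive (cvg_lim _ lim0)// /flat ltxx.
Unshelve. all: by end_near. Qed.


(** The k-th derivative of [flat p (1 + t) * flat q (1 - t)], with the Leibniz rule as recursion;
    the minus sign is the inner derivative of 1 - t. Both arguments have to be positive, so the
    support lies in [-1, 1]. *)
Fixpoint bumpd k p q t : R :=
  if k is k'.+1 then bumpd k' (flat' p) q t - bumpd k' p (flat' q) t
  else flat p (1 + t) * flat q (1 - t).

Lemma is_derive_bumpd k p q t : is_derive t 1 (bumpd k p q) (bumpd k.+1 p q t).
Proof.
elim: k p q => [|k ih] p q; last first.
  exact: (is_deriveB (ih (flat' p) q) (ih p (flat' q))).
have dp : is_derive t (1 : R) (fun s : R => 1 + s) 1.
  exact: (is_derive_eq (is_deriveD (is_derive_cst (1 : R) t 1) (is_derive_id t 1))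
    (add0r 1)).
have dm : is_derive t (1 : R) (fun s : R => 1 - s) (-1).
  exact: (is_derive_eq (is_deriveB (is_derive_cst (1 : R) t 1) (is_derive_id t 1))
    (sub0r 1)).
have d1 := @is_derive1_comp R (flat p) (fun s => 1 + s) t _ _ (is_derive_flat p _) dp.
have d2 := @is_derive1_comp R (flat q) (fun s => 1 - s) t _ _ (is_derive_flat q _) dm.
apply: is_derive_eq (is_deriveM d1 d2) _.
by rewrite /GRing.scale/=; ring.
Qed.

Lemma bumpd_eq0 k p q t : 1 <= `|t| -> bumpd k p q t = 0.
Proof.
move=> t1; elim: k p q => [|k ih] p q /=; last by rewrite !ih subrr.
move: t1; rewrite ler_normr /flat => /orP[t1|t1].
  by rewrite [X in _ * X]ifN ?mulr0// -leNgt subr_le0.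
by rewrite ifN ?mul0r// -leNgt -lerBrDl sub0r lerNr.
Qed.

Definition bump k : R -> R := bumpd k 1 1.

Lemma is_derive_bump k t : is_derive t 1 (bump k) (bump k.+1 t).
Proof. exact: is_derive_bumpd. Qed.

Lemma bump_neq0 : bump 0 0 != 0.
Proof.
have h1 : (1 : {poly R}).[1^-1] = 1 by rewrite hornerE.
rewrite /bump/= /flat addr0 subr0 ltr01 h1 mul1r.
by rewrite mulf_neq0// gt_eqF// expR_gt0.
Qed.

Lemma continuous_bump k : continuous (bump k).
Proof.
move=> t; apply: differentiable_continuous; apply/derivable1_diffP.
by case: (is_derive_bump k t).
Qed.

Lemma bump_le k : exists M, forall t, `|bump k t| <= M.
Proof.
have h11 : -1 <= 1 :> R by lra.
have [|c _ cM] := @EVT_max R (fun t => `|bump k t|) (-1) 1 h11.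
  apply: continuous_subspaceT => t; apply: continuous_comp.
    exact: continuous_bump.
  exact: norm_continuous.
exists `|bump k c| => t; have [t1|t1] := leP 1 `|t|.
  by rewrite /bump bumpd_eq0// normr0.
by apply: cM; rewrite in_itv/= -ler_norml ltW.
Qed.

(* the k-th derivative of t |-> bump i (t / N) * e^(iat) *)
Fixpoint cut (N a : R) k i t : 'C[R] :=
  if k is k'.+1 then (N^-1)%:C%C * cut N a k' i.+1 t + Complex 0 a * cut N a k' i t
  else (bump i (t / N))%:C%C * expi (a * t).

Lemma cderive_cut N a k i t : cderive (cut N a k i) t (1 : R) (cut N a k.+1 i t).
Proof.
elim: k i => [|k ih] i; last first.
  by apply: cderiveD; apply: cderiveZ; exact: ih.
have dN : is_derive t (1 : R) (fun s => s / N) N^-1.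
  by apply: is_derive_eq; rewrite /GRing.scale/=; ring.
have dB := @is_derive1_comp R (bump i) (fun s => s / N) t _ _ (is_derive_bump i _) dN.
have da : is_derive t (1 : R) (fun s => a * s) a.
  by apply: is_derive_eq; rewrite /GRing.scale/=; ring.
have dc := @is_derive1_comp R cos (fun s => a * s) t _ _ (is_derive_cos _) da.
have ds := @is_derive1_comp R sin (fun s => a * s) t _ _ (is_derive_sin _) da.
have h1 : cderive (fun s : R => (bump i (s / N))%:C%C) t (1 : R)
    ((bump i.+1 (t / N) / N)%:C%C).
  by split; [exact: dB|exact: is_derive_cst].
have h2 : cderive (fun s : R => expi (a * s)) t (1 : R) (Complex 0 a * expi (a * t)).
  split => /=; first by apply: is_derive_eq dc _; ring.
  by apply: is_derive_eq ds _; ring.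
apply: cderive_eq (cderiveM h1 h2) _.
by apply: complexP => /=; ring.
Qed.

Lemma cut_eq0 N a k i t : 0 < N -> N <= `|t| -> cut N a k i t = 0.
Proof.
move=> N0 Nt; elim: k i => [|k ih] i /=; last by rewrite !ih !mulr0 addr0.
rewrite /bump bumpd_eq0 ?mul0r// normrM normfV (gtr0_norm N0).
by rewrite ler_pdivlMr// mul1r.
Qed.

(** Uniform in [N >= 1], since a derivative that falls on the bump brings the factor 1/N <= 1; this
    is the domination used when the cut-off is removed. *)
Lemma cut_le a k i : exists M, forall N t, 1 <= N -> modulus (cut N a k i t) <= M.
Proof.
elim: k i => [|k ih] i.
  have [M bM] := bump_le i; exists M => N t _ /=.
  by rewrite modulusM modulus_real modulus_expi mulr1.
have [M1 h1] := ih i.+1; have [M2 h2] := ih i.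
exists (M1 + modulus (Complex 0 a : 'C[R]) * M2) => N t N1 /=.
rewrite (le_trans (modulusD _ _))// !modulusM modulus_real lerD//.
  rewrite -[leRHS]mul1r ler_pM ?modulus_ge0 ?h1//.
  by rewrite ger0_norm ?invr_ge0 ?(le_trans ler01)// invf_le1// (lt_le_trans ltr01).
by rewrite ler_wpM2l ?modulus_ge0 ?h2.
Qed.

(** Only the term in which all derivatives fall on the exponential survives; the others carry a
    factor 1/N. *)
Lemma cvg_cut a k i t : (fun n => cut n.+1%:R a k i t) @ \oo -->
  (Complex 0 a : 'C[R]) ^+ k * ((bump i 0)%:C%C * expi (a * t)).
Proof.
have cN : (fun n => (n.+1%:R : R)^-1) @ \oo --> (0 : R) by exact: cvg_harmonic.
elim: k i => [|k ih] i /=.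
  rewrite expr0 mul1r; apply: cvgM; last exact: cvg_cst.
  apply: cvg_real_complex.
  apply: (@cvg_comp _ _ _ (fun n => t / n.+1%:R) (bump i) _ (nbhs (0 : R))).
    by rewrite -(mulr0 t); apply: cvgMr.
  exact: continuous_bump.
rewrite -[X in _ --> X]add0r; apply: cvgD; last first.
  by rewrite exprS -mulrA; apply: cvgM; [exact: cvg_cst|exact: ih].
rewrite -(mul0r ((Complex 0 a : 'C[R]) ^+ k * ((bump i.+1 0)%:C%C * expi (a * t)))).
by apply: cvgM; [exact: cvg_real_complex cN|exact: ih].
Qed.

End bump.

Lemma is_derive_line_inv (R : realType) (U W : normedModType R) (f : W -> R)
    (p : U -> W) (u a : U) (v : W) (df : R) :
  (forall h : R, p (h *: u + a) = h *: v + p a) ->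
  is_derive a u (f \o p) df -> is_derive (p a) v f df.
Proof.
move=> pE [fd fE].
have E : (fun h => h^-1 *: ((f \o shift (p a)) (h *: v) - f (p a))) =
    (fun h : R => h^-1 *: (((f \o p) \o shift a) (h *: u) - (f \o p) a)).
  by apply/funext => h /=; rewrite pE.
split; first by rewrite /derivable E.
by rewrite -fE /derive E.
Qed.

Lemma cderive_line_inv (R : realType) (U W : normedModType R) (f : W -> 'C[R])
    (p : U -> W) (u a : U) (v : W) (df : 'C[R]) :
  (forall h : R, p (h *: u + a) = h *: v + p a) ->
  cderive (f \o p) a u df -> cderive f (p a) v df.
Proof.
move=> pE [fR fI]; split.
  exact: (@is_derive_line_inv R U W (fun y => complex.Re (f y)) p u a).
exact: (@is_derive_line_inv R U W (fun y => complex.Im (f y)) p u a).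
Qed.

(** * Products of one-variable functions *)

Section product_functions.
Context (R : realType) (d : nat).
Variable g : 'I_d -> nat -> R -> 'C[R].
Hypothesis dg : forall j k t, cderive (g j k) t (1 : R) (g j k.+1 t).

(** With [g j k] the k-th derivative of [g j 0], iterated partial derivatives stay of this form and
    only change the multi-index [k]; smoothness and [multi_partial] become computations with
    indices. *)
Definition prodf (k : 'I_d -> nat) (x : 'rV[R]_d) : 'C[R] :=
  \prod_j g j (k j) (x ord0 j).

Lemma cderive_partial (f : 'rV[R]_d -> 'C[R]) j x a :
  cderive f x (delta_mx ord0 j) a -> partial j f x = a.
Proof.
by move=> [fR fI]; apply: complexP; rewrite /partial /=; exact: derive_val.
Qed.

Lemma cderive_prodf k j x : cderive (prodf k) x (delta_mx ord0 j)
  (prodf (fun i => (k i + (i == j))%N) x).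
Proof.
pose p (t : R) : 'rV[R]_d := t *: delta_mx ord0 j + x.
have p0 : x = p 0 by rewrite /p scale0r add0r.
rewrite [X in cderive _ X](p0).
apply: (@cderive_line_inv _ _ _ _ p (1 : R)) => [h|].
  by rewrite -p0 /p addr0 /GRing.scale/= mulr1.
have E : prodf k \o p = fun t => g j (k j) (t + x ord0 j) *
    \prod_(i | i != j) g i (k i) (x ord0 i).
  apply/funext => t; rewrite /= /prodf (bigD1 j)//=; congr (_ * _).
    by rewrite /p !mxE !eqxx mulr1.
  apply: eq_bigr => i ij; rewrite /p !mxE (negbTE ij) andbF mulr0 add0r//.
have h : cderive (fun t => g j (k j) (t + x ord0 j)) 0 (1 : R)
    (g j (k j).+1 (0 + x ord0 j)).
  apply: (@cderive_line _ _ _ (g j (k j)) (fun t => t + x ord0 j) 1 0 1) => [h|].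
    by rewrite addr0 add0r.
  exact: dg.
rewrite E; apply: (cderive_eq (cderiveM h (cderive_cst _ _ _))).
rewrite mulr0 addr0 add0r /prodf [RHS](bigD1 j)//= eqxx addn1; congr (_ * _).
by apply: eq_bigr => i ij; rewrite (negbTE ij) addn0.
Qed.

Lemma partial_prodf k j : partial j (prodf k) = prodf (fun i => (k i + (i == j))%N).
Proof. by apply/funext => x; apply: cderive_partial; exact: cderive_prodf. Qed.

Lemma cderive_continuous (f : R -> 'C[R]) (df : R -> 'C[R]) :
  (forall t, cderive f t (1 : R) (df t)) -> continuous f.
Proof.
move=> fd t; apply/cvg_complexP; split;
  by apply: differentiable_continuous; apply/derivable1_diffP; case: (fd t) => -[].
Qed.

Lemma continuous_prodf k : continuous (prodf k).
Proof.
move=> x; apply: (@cvg_cprod _ _ _ (nbhs_filter x)) => j.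
apply: (@cvg_comp _ _ _ (fun y : 'rV[R]_d => y ord0 j) (g j (k j)) _ (nbhs (x ord0 j))).
  exact: coord_continuous.
exact: (cderive_continuous (dg j (k j))).
Qed.

Lemma smooth_prodf k : smooth (prodf k).
Proof.
move=> s; have [k' ->] : exists k', foldr (@partial R d) (prodf k) s = prodf k'.
  elim: s => [|j s [k' /= ->]]; first by exists k.
  by eexists; exact: partial_prodf.
split; first exact: continuous_prodf.
by move=> j x; have [[? _] [? _]] := cderive_prodf k' j x.
Qed.

Lemma iter_partial_prodf k j n : iter n (@partial R d j) (prodf k) =
  prodf (fun i => (k i + (i == j) * n)%N).
Proof.
elim: n => [|n ih] /=.
  by congr prodf; apply/funext => i; rewrite muln0 addn0.
rewrite ih partial_prodf; congr prodf; apply/funext => i.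
by rewrite mulnS addnAC addnA.
Qed.

Lemma multi_partial_prodf (m : mpoly.multinom d) :
  multi_partial m (prodf (fun=> 0%N)) = prodf (mpoly.fun_of_multinom m).
Proof.
rewrite /multi_partial.
suff E (s : seq 'I_d) : uniq s ->
    foldr (fun j h => iter (mpoly.fun_of_multinom m j) (partial j) h)
      (prodf (fun=> 0%N)) s =
    prodf (fun j => if j \in s then mpoly.fun_of_multinom m j else 0%N).
  by rewrite E ?enum_uniq//; congr prodf; apply/funext => j; rewrite mem_enum.
elim: s => [_|j s ih /= /andP[js us]].
  by congr prodf.
rewrite ih// iter_partial_prodf; congr prodf; apply/funext => i.
rewrite inE; case: eqP => [->|_]; first by rewrite (negbTE js) mul1n.
by rewrite mul0n addn0.
Qed.

Lemma test_prodf N : (forall j k t, N <= `|t| -> g j k t = 0) ->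
  test_function (prodf (fun=> 0%N)).
Proof.
move=> g0; split; first exact: smooth_prodf.
pose A := [set x : 'rV[R]_d | forall j, x ord0 j \in `[- N, N]].
have cA : compact A.
  by apply: (@rV_compact _ _ (fun=> `[- N, N]%classic)) => _; exact: segment_compact.
apply: subclosed_compact cA _; first exact: closed_closure.
have clA : closed A.
  rewrite (_ : A = \bigcap_(j in setT) (fun x : 'rV[R]_d => x ord0 j) @^-1` `[- N, N]).
    apply: closed_bigI => j _; apply: preimage_closed; last exact: itv_closed.
    by move=> x _; exact: coord_continuous.
  by apply/seteqP; split=> x h j; [move=> _|]; exact: h.
rewrite /support_of [X in _ `<=` X](closure_id A).1//.
apply: closure_subset => x /= xn0 j; rewrite in_itv/= -ler_norml.
rewrite leNgt; apply/negP => /ltW/(g0 j 0%N) gx0.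
by move/negP : xn0; apply; rewrite /prodf (bigD1 j)//= gx0 mul0r.
Qed.

End product_functions.

(** * Weak derivatives and the transform *)

Section weak_derivative.
Context (R : realType) (d : nat).
Local Notation leb := (lebesgue_rV R d).
Implicit Types (P : mpoly.mpoly d R[i]) (u v : L1 leb).

Lemma cintegrable_L1_fun u : cintegrable leb (L1_fun u).
Proof. exact: L1preP. Qed.

Lemma cmeasurable_continuous (f : 'rV[R]_d -> 'C[R]) : continuous f -> cmeasurable f.
Proof.
by move=> cf; split; apply: continuous_rV_measurable => x;
  have /cvg_complexP[] := cf x.
Qed.

Section cut_wave.
Variable l : 'rV[R]_d.

Definition cut_wave n (j : 'I_d) k t : 'C[R] := cut n.+1%:R (- l ord0 j) k 0 t.

Let derive_cut_wave n j k t : cderive (cut_wave n j k) t (1 : R) (cut_wave n j k.+1 t).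
Proof. exact: cderive_cut. Qed.

Lemma test_cut_wave n : test_function (prodf (cut_wave n) (fun=> 0%N)).
Proof.
by apply: (test_prodf (derive_cut_wave n) (N := n.+1%:R)) => j k t; exact: cut_eq0.
Qed.

Lemma multi_partial_cut_wave n m : multi_partial m (prodf (cut_wave n) (fun=> 0%N)) =
  prodf (cut_wave n) (mpoly.fun_of_multinom m).
Proof. exact: (multi_partial_prodf (derive_cut_wave n)). Qed.

(* the constant bump 0 0 is eta(0) for the cut-off eta(x / n) *)
Lemma cvg_cintegral_cut_wave u k :
  (fun n => cintegral leb (fun x => L1_fun u x * prodf (cut_wave n) k x)) @ \oo -->
  (\prod_j (Complex 0 (- l ord0 j) : 'C[R]) ^+ k j) *
    ((bump 0 0 : R) ^+ d)%:C%C * ft (L1_fun u) l.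
Proof.
have [M hM] : exists M : 'I_d -> R, forall j n t, modulus (cut_wave n j (k j) t) <= M j.
  have /choice[M hM] : forall j : 'I_d, exists M, forall N t, 1 <= N ->
    modulus (cut N (- l ord0 j) (k j) 0 t) <= M by move=> j; exact: cut_le.
  by exists M => j n t; apply: hM; rewrite ler1n.
have Iu := cintegrable_L1_fun u.
rewrite -cintegralZ; last exact: cintegrable_ft.
apply: (@dominated_cintegral _ _ _ _ _ _ (fun x => (\prod_j M j) * modulus (L1_fun u x))).
- move=> n; apply: cmeasurableM; first exact: cintegrable_measurable Iu.
  by apply: cmeasurable_continuous; exact: (continuous_prodf (derive_cut_wave n)).
- apply: cmeasurableM; first exact: cmeasurable_cst.
  exact: cintegrable_measurable (cintegrable_ft l Iu).
- move=> x; rewrite mulrCA; apply: cvgM; first exact: cvg_cst.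
  rewrite rmorphXn/= -[X in _ * _ ^+ X * _](card_ord d) -prodr_const -sumrN expi_sum.
  rewrite -!big_split/=; apply: cvg_cprod => j.
  rewrite -mulrA -mulNr; exact: cvg_cut.
- exact: integrableZl (integrable_modulus Iu).
- move=> n x; rewrite modulusM mulrC ler_wpM2r ?modulus_ge0// modulus_prod.
  by apply: ler_prod => j _; rewrite modulus_ge0 hM.
Qed.

End cut_wave.

(** The identity of distributions is applied to the cut-off waves and n tends to infinity. Both
    limits contain the same non-zero factor [b], a power of the value of the bump at 0, which
    cancels. *)
Lemma weak_diffop_ft P u v : weak_diffop P u v ->
  forall l, ft (L1_fun v) l = symbol P l * ft (L1_fun u) l.
Proof.
move=> Puv l.
pose b : 'C[R] := ((bump 0 0 : R) ^+ d)%:C%C.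
have b0 : b != 0.
  by rewrite -(rmorph0 (real_complex R)) (inj_eq (@complexI R)) expf_neq0// bump_neq0.
have limv := @cvg_cintegral_cut_wave l v (fun=> 0%N).
rewrite big1 ?mul1r in limv; last by move=> j _; rewrite expr0.
have limu : (fun n => distribution_diffop P (regular_distribution (L1_fun u))
    (prodf (cut_wave l n) (fun=> 0%N))) @ \oo --> b * (symbol P l * ft (L1_fun u) l).
  have -> : b * (symbol P l * ft (L1_fun u) l) = \sum_(m <- mpoly.msupp P)
     (mpoly.mcoeff m P : 'C[R]) * ((-1) ^+ mpoly.mdeg m *
      ((\prod_j (Complex 0 (- l ord0 j) : 'C[R]) ^+ mpoly.fun_of_multinom m j) *
       b * ft (L1_fun u) l)).
    rewrite mulrCA /symbol mpoly.mevalE mulr_suml; apply: eq_bigr => m _.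
    rewrite -!mulrA; congr (_ * _); rewrite !mulrA; congr (_ * _ * _).
    (* The sign (-1)^|m| of the distributional derivative turns (-il)^m into (il)^m, the monomial in
       [symbol P l]. *)
    rewrite mpoly.mdegE -prodrXr -big_split; apply: eq_bigr => j _ /=.
    rewrite -exprMn; congr (_ ^+ _).
    by rewrite mulN1r; apply: complexP => /=; rewrite ?oppr0 ?opprK.
  apply: cvg_csum => m; apply: cvgM; first exact: cvg_cst.
  apply: cvgM; first exact: cvg_cst.
  under eq_fun do rewrite multi_partial_cut_wave.
  exact: cvg_cintegral_cut_wave.
have E : (fun n => distribution_diffop P (regular_distribution (L1_fun u))
      (prodf (cut_wave l n) (fun=> 0%N))) =
    (fun n => regular_distribution (L1_fun v) (prodf (cut_wave l n) (fun=> 0%N))).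
  by apply/funext => n; apply: Puv; exact: test_cut_wave.
rewrite E in limu.
exact: (mulfI b0 (cvg_unique _ limv limu)).
Qed.

(** Both candidates have [symbol P] times the transform of [u] as transform. This pins down the
    choice of [xget] in [diffop_L1]. *)
Lemma weak_diffop_inj P u v1 v2 : weak_diffop P u v1 -> weak_diffop P u v2 -> v1 = v2.
Proof.
move=> h1 h2.
rewrite -(L1_class_repr v1) -(L1_class_repr v2); apply/L1_classE.
have I1 := cintegrable_L1_fun v1; have I2 := cintegrable_L1_fun v2.
have h := ft_inj (cintegrableB I1 I2).
apply: filterS (h _) => [x /eqP|l]; first by rewrite subr_eq0 => /eqP.
have IN2 := cintegrableN I2.
rewrite (@ftD _ _ _ (fun x => - L1_fun v2 x))//.
have -> : ft (fun x => - L1_fun v2 x) l = - ft (L1_fun v2) l.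
  rewrite -mulN1r -ftZ//; apply: eq_cintegral => x; by rewrite mulN1r.
by rewrite (weak_diffop_ft h1) (weak_diffop_ft h2) subrr.
Qed.

Lemma diffop_L1_app P u v : weak_diffop P u v ->
  op_dom (diffop_L1 P) u /\ op_app (diffop_L1 P) u = v.
Proof.
move=> Puv; split; first by exists v.
by apply: (weak_diffop_inj (P := P) (u := u)) => //; rewrite /diffop_L1/=; apply: xgetPex; exists v.
Qed.

Lemma ft_diffop_L1 P u : op_dom (diffop_L1 P) u -> forall l,
  ft (L1_fun (op_app (diffop_L1 P) u)) l = symbol P l * ft (L1_fun u) l.
Proof.
by move=> [v Puv] l; rewrite (diffop_L1_app Puv).2; exact: weak_diffop_ft.
Qed.

End weak_derivative.

(** * The transform on classes of L^1 *)

Section L1_facts.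
Context (R : realType) (d : nat).
Local Notation leb := (lebesgue_rV R d).
Implicit Types (f g : 'rV[R]_d -> 'C[R]) (u v : L1 leb).

Lemma L1_ofE f (If : f \in L1fun leb) : L1_of leb f = L1_class (MkL1pre If).
Proof. by rewrite /L1_of insubT. Qed.

Lemma L1_of_ae f : cintegrable leb f -> {ae leb, forall x, L1_fun (L1_of leb f) x = f x}.
Proof.
move=> If; have If' : f \in L1fun leb by rewrite inE.
by rewrite L1_ofE; exact: repr_L1_class.
Qed.

Lemma L1_of_eq f g : cintegrable leb f -> cintegrable leb g ->
  {ae leb, forall x, f x = g x} -> L1_of leb f = L1_of leb g.
Proof.
move=> If Ig fg; have If' : f \in L1fun leb by rewrite inE.
have Ig' : g \in L1fun leb by rewrite inE.
by rewrite !L1_ofE; apply/L1_classE.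
Qed.

Lemma L1_ofD f g : cintegrable leb f -> cintegrable leb g ->
  L1_of leb (fun x => f x + g x) = L1_of leb f + L1_of leb g.
Proof.
move=> If Ig; have If' : f \in L1fun leb by rewrite inE.
have Ig' : g \in L1fun leb by rewrite inE.
have Ifg' : (fun x => f x + g x) \in L1fun leb by rewrite inE; exact: cintegrableD.
by rewrite !L1_ofE -L1_classD; congr L1_class; exact/val_inj.
Qed.

Lemma L1_ofZ a f : cintegrable leb f ->
  L1_of leb (fun x => a * f x) = (a : R[i]) *: L1_of leb f.
Proof.
move=> If; have If' : f \in L1fun leb by rewrite inE.
have Iaf' : (fun x => a * f x) \in L1fun leb by rewrite inE; exact: cintegrableZ.
rewrite !L1_ofE -[RHS]L1_classZ; congr L1_class; exact/val_inj.
Qed.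

Lemma modulus_L1_of f : cintegrable leb f ->
  modulus (L1_of leb f) = \int[leb]_x modulus (f x).
Proof.
move=> If; have If' : f \in L1fun leb by rewrite inE.
by rewrite L1_ofE {1}/modulus [`|_|]L1_norm_class.
Qed.

Lemma L1_of_fun u : L1_of leb (L1_fun u) = u.
Proof.
have Iu : L1_fun u \in L1fun leb by rewrite inE; exact: cintegrable_L1_fun.
by rewrite L1_ofE -[RHS]L1_class_repr; congr L1_class; exact/val_inj.
Qed.

Definition ftL u l := ft (L1_fun u) l.

Lemma ftL_of f l : cintegrable leb f -> ftL (L1_of leb f) l = ft f l.
Proof.
move=> If; apply: ae_eq_cintegral.
- exact/cintegrable_ft/cintegrable_L1_fun.
- exact: cintegrable_ft.
- by apply: filterS (L1_of_ae If) => x ->.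
Qed.

Lemma ftLD u v l : ftL (u + v) l = ftL u l + ftL v l.
Proof.
have Iu := cintegrable_L1_fun u; have Iv := cintegrable_L1_fun v.
rewrite -{1}(L1_of_fun u) -{1}(L1_of_fun v) -L1_ofD// ftL_of ?ftD//.
exact: cintegrableD.
Qed.

Lemma ftLZ (a : R[i]) u l : ftL (a *: u) l = (a : 'C[R]) * ftL u l.
Proof.
have Iu := cintegrable_L1_fun u.
by rewrite -{1}(L1_of_fun u) -L1_ofZ// ftL_of ?ftZ//; exact: cintegrableZ.
Qed.

Lemma ftLB u v l : ftL (u - v) l = ftL u l - ftL v l.
Proof. by rewrite ftLD -scaleN1r ftLZ mulN1r. Qed.

Lemma ftL_le u l : modulus (ftL u l) <= modulus u.
Proof. exact/modulus_ft/cintegrable_L1_fun. Qed.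

Lemma ftL_inj u : (forall l, ftL u l = 0) -> u = 0.
Proof.
move=> u0; have ae0 := ft_inj (cintegrable_L1_fun u) u0.
rewrite -(L1_of_fun u) (L1_of_eq (cintegrable_L1_fun u) (cintegrable0 leb))//.
have -> : (fun _ : 'rV[R]_d => 0 : 'C[R]) = (fun x => 0 * 0).
  by apply/funext => x; rewrite mul0r.
by rewrite L1_ofZ ?scale0r//; exact: cintegrable0.
Qed.

End L1_facts.

(** * The single-valued extension property *)

Section analytic.
Context (R : realType) (X : normedModType R[i]).

Lemma geometric_sum_le (q : R) n : 0 <= q -> q <= 2^-1 -> \sum_(k < n) q ^+ k <= 2.
Proof.
move=> q0 q2; suff : \sum_(k < n) q ^+ k <= 2 - 2 * q ^+ n.
  by move/le_trans; apply; rewrite lerBlDr lerDl mulr_ge0// exprn_ge0.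
elim: n => [|n ih]; first by rewrite big_ord0 expr0 mulr1 subrr.
rewrite big_ord_recr/= (le_trans (lerD ih (lexx _)))// exprS.
have := exprn_ge0 n q0; nra.
Qed.

(** Convergence at the point z0 + rho bounds the coefficients by M / rho^k; for |z - z0| < rho / 2
    the series without its constant term is then at most |z - z0| times a geometric series of ratio
    at most 1/2. *)
Lemma analytic_lipschitz (U : set 'C[R]) (phi : 'C[R] -> X) z0 :
  analytic_on U phi -> U z0 -> exists r C : R, 0 < r /\ forall z,
    modulus (z - z0) < r -> modulus (phi z - phi z0) <= C * modulus (z - z0).
Proof.
move=> aphi Uz0; have [a] := aphi _ Uz0.
move=> /nbhs_ballP[[e e'] /=]; rewrite ltcE/= => /andP[/eqP -> e0] sub.
pose S z n := \sum_(0 <= k < n) ((z - z0) ^+ k : R[i]) *: a k.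
have cS z : modulus (z - z0) < e -> S z @ \oo --> phi z.
  move=> ze; have := sub z; apply.
  by rewrite -ball_normE /= -modulusE ltcR modulusB.
have S0 n : S z0 n.+1 = a 0.
  rewrite /S big_nat_recl// subrr expr0 scale1r big1 ?addr0// => k _.
  by rewrite expr0n scale0r.
have pz0 : phi z0 = a 0.
  have c1 : S z0 @ \oo --> phi z0 by apply: cS; rewrite subrr modulus0.
  have c2 : S z0 @ \oo --> a 0.
    rewrite -cvg_shiftS /=; under eq_fun do rewrite S0; exact: cvg_cst.
  exact: (cvg_unique _ c1 c2).
pose rho := e / 2; have rho0 : 0 < rho by rewrite divr_gt0.
pose z1 : 'C[R] := z0 + rho%:C%C.
have z1E : z1 - z0 = rho%:C%C by rewrite /z1 addrC addKr.
have [M hM] : exists M, forall k, rho ^+ k * modulus (a k) <= M.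
  have /cvg_modulusP c1 : S z1 @ \oo --> phi z1.
    by apply: cS; rewrite z1E modulus_real gtr0_norm// /rho; lra.
  have [B [_ hB]] : bounded_fun (fun n => modulus (phi z1 - S z1 n)).
    by apply: cvg_seq_bounded; apply/cvg_ex; exists 0.
  (* A term is the difference of two consecutive errors [phi z1 - S z1 n], which are bounded since
     they converge; [hB] gives bounds strictly above [B], whence B + 1. *)
  exists ((B + 1) + (B + 1)) => k.
  have E : ((z1 - z0) ^+ k : R[i]) *: a k = (phi z1 - S z1 k) - (phi z1 - S z1 k.+1).
    by rewrite /S big_nat_recr//= opprB [RHS]addrC addrA subrK [RHS]addrC addKr.
  have hk n : modulus (phi z1 - S z1 n) <= B + 1.
    rewrite (le_trans (ler_norm _))//; apply: (hB (B + 1)) => //.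
    by rewrite ltrDl.
  have -> : rho ^+ k * modulus (a k) = modulus (((z1 - z0) ^+ k : R[i]) *: a k).
    by rewrite modulusZ modulusX z1E modulus_real gtr0_norm.
  by rewrite E (le_trans (modulusD _ _))// modulusN lerD.
have M0 : 0 <= M by apply: le_trans (hM 0%N); rewrite expr0 mul1r modulus_ge0.
exists (rho / 2), (2 * M / rho); split; first by rewrite divr_gt0.
move=> z zr; pose q := modulus (z - z0) / rho.
have q0 : 0 <= q by rewrite divr_ge0 ?modulus_ge0 ?ltW.
have q2 : q <= 2^-1 by rewrite ler_pdivrMr// mulrC ltW.
have Sle n : modulus (S z n.+1 - phi z0) <= 2 * M * q.
  rewrite pz0 /S big_nat_recl// expr0 scale1r addrC addKr.
  rewrite (le_trans (modulus_sum _ _ _))//.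
  rewrite (@le_trans _ _ (\sum_(0 <= k < n) M * q * q ^+ k))//.
    apply: ler_sum => k _; rewrite modulusZ modulusX -mulrA -exprS /q expr_div_n.
    rewrite mulrCA ler_wpM2l ?exprn_ge0 ?modulus_ge0//.
    by rewrite ler_pdivlMr ?exprn_gt0// mulrC hM.
  rewrite -mulr_sumr big_mkord (_ : 2 * M * q = M * q * 2); last by ring.
  by apply: ler_wpM2l; [exact: mulr_ge0|exact: geometric_sum_le].
have zS : S z @ \oo --> phi z.
  by apply: cS; rewrite (lt_trans zr)// /rho; lra.
rewrite (_ : 2 * M / rho * _ = 2 * M * q); last by rewrite /q; ring.
apply/ler_addgt0Pr => eps eps0.
have /cvg_modulusP/cvgrPdist_lt/(_ _ eps0) := zS.
move=> [N _ hN]; have := hN N.+1 (leqnSn _); rewrite /= sub0r normrN.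
rewrite ger0_norm ?modulus_ge0// => /ltW h.
rewrite (_ : phi z - phi z0 = (S z N.+1 - phi z0) + (phi z - S z N.+1)).
  by rewrite (le_trans (modulusD _ _))// lerD.
by rewrite [RHS]addrC addrA subrK.
Qed.

End analytic.

Section svep.
Context (R : realType) (d : nat).
Local Notation leb := (lebesgue_rV R d).

Lemma resolvent_ft (P : mpoly.mpoly d R[i]) (u v : L1 leb) (z : R[i]) :
  op_dom (diffop_L1 P) u -> op_app (diffop_L1 P) u - z *: u = v ->
  forall l, (symbol P l - (z : 'C[R])) * ftL u l = ftL v l.
Proof.
by move=> Du <- l; rewrite ftLB ftLZ /ftL ft_diffop_L1// mulrBl.
Qed.

(* phi is continuous and its Fourier coefficient at l vanishes off z = P(il) *)
Lemma SVEP_diffop_L1 (P : mpoly.mpoly d R[i]) : SVEP (diffop_L1 P).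
Proof.
move=> U oU _ phi aphi hphi z Uz; apply: ftL_inj => l.
have h w : U w -> w != symbol P l -> ftL (phi w) l = 0.
  move=> Uw wP; have [Dw Tw] := hphi w Uw.
  have := resolvent_ft Dw Tw l.
  rewrite -(scale0r (phi w)) ftLZ mul0r => /eqP.
  by rewrite mulf_eq0 subr_eq0 eq_sym (negbTE wP) => /eqP.
have [zP|/h] := eqVneq z (symbol P l); last exact.
have [r [C [r0 hC]]] := analytic_lipschitz aphi Uz.
apply/eqP; rewrite -modulus_eq0 eq_le modulus_ge0 andbT.
apply/ler_addgt0Pr => eps eps0; rewrite add0r.
have /nbhs_ballP[[e e'] /=] := open_nbhs_nbhs (conj oU Uz).
rewrite ltcE/= => /andP[/eqP -> e0] eU.
(* Halving keeps [w] strictly inside both radii; the last entry makes (1 + |C|) t <= eps, where 1 +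
   |C| is positive whatever the sign of C. *)
pose t := Num.min (Num.min r e / 2) (eps / (1 + `|C|)).
have t0 : 0 < t.
  by rewrite lt_min !divr_gt0 ?lt_min ?r0 ?e0// ltr_pwDl.
have tr : t < r.
  apply: (@le_lt_trans _ _ (Num.min r e / 2)); first by rewrite ge_min lexx.
  by rewrite ltr_pdivrMr// gt_min ltr_pMr// ltr1n.
have te : t < e.
  apply: (@le_lt_trans _ _ (Num.min r e / 2)); first by rewrite ge_min lexx.
  by rewrite ltr_pdivrMr// gt_min [X in _ || X]ltr_pMr// ltr1n orbT.
pose w : 'C[R] := z + t%:C%C.
have wz : w - z = t%:C%C by rewrite /w addrC addKr.
have mw : modulus (w - z) = t by rewrite wz modulus_real gtr0_norm.
have Uw : U w.
  by apply: eU; rewrite -ball_normE/= -modulusE ltcR modulusB mw.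
have wP : w != symbol P l.
  by rewrite -zP -subr_eq0 -modulus_eq0 mw gt_eqF.
have -> : ftL (phi z) l = ftL (phi z - phi w) l by rewrite ftLB (h w)// subr0.
rewrite (le_trans (ftL_le _ _))// modulusB (le_trans (hC w _)) ?mw//.
rewrite (@le_trans _ _ ((1 + `|C|) * t))//.
  by rewrite ler_wpM2r ?(ltW t0)// (le_trans (ler_norm C))// lerDr.
rewrite mulrC -ler_pdivlMr ?ltr_pwDl//.
by rewrite ge_min lexx orbT.
Qed.

End svep.

Lemma continuous_Re (R : realType) (T : topologicalType) (f : T -> 'C[R]) :
  continuous f -> continuous (fun x => complex.Re (f x)).
Proof. by move=> cf x; have /cvg_complexP[] := cf x. Qed.

Lemma continuous_Im (R : realType) (T : topologicalType) (f : T -> 'C[R]) :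
  continuous f -> continuous (fun x => complex.Im (f x)).
Proof. by move=> cf x; have /cvg_complexP[] := cf x. Qed.

Lemma ccontinuousM (R : realType) (T : topologicalType) (f g : T -> 'C[R]) :
  continuous f -> continuous g -> continuous (fun x => f x * g x).
Proof. by move=> cf cg x; apply: ccvgM; [exact: cf|exact: cg]. Qed.

Lemma ccontinuousD (R : realType) (T : topologicalType) (f g : T -> 'C[R]) :
  continuous f -> continuous g -> continuous (fun x => f x + g x).
Proof. by move=> cf cg x; apply: ccvgD; [exact: cf|exact: cg]. Qed.

Lemma ccontinuous_cst (R : realType) (T : topologicalType) (a : 'C[R]) :
  continuous (fun _ : T => a).
Proof. by move=> x; exact: cvg_cst. Qed.

(** * Symmetry of iterated partial derivatives *)

Section clairaut.
Context (R : realType) (d : nat).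
Implicit Types (g : 'rV[R]_d -> R) (x v : 'rV[R]_d).

Lemma MVT_line g (dg : 'rV[R]_d -> R) v x (t : R) : 0 < t ->
  (forall y, is_derive y v g (dg y)) ->
  exists2 a, 0 < a < t & g (t *: v + x) - g x = t * dg (a *: v + x).
Proof.
move=> t0 gd.
have hd s : is_derive s (1 : R) (fun s : R => g (s *: v + x)) (dg (s *: v + x)).
  apply: (@is_derive_line R R 'rV[R]_d g (fun s => s *: v + x) 1 s v) => h.
  have -> : h *: (1 : R) = h by exact: mulr1.
  by rewrite scalerDl addrA.
have ch : {within `[0, t], continuous (fun s : R => g (s *: v + x))}.
  apply: derivable_within_continuous => s _; by case: (hd s).
have [a] := MVT t0 (fun s _ => hd s) ch.
rewrite in_itv/= => a0t; rewrite subr0 scale0r add0r => ->.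
by exists a => //; rewrite mulrC.
Qed.

Let second_difference g gi gij (u v : 'rV[R]_d) x (t : R) : 0 < t ->
  (forall y, is_derive y u g (gi y)) -> (forall y, is_derive y v gi (gij y)) ->
  exists a b, [/\ 0 < a < t, 0 < b < t &
    g (t *: u + (t *: v + x)) - g (t *: u + x) - (g (t *: v + x) - g x) =
    t ^+ 2 * gij (b *: v + (a *: u + x))].
Proof.
move=> t0 gu giv.
have hd (y : 'rV[R]_d) : is_derive y u (fun y => g (t *: v + y) - g y)
    (gi (t *: v + y) - gi y).
  apply: is_deriveB.
  apply: (@is_derive_line R _ _ g (fun y => t *: v + y) u y u) => h.
  by rewrite addrCA.
have [a a0t aE] := MVT_line x t0 hd.
have [b b0t bE] := MVT_line (a *: u + x) t0 giv.
exists a, b; split => //.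
rewrite expr2 -mulrA -bE -aE (addrCA (t *: u)).
rewrite !opprD !opprK !addrA; congr (_ + _); rewrite -!addrA; congr (_ + _).
Qed.

(** Both mixed derivatives are values of the same second difference, up to t^2, by two mean value
    theorems in either order. Symmetry matters because [schwartz] bounds the derivatives in one
    fixed order of the coordinates, whereas repeated differentiation produces any order. *)
Lemma clairaut g gi gj gij gji (u v : 'rV[R]_d) :
  (forall y, is_derive y u g (gi y)) -> (forall y, is_derive y v g (gj y)) ->
  (forall y, is_derive y v gi (gij y)) -> (forall y, is_derive y u gj (gji y)) ->
  continuous gij -> continuous gji -> gij =1 gji.
Proof.
move=> gu gv guv gvu cij cji x.
apply/eqP; rewrite -subr_eq0 -normr_eq0 eq_le normr_ge0 andbT.
apply/ler_addgt0Pr => e e0; rewrite add0r.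
have e20 : 0 < e / 2 by rewrite divr_gt0.
have near0 (f : 'rV[R]_d -> R) : continuous f -> exists2 r, 0 < r &
    forall a b, 0 < a < r -> 0 < b < r -> `|f x - f (b *: v + (a *: u + x))| < e / 2.
  move=> cf; have /cvgrPdist_lt/(_ _ e20)/nbhs_ballP[r /= r0 rf] := cf x.
  exists (r / (1 + (`|u| + `|v|))).
    by rewrite divr_gt0// ltr_pwDl// addr_ge0.
  move=> a b /andP[a0 ar] /andP[b0 br]; apply: rf.
  rewrite -ball_normE /= addrA opprD addrCA subrr addr0 normrN.
  rewrite (le_lt_trans (ler_normD _ _))// !normrZ (gtr0_norm a0) (gtr0_norm b0).
  pose s := r / (1 + (`|u| + `|v|)).
  have D0 : 0 < 1 + (`|u| + `|v|) by rewrite ltr_pwDl// addr_ge0.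
  rewrite (@le_lt_trans _ _ (s * `|v| + s * `|u|))//.
    by rewrite lerD// ler_wpM2r// ltW.
  have -> : r = s * (1 + (`|u| + `|v|)) by rewrite /s divfK// gt_eqF.
  rewrite !mulrDr mulr1 [s * `|u| + _]addrC ltrDr.
  by rewrite /s divr_gt0.
have [r1 r10 h1] := near0 _ cij; have [r2 r20 h2] := near0 _ cji.
pose t := Num.min r1 r2; have t0 : 0 < t by rewrite lt_min r10.
have tr1 : t <= r1 by rewrite ge_min lexx.
have tr2 : t <= r2 by rewrite ge_min lexx orbT.
have [a [b [/andP[a0 at'] /andP[b0 bt] E1]]] := second_difference x t0 gu guv.
have [a' [b' [/andP[a'0 a't] /andP[b'0 b't] E2]]] := second_difference x t0 gv gvu.
have E : gij (b *: v + (a *: u + x)) = gji (b' *: u + (a' *: v + x)).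
  apply: (@mulfI _ (t ^+ 2)); first by rewrite expf_neq0// gt_eqF.
  rewrite -E1 -E2 (addrCA (t *: u)) !opprD !opprK !addrA.
  by congr (_ + _); exact: addrAC.
have H1 : `|gij x - gij (b *: v + (a *: u + x))| < e / 2.
  by apply: h1; apply/andP; split=> //; apply: lt_le_trans tr1.
have H2 : `|gji x - gji (b' *: u + (a' *: v + x))| < e / 2.
  rewrite addrCA; apply: h2; apply/andP; split=> //; exact: lt_le_trans tr2.
rewrite (_ : gij x - gji x = (gij x - gij (b *: v + (a *: u + x))) -
    (gji x - gji (b' *: u + (a' *: v + x)))).
  by rewrite (le_trans (ler_normB _ _))// [leRHS]splitr lerD// ltW.
by rewrite E opprB addrA subrK.
Qed.

Lemma cderive_partial_smooth (f : 'rV[R]_d -> 'C[R]) j x : partially_derivable f ->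
  cderive f x (delta_mx ord0 j) (partial j f x).
Proof. by move=> /(_ j x)[fR fI]; split; exact: derivableP. Qed.

Lemma partialC (f : 'rV[R]_d -> 'C[R]) i j : smooth f ->
  partial i (partial j f) = partial j (partial i f).
Proof.
move=> sf; apply/funext => x.
have [_ f0] := sf [::]; have [_ fi] := sf [:: i]; have [_ fj] := sf [:: j].
have [cij _] := sf [:: i; j]; have [cji _] := sf [:: j; i].
have D0 k y := cderive_partial_smooth k y f0.
have Di k y := cderive_partial_smooth k y fi.
have Dj k y := cderive_partial_smooth k y fj.
apply: complexP.
  apply: (clairaut (fun y => (D0 j y).1) (fun y => (D0 i y).1)
    (fun y => (Dj i y).1) (fun y => (Di j y).1)).
    exact: continuous_Re cij.
  exact: continuous_Re cji.
apply: (clairaut (fun y => (D0 j y).2) (fun y => (D0 i y).2)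
  (fun y => (Dj i y).2) (fun y => (Di j y).2)).
  exact: continuous_Im cij.
exact: continuous_Im cji.
Qed.

Lemma smooth_foldr (f : 'rV[R]_d -> 'C[R]) s : smooth f ->
  smooth (foldr (@partial R d) f s).
Proof. by move=> sf t; rewrite -foldr_cat; exact: sf. Qed.

Lemma foldr_partial_perm (f : 'rV[R]_d -> 'C[R]) s t : smooth f -> perm_eq s t ->
  foldr (@partial R d) f s = foldr (@partial R d) f t.
Proof.
move=> sf.
have move_front i (t1 t2 : seq 'I_d) : foldr (@partial R d) f (t1 ++ i :: t2) =
    foldr (@partial R d) f (i :: t1 ++ t2).
  elim: t1 => //= k t1 ->; rewrite partialC//; exact: smooth_foldr.
elim: s t => [|i s ih] t; first by rewrite perm_sym => /perm_nilP ->.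
move=> st; have it : i \in t by rewrite -(perm_mem st) mem_head.
case/splitPr: it st => t1 t2 st; rewrite move_front /= (ih (t1 ++ t2))//.
rewrite -(perm_cons i) (perm_trans st)//.
by apply/permPl; exact: (perm_catCA t1 [:: i] t2).
Qed.

Lemma multi_partialE m (f : 'rV[R]_d -> 'C[R]) : multi_partial m f =
  foldr (@partial R d) f
    (flatten [seq nseq (mpoly.fun_of_multinom m j) j | j <- enum 'I_d]).
Proof.
rewrite /multi_partial; elim: (enum 'I_d) => //= j r ->.
by rewrite foldr_cat; elim: (mpoly.fun_of_multinom m j) => //= n ->.
Qed.

(** The multi-index counts the occurrences of each direction in [s]. *)
Lemma foldr_partialE (f : 'rV[R]_d -> 'C[R]) s : smooth f ->
  exists m, foldr (@partial R d) f s = multi_partial m f.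
Proof.
move=> sf; pose m : mpoly.multinom d := mpoly.Multinom [tuple count_mem j s | j < d].
have mE j : mpoly.fun_of_multinom m j = count_mem j s.
  by rewrite /mpoly.fun_of_multinom tnth_mktuple.
exists m; rewrite multi_partialE; apply: foldr_partial_perm => //.
apply/allP => j _ /=.
rewrite count_flatten -map_comp sumnE big_map big_enum (bigD1 j)//=.
rewrite count_nseq /= eqxx mE mul1n big1 ?addn0// => i ij.
by rewrite count_nseq /= (negbTE ij).
Qed.

End clairaut.

(** * Rapidly decreasing families *)

Section rapid.
Context (R : realType) (d : nat).
Local Notation leb := (lebesgue_rV R d).
Local Notation e_ := (delta_mx ord0).
Implicit Types (f : 'rV[R]_d -> 'C[R]).

(* coinductive form of: all functions obtained from the family h by *)
(* differentiations and multiplications by coordinates are O(b) *)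
Definition rapid_closed I (b : I -> R) (D : set (I -> 'rV[R]_d -> 'C[R])) : Prop :=
  forall g, D g -> [/\ (exists C, forall i x, modulus (g i x) <= C * b i),
    (forall i, continuous (g i)),
    (forall j, D (fun i x => (x ord0 j)%:C%C * g i x)) &
    forall j, exists dg, D dg /\ forall i x, cderive (g i) x (e_ j) (dg i x)].

(** The largest invariant class: rapidity is proved by exhibiting [D]. The constants may depend on
    the derivative and the moment but not on the index, so [b n = rho ^ n] gives O(rho^n) for each
    of them. *)
Definition rapid I (b : I -> R) (g : I -> 'rV[R]_d -> 'C[R]) : Prop :=
  exists D, rapid_closed b D /\ D g.

Section families.
Variables (I : Type) (b : I -> R).
Implicit Types g : I -> 'rV[R]_d -> 'C[R].

Lemma rapid_le g : rapid b g -> exists C, forall i x, modulus (g i x) <= C * b i.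
Proof. by move=> [D [cD /cD[]]]. Qed.

Lemma rapid_continuous g i : rapid b g -> continuous (g i).
Proof. by move=> [D [cD /cD[_ + _ _]]]; apply. Qed.

Lemma rapid_coord g j : rapid b g -> rapid b (fun i x => (x ord0 j)%:C%C * g i x).
Proof. by move=> [D [cD Dg]]; exists D; split => //; have [_ _ + _] := cD _ Dg; apply. Qed.

Lemma rapid_derive g j : rapid b g -> exists dg, rapid b dg /\
  forall i x, cderive (g i) x (e_ j) (dg i x).
Proof.
move=> [D [cD Dg]]; have [_ _ _ /(_ j)[dg [Ddg gd]]] := cD _ Dg.
by exists dg; split => //; exists D.
Qed.

Lemma rapidD g1 g2 : rapid b g1 -> rapid b g2 ->
  rapid b (fun i x => g1 i x + g2 i x).
Proof.
move=> [D1 [c1 Dg1]] [D2 [c2 Dg2]].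
exists [set g | exists h1 h2, [/\ D1 h1, D2 h2 & g = (fun i x => h1 i x + h2 i x)]].
split; last by exists g1, g2.
move=> _ [h1 [h2 [Dh1 Dh2 ->]]].
have [[C1 hC1] ct1 x1 d1] := c1 _ Dh1; have [[C2 hC2] ct2 x2 d2] := c2 _ Dh2.
split.
- exists (C1 + C2) => i x; rewrite (le_trans (modulusD _ _))// mulrDl.
  by rewrite lerD.
- by move=> i; apply: ccontinuousD.
- move=> j; exists (fun i (x : 'rV[R]_d) => (x ord0 j)%:C%C * h1 i x).
  exists (fun i (x : 'rV[R]_d) => (x ord0 j)%:C%C * h2 i x); split; [exact: x1|exact: x2|].
  by apply/funext => i; apply/funext => x; rewrite mulrDr.
- move=> j; have [dh1 [Dd1 e1]] := d1 j; have [dh2 [Dd2 e2]] := d2 j.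
  exists (fun i x => dh1 i x + dh2 i x); split; first by exists dh1, dh2.
  by move=> i x; apply: cderiveD.
Qed.

Lemma rapidZ (c : 'C[R]) g : rapid b g -> rapid b (fun i x => c * g i x).
Proof.
move=> [D [cD Dg]].
exists [set g' | exists2 h1, D h1 & g' = (fun i x => c * h1 i x)].
split; last by exists g.
move=> _ [h1 Dh1 ->]; have [[C hC] ct1 x1 d1] := cD _ Dh1.
split.
- exists (modulus c * C) => i x; rewrite modulusM -mulrA.
  by rewrite ler_wpM2l ?modulus_ge0.
- by move=> i; apply: ccontinuousM => //; exact: ccontinuous_cst.
- move=> j; exists (fun i (x : 'rV[R]_d) => (x ord0 j)%:C%C * h1 i x); first exact: x1.
  by apply/funext => i; apply/funext => x; rewrite mulrCA.
- move=> j; have [dh1 [Dd1 e1]] := d1 j.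
  exists (fun i x => c * dh1 i x); split; first by exists dh1.
  by move=> i x; apply: cderiveZ.
Qed.

Lemma rapid_ext g1 g2 : (forall i, g1 i =1 g2 i) -> rapid b g1 -> rapid b g2.
Proof. by move=> E; rewrite (_ : g1 = g2)//; apply/funext => i; exact/funext. Qed.

End families.

Definition rapid1 f := rapid (fun _ : unit => 1) (fun _ => f).

Lemma rapid_member I (b : I -> R) g i : rapid b g -> rapid1 (g i).
Proof.
move=> [D [cD Dg]]; exists [set g' | exists2 h1, D h1 & g' = (fun _ => h1 i)].
split; last by exists g.
move=> _ [h1 Dh1 ->]; have [[C hC] ct1 x1 d1] := cD _ Dh1.
split.
- by exists (C * b i) => _ x; rewrite mulr1.
- by move=> _; exact: ct1.
- by move=> j; exists (fun i (x : 'rV[R]_d) => (x ord0 j)%:C%C * h1 i x).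
- move=> j; have [dh1 [Dd1 e1]] := d1 j.
  by exists (fun _ => dh1 i); split; [exists dh1|move=> _ x].
Qed.

Lemma rapid1_derive f j : rapid1 f -> exists df, rapid1 df /\
  forall x, cderive f x (e_ j) (df x).
Proof.
move=> /(rapid_derive j)[dg [rdg fd]]; exists (dg tt); split; last exact: fd tt.
by apply: rapid_ext rdg => -[].
Qed.

Lemma rapid1_continuous f : rapid1 f -> continuous f.
Proof. by move=> rf; exact: (@rapid_continuous _ (fun=> 1) (fun=> f) tt rf). Qed.

(** (1 + x_j^2) g = g + x_j (x_j g) is again rapid, so the factors are collected one at a time. One
    pass over all coordinates yields the integrable majorant [weight]. *)
Lemma rapid_seq_weight I (b : I -> R) g (s : seq 'I_d) : rapid b g ->
  exists C, forall i (x : 'rV[R]_d), (\prod_(j <- s) oneDsqr (x ord0 j)) * modulus (g i x) <= C * b i.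
Proof.
elim: s g => [|j s ih] g rg.
  by have [C hC] := rapid_le rg; exists C => i x; rewrite big_nil mul1r.
have rg' : rapid b (fun i (x : 'rV[R]_d) => g i x + (x ord0 j)%:C%C * ((x ord0 j)%:C%C * g i x)).
  by apply: rapidD => //; do 2 apply: rapid_coord.
have [C hC] := ih _ rg'; exists C => i x.
rewrite big_cons mulrAC [oneDsqr _ * _](_ : _ =
    modulus (g i x + (x ord0 j)%:C%C * ((x ord0 j)%:C%C * g i x))).
  by rewrite mulrC.
rewrite (_ : _ + _ = ((oneDsqr (x ord0 j))%:C%C : 'C[R]) * g i x).
  by rewrite modulusM modulus_real gtr0_norm// oneDsqr_gt0.
by rewrite /oneDsqr rmorphD rmorph1 mulrDl mul1r rmorphXn/= expr2 mulrA.
Qed.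

Lemma rapid_weight I (b : I -> R) g : rapid b g ->
  exists C, forall i x, modulus (g i x) <= C * b i * weight x.
Proof.
move=> /(rapid_seq_weight (index_enum 'I_d))[C hC]; exists C => i x.
rewrite /weight prodfV ler_pdivlMr; last by apply: prodr_gt0 => j _; exact: oneDsqr_gt0.
by rewrite mulrC.
Qed.

Lemma rapid1_weight f : rapid1 f -> exists C, forall x, modulus (f x) <= C * weight x.
Proof. by move=> /rapid_weight[C hC]; exists C => x; have := hC tt x; rewrite mulr1. Qed.

Lemma integrable_weightZ C : leb.-integrable setT (EFin \o (fun x => C * weight x)).
Proof. exact: integrableZl (@integrable_weight R d). Qed.

Lemma rapid1_cintegrable f : rapid1 f -> cintegrable leb f.
Proof.
move=> rf; have [C hC] := rapid1_weight rf.
apply: (cintegrable_le _ (integrable_weightZ C)) => //.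
by apply: cmeasurable_continuous; exact: rapid1_continuous.
Qed.

Lemma cintegral_partial0 (j : 'I_d) (H dH : 'rV[R]_d -> 'C[R]) (C : R) :
  continuous dH -> (forall x, cderive H x (e_ j) (dH x)) ->
  (forall x, modulus (H x) <= C * weight x) ->
  (forall x, modulus (dH x) <= C * weight x) ->
  cintegral leb dH = 0.
Proof.
move=> cdH Hd HC dHC; apply: complexP => /=.
  apply: (Rintegral_partial0 (continuous_Re cdH) (fun x => (Hd x).1)) => x.
    exact: le_trans (le_Re_modulus _) (HC x).
  exact: le_trans (le_Re_modulus _) (dHC x).
apply: (Rintegral_partial0 (continuous_Im cdH) (fun x => (Hd x).2)) => x.
  exact: le_trans (le_Im_modulus _) (HC x).
exact: le_trans (le_Im_modulus _) (dHC x).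
Qed.

Lemma cderive_wave (s : R) (l x : 'rV[R]_d) j :
  cderive (fun y : 'rV[R]_d => expi (s * dot l y)) x (e_ j)
  ((Complex 0 (s * l ord0 j) : 'C[R]) * expi (s * dot l x)).
Proof.
pose p (t : R) : 'rV[R]_d := t *: e_ j + x.
have p0 : x = p 0 by rewrite /p scale0r add0r.
rewrite [X in cderive _ X](p0).
apply: (@cderive_line_inv _ _ _ _ p (1 : R)) => [h|].
  by rewrite -p0 /p addr0 /GRing.scale/= mulr1.
have E t : s * dot l (p t) = s * l ord0 j * t + s * dot l x.
  by rewrite /p dotDr dotZr dot_delta mulrDr mulrA mulrAC.
have da : is_derive (0 : R) (1 : R) (fun t => s * l ord0 j * t + s * dot l x) (s * l ord0 j).
  by apply: is_derive_eq; rewrite /GRing.scale/=; ring.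
have dc := @is_derive1_comp R cos _ 0 _ _ (is_derive_cos _) da.
have ds := @is_derive1_comp R sin _ 0 _ _ (is_derive_sin _) da.
split.
  rewrite (_ : (fun _ => _) = cos \o (fun t => s * l ord0 j * t + s * dot l x)).
    by apply: is_derive_eq dc _; rewrite /= mulr0 add0r; ring.
  by apply/funext => t /=; rewrite E.
rewrite (_ : (fun _ => _) = sin \o (fun t => s * l ord0 j * t + s * dot l x)).
  by apply: is_derive_eq ds _; rewrite /= mulr0 add0r; ring.
by apply/funext => t /=; rewrite E.
Qed.

Lemma cvg_rsum T (F : set_system T) {FF : Filter F} I (r : seq I)
    (u : I -> T -> R) (l : I -> R) :
  (forall i, u i @ F --> l i) ->
  (fun t => \sum_(i <- r) u i t) @ F --> (\sum_(i <- r) l i : R).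
Proof.
move=> ul; elim: r => [|i r ih].
  rewrite (_ : (fun _ => _) = fun=> 0); last by apply/funext => t; rewrite big_nil.
  by rewrite big_nil; exact: cvg_cst.
rewrite (_ : (fun _ => _) = fun t => u i t + \sum_(i <- r) u i t); last first.
  by apply/funext => t; rewrite big_cons.
by rewrite big_cons; exact: (cvgD (ul i) ih).
Qed.

Lemma continuous_wave (s : R) (l : 'rV[R]_d) :
  continuous (fun y : 'rV[R]_d => expi (s * dot l y)).
Proof.
have cd : continuous (fun y : 'rV[R]_d => s * dot l y).
  move=> y; apply: (@cvgMr _ _ _ (nbhs_filter y)).
  apply: (@cvg_rsum _ _ (nbhs_filter y) _ _ (fun j (z : 'rV[R]_d) => l ord0 j * z ord0 j)) => j.
  by apply: (@cvgMr _ _ _ (nbhs_filter y)); exact: coord_continuous.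
move=> y; apply/(@cvg_complexP _ _ _ (nbhs_filter y)); split => /=.
  exact: (@continuous_comp _ _ _ _ _ _ (cd y) (@continuous_cos R _)).
exact: (@continuous_comp _ _ _ _ _ _ (cd y) (@continuous_sin R _)).
Qed.

(** The derivative of the product of [f] and the wave integrates to 0, because the product and its
    derivative are both O(weight). *)
Lemma wave_by_parts (s : R) (l : 'rV[R]_d) j f df : rapid1 f -> rapid1 df ->
  (forall x, cderive f x (e_ j) (df x)) ->
  cintegral leb (fun x => df x * expi (s * dot l x)) =
  - (Complex 0 (s * l ord0 j) : 'C[R]) * cintegral leb (fun x => f x * expi (s * dot l x)).
Proof.
move=> rf rdf fd; pose c : 'C[R] := Complex 0 (s * l ord0 j).
have rcf : rapid1 (fun x => c * f x) by exact: rapidZ rf.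
have If : cintegrable leb (fun x => f x * expi (s * dot l x)).
  apply: (cintegrableM (rapid1_cintegrable rf) (cmeasurable_wave s l) (M := 1)) => x.
  by rewrite modulus_expi.
have Idf : cintegrable leb (fun x => df x * expi (s * dot l x)).
  apply: (cintegrableM (rapid1_cintegrable rdf) (cmeasurable_wave s l) (M := 1)) => x.
  by rewrite modulus_expi.
have [C1 h1] := rapid1_weight rf.
have [C2 h2] := rapid1_weight (rapidD rdf rcf).
have : cintegral leb (fun x => (df x + c * f x) * expi (s * dot l x)) = 0.
  apply: (@cintegral_partial0 j (fun x => f x * expi (s * dot l x)) _ (Num.max C1 C2)).
  - apply: ccontinuousM; last exact: continuous_wave.
    exact: rapid1_continuous (rapidD rdf rcf).
  - move=> x; apply: cderive_eq (cderiveM (fd x) (cderive_wave s l x j)) _.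
    by rewrite mulrDl; congr (_ + _); rewrite mulrA [c * _]mulrC.
  - move=> x; rewrite modulusM modulus_expi mulr1 (le_trans (h1 x))//.
    by rewrite ler_wpM2r ?weight_ge0// le_max lexx.
  - move=> x; rewrite modulusM modulus_expi mulr1 (le_trans (h2 x))//.
    by rewrite ler_wpM2r ?weight_ge0// le_max lexx orbT.
rewrite (eq_cintegral _ (g := fun x => df x * expi (s * dot l x) +
    c * (f x * expi (s * dot l x)))); last by move=> x; rewrite mulrDl mulrA.
rewrite cintegralD//; last exact: cintegrableZ.
by rewrite cintegralZ// => /eqP; rewrite addr_eq0 => /eqP ->; rewrite mulNr.
Qed.

End rapid.

(** * Taylor bounds for e^(it) *)

Section small_angles.
Context (R : realType).

Lemma le_MVT0 (g dg : R -> R) (M t : R) : 0 <= t ->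
  (forall s, is_derive s (1 : R) g (dg s)) ->
  (forall s, 0 <= s <= t -> `|dg s| <= M) -> `|g t - g 0| <= M * t.
Proof.
move=> t0 gd gM.
have cg : {within `[0, t], continuous g}.
  by apply: derivable_within_continuous => s _; case: (gd s).
have [a] := MVT_segment t0 (fun s _ => gd s) cg.
rewrite in_itv/= => a0t ->; rewrite subr0 normrM (ger0_norm t0).
by rewrite ler_wpM2r// gM.
Qed.

Lemma norm_sin_le (t : R) : `|sin t| <= `|t|.
Proof.
wlog t0 : t / 0 <= t => [H|].
  by case: (leP 0 t) => [/H//|/ltW]; rewrite -oppr_ge0 => /H; rewrite sinN !normrN.
have := @le_MVT0 sin cos 1 t t0 (fun s => is_derive_sin s).
rewrite sin0 subr0 mul1r (ger0_norm t0); apply => s _.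
by rewrite ler_norml cos_geN1 cos_le1.
Qed.

Lemma norm_cosB1_le (t : R) : `|cos t - 1| <= `|t|.
Proof.
wlog t0 : t / 0 <= t => [H|].
  by case: (leP 0 t) => [/H//|/ltW]; rewrite -oppr_ge0 => /H; rewrite cosN !normrN.
have := @le_MVT0 cos (fun s => - sin s) 1 t t0 (fun s => is_derive_cos s).
rewrite cos0 mul1r (ger0_norm t0); apply => s _.
by rewrite normrN ler_norml sin_geN1 sin_le1.
Qed.

Lemma norm_cosB1_le2 (t : R) : `|cos t - 1| <= t ^+ 2.
Proof.
wlog t0 : t / 0 <= t => [H|].
  by case: (leP 0 t) => [/H//|/ltW]; rewrite -oppr_ge0 => /H; rewrite cosN sqrrN.
have := @le_MVT0 cos (fun s => - sin s) t t t0 (fun s => is_derive_cos s).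
rewrite cos0 -expr2; apply => s /andP[s0 st].
by rewrite normrN (le_trans (norm_sin_le s))// ger0_norm.
Qed.

Lemma norm_sinB_le2 (t : R) : `|sin t - t| <= t ^+ 2.
Proof.
wlog t0 : t / 0 <= t => [H|].
  case: (leP 0 t) => [/H//|/ltW]; rewrite -oppr_ge0 => /H.
  by rewrite sinN sqrrN -opprD normrN.
have sd (s : R) : is_derive s (1 : R) (fun s => sin s - s) (cos s - 1).
  exact: (is_deriveB (is_derive_sin s) (is_derive_id s 1)).
have := @le_MVT0 (fun s => sin s - s) (fun s => cos s - 1) t t t0 sd.
rewrite sin0 !subr0 -expr2; apply => s /andP[s0 st].
by rewrite (le_trans (norm_cosB1_le s))// ger0_norm.
Qed.

Lemma modulus_expiB1 (t : R) : modulus (expi t - 1) <= 2 * `|t|.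
Proof.
rewrite (le_trans (modulus_le _))//= subr0 mulrDl mul1r.
by rewrite lerD ?norm_cosB1_le ?norm_sin_le.
Qed.

Lemma modulus_expiB2 (t : R) : modulus (expi t - 1 - Complex 0 t) <= 2 * t ^+ 2.
Proof.
rewrite (le_trans (modulus_le _))//= subr0 subr0 mulrDl mul1r.
by rewrite lerD ?norm_cosB1_le2 ?norm_sinB_le2.
Qed.

End small_angles.

(** * Transforms of rapidly decreasing functions *)

Section fourier_of_rapid.
Context (R : realType) (d : nat).
Local Notation leb := (lebesgue_rV R d).
Local Notation e_ := (delta_mx ord0).

(** Difference quotients have a continuous parameter while [dominated_cintegral] concerns sequences;
    a quadratic remainder replaces the limit under the integral sign. *)
Lemma is_derive_quadratic (V : normedModType R) (g : V -> R) x v a (C : R) :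
  (forall t : R, `|g (t *: v + x) - g x - t * a| <= C * t ^+ 2) ->
  is_derive x v g a.
Proof.
move=> gC.
have H : h^-1 *: ((g \o shift x) (h *: v) - g x) @[h --> (0 : R)^'] --> a.
  apply/cvgrPdist_le => e e0; near=> h.
  have h0 : h != 0 by near: h; exact: nbhs_dnbhs_neq.
  have -> : a - h^-1 *: ((g \o shift x) (h *: v) - g x) =
      - h^-1 * (g (h *: v + x) - g x - h * a).
    by rewrite /GRing.scale/=; field.
  rewrite normrM normrN normfV ler_pdivrMl ?normr_gt0//.
  apply: le_trans (gC h) _; rewrite -real_normK ?num_real// expr2 mulrA.
  rewrite [leRHS]mulrC ler_wpM2r//.
  apply: (@le_trans _ _ ((`|C| + 1) * `|h|)).
    by rewrite ler_wpM2r// (le_trans (ler_norm _))// lerDl.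
  rewrite -ler_pdivlMl ?ltr_pwDr//.
  near: h; apply: dnbhs0_le; rewrite mulr_gt0// invr_gt0 ltr_pwDr//.
split; first by apply/cvg_ex; exists a.
exact: cvg_lim H.
Unshelve. all: by end_near.
Qed.

Lemma cderive_quadratic (V : normedModType R) (g : V -> 'C[R]) x v a (C : R) :
  (forall t : R, modulus (g (t *: v + x) - g x - (t%:C%C : 'C[R]) * a) <= C * t ^+ 2) ->
  cderive g x v a.
Proof.
move=> gC; split; apply: (@is_derive_quadratic _ _ _ _ _ C) => t.
  apply: le_trans (gC t); apply: le_trans (le_Re_modulus _).
  by rewrite !(ReD, ReN) ReM /= mul0r subr0.
apply: le_trans (gC t); apply: le_trans (le_Im_modulus _).
by rewrite !(ImD, ImN) ImM /= mul0r addr0.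
Qed.

Lemma rapid1_coord (f : 'rV[R]_d -> 'C[R]) j : rapid1 f ->
  rapid1 (fun x : 'rV[R]_d => (x ord0 j)%:C%C * f x).
Proof. exact: rapid_coord. Qed.

Lemma rapid1Z (c : 'C[R]) (f : 'rV[R]_d -> 'C[R]) : rapid1 f -> rapid1 (fun x => c * f x).
Proof. exact: rapidZ. Qed.

(** The first-order remainder is the integral of [f] times a wave times e^(-is) - 1 + is, with s = t
    x_j. That factor is at most 2 s^2, so a second moment of [f] bounds the remainder by K t^2. *)
Lemma cderive_ft (f : 'rV[R]_d -> 'C[R]) j l : rapid1 f ->
  cderive (ft f) l (e_ j)
    (ft (fun x : 'rV[R]_d => (Complex 0 (-1) : 'C[R]) * ((x ord0 j)%:C%C * f x)) l).
Proof.
move=> rf; have rx := rapid1_coord j rf; have rxx := rapid1_coord j rx.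
have If := rapid1_cintegrable rf.
have Ix := rapid1_cintegrable (rapid1Z (Complex 0 (-1)) rx).
pose K := \int[leb]_x (2 * modulus (((x ord0 j)%:C%C : 'C[R]) * ((x ord0 j)%:C%C * f x))).
have Ig : leb.-integrable setT (EFin \o fun x : 'rV[R]_d =>
    2 * modulus (((x ord0 j)%:C%C : 'C[R]) * ((x ord0 j)%:C%C * f x))).
  exact: integrableZl (integrable_modulus (rapid1_cintegrable rxx)).
apply: (@cderive_quadratic _ _ _ _ _ K) => t.
have E : ft f (t *: e_ j + l) - ft f l - (t%:C%C : 'C[R]) *
    ft (fun x : 'rV[R]_d => (Complex 0 (-1) : 'C[R]) * ((x ord0 j)%:C%C * f x)) l =
    cintegral leb (fun x : 'rV[R]_d => f x * expi (- dot l x) *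
      (expi (- (t * x ord0 j)) - 1 - Complex 0 (- (t * x ord0 j)))).
  rewrite -ftZ// /ft -cintegralB; [|exact: cintegrable_ft..].
  rewrite -cintegralB.
  - apply: eq_cintegral => x.
    rewrite dotC dotDr dotZr dot_delta dotC opprD [- (t * _) + _]addrC expiD.
    rewrite !mulrBr mulr1 -!mulrA; congr (_ - _).
    have -> : Complex 0 (- (t * x ord0 j)) =
        (t%:C%C : 'C[R]) * ((Complex 0 (-1) : 'C[R]) * ((x ord0 j)%:C%C : 'C[R])).
      by apply: complexP; rewrite !(ReM, ImM) /=; ring.
    by rewrite [RHS]mulrA [RHS]mulrC -!mulrA.
  - by apply: cintegrableB; exact: cintegrable_ft.
  - by apply: cintegrable_ft; exact: cintegrableZ.
rewrite E; apply: (@le_trans _ _ (\int[leb]_x (t ^+ 2 *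
    (2 * modulus (((x ord0 j)%:C%C : 'C[R]) * ((x ord0 j)%:C%C * f x)))))).
  apply: modulus_cintegral_le.
  - apply: cmeasurableM.
      exact: cintegrable_measurable (cintegrable_ft _ If).
    have mt : measurable_fun setT (fun x : 'rV[R]_d => - (t * x ord0 j)).
      apply: measurable_funN; apply: measurable_funM => //.
      exact: measurable_coord.
    apply: cmeasurableB; last by split => //=.
    by apply: cmeasurableB; [exact: cmeasurable_expi|exact: cmeasurable_cst].
  - exact: (integrableZl measurableT (t ^+ 2) Ig).
  - move=> x; rewrite !modulusM modulus_expi mulr1 !modulus_real.
    rewrite mulrC; apply: le_trans (ler_wpM2r (modulus_ge0 _) (modulus_expiB2 _)) _.
    rewrite sqrrN exprMn -(real_normK (num_real (x ord0 j))).
    by rewrite le_eqVlt; apply/orP; left; apply/eqP; ring.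
by rewrite RintegralZl// mulrC.
Qed.

Lemma ft_partial (f df : 'rV[R]_d -> 'C[R]) j (l : 'rV[R]_d) : rapid1 f -> rapid1 df ->
  (forall x, cderive f x (e_ j) (df x)) ->
  ft df l = (Complex 0 (l ord0 j) : 'C[R]) * ft f l.
Proof.
move=> rf rdf fd; have W (g : 'rV[R]_d -> 'C[R]) :
    ft g l = cintegral leb (fun x => g x * expi (-1 * dot l x)).
  by apply: eq_cintegral => x; rewrite dotC mulN1r.
rewrite !W (wave_by_parts (-1) l rf rdf fd); congr (_ * _).
by apply: complexP => /=; ring.
Qed.

Lemma integrable_Rsum I (r : seq I) (F : I -> 'rV[R]_d -> R) :
  (forall i, leb.-integrable setT (EFin \o F i)) ->
  leb.-integrable setT (EFin \o (fun x => \sum_(i <- r) F i x)) /\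
  \int[leb]_x (\sum_(i <- r) F i x) = \sum_(i <- r) \int[leb]_x F i x.
Proof.
move=> IF; elim: r => [|i r [ih1 ih2]].
  rewrite (_ : (fun _ => _) = fun=> 0); last by apply/funext => x; rewrite big_nil.
  by rewrite big_nil /Rintegral integral0_eq//; split => //; exact: integrable0.
have -> : (fun x => \sum_(j <- i :: r) F j x) = (fun x => F i x + \sum_(j <- r) F j x).
  by apply/funext => x; rewrite big_cons.
split; first exact: integrableD (IF i) ih1.
by rewrite RintegralD// ih2 big_cons.
Qed.

(** |e^(is) - 1| <= 2 |s| gives a Lipschitz bound whose constants are first moments of [f]. *)
Lemma continuous_ft (f : 'rV[R]_d -> 'C[R]) : rapid1 f -> continuous (ft f).
Proof.
move=> rf l; have If := rapid1_cintegrable rf.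
have Ix j := integrable_modulus (rapid1_cintegrable (rapid1_coord j rf)).
pose q j (x : 'rV[R]_d) := modulus (((x ord0 j)%:C%C : 'C[R]) * f x).
pose K j := 2 * \int[leb]_x q j x.
have bound y : modulus (ft f l - ft f y) <= \sum_j `|l ord0 j - y ord0 j| * K j.
  have Iq j : leb.-integrable setT (EFin \o (fun x => `|l ord0 j - y ord0 j| * (2 * q j x))).
    exact: integrableZl (integrableZl measurableT 2 (Ix j)).
  have [Is Es] := integrable_Rsum (index_enum _) Iq.
  have -> : \sum_j `|l ord0 j - y ord0 j| * K j =
      \int[leb]_x (\sum_j `|l ord0 j - y ord0 j| * (2 * q j x)).
    rewrite Es; apply: eq_bigr => j _.
    rewrite RintegralZl//; last exact: integrableZl (Ix j).
    by rewrite RintegralZl//; exact: Ix.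
  rewrite /ft -cintegralB; [|exact: cintegrable_ft..].
  apply: modulus_cintegral_le => //.
    by apply: cmeasurableB; exact: cintegrable_measurable (cintegrable_ft _ If).
  move=> x; rewrite (dotC l x) (dotC y x).
  have -> : f x * expi (- dot x l) - f x * expi (- dot x y) =
      f x * expi (- dot x y) * (expi (dot x (y - l)) - 1).
    rewrite mulrBr mulr1 -mulrA -expiD dotDr dotNr; congr (_ * expi _ - _).
    by ring.
  rewrite !modulusM modulus_expi mulr1.
  apply: le_trans (ler_wpM2l (modulus_ge0 _) (modulus_expiB1 _)) _.
  rewrite mulrCA [dot _ _]/dot.
  apply: (@le_trans _ _ (modulus (f x) * (2 * \sum_j `|x ord0 j * (y - l) ord0 j|))).
    rewrite mulrCA !ler_wpM2l ?modulus_ge0//; exact: ler_norm_sum.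
  rewrite !mulr_sumr; apply: ler_sum => j _.
  rewrite /q modulusM modulus_real normrM !mxE distrC.
  by rewrite le_eqVlt; apply/orP; left; apply/eqP; ring.
apply/(@cvg_modulusP _ _ _ _ (nbhs_filter l)).
pose B (y : 'rV[R]_d) := \sum_j `|l ord0 j - y ord0 j| * K j.
have B0 : B y @[y --> l] --> (0 : R).
  have -> : 0 = \sum_(j < d) (0 : R) by rewrite big1.
  apply: (@cvg_rsum _ _ _ (nbhs_filter l) _ _
    (fun j (y : 'rV[R]_d) => `|l ord0 j - y ord0 j| * K j)) => j.
  rewrite -[X in _ --> X](mul0r (K j)); apply: (@cvgMl _ _ _ (nbhs_filter l)).
  rewrite -[X in _ --> X](normr0 R) -(subrr (l ord0 j)).
  apply: (@cvg_norm _ _ _ _ (nbhs_filter l)).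
  apply: (@cvgB _ _ _ _ (nbhs_filter l)); first exact: (@cvg_cst _ _ _ _ (nbhs_filter l)).
  exact: coord_continuous.
have nb : \forall y \near nbhs l, 0 <= modulus (ft f l - ft f y) <= B y.
  by apply: nearW => y; rewrite modulus_ge0 bound.
apply: (@squeeze_cvgr _ _ (nbhs_filter l) _ (fun=> 0) B _ nb) => //.
exact: (@cvg_cst _ _ _ _ (nbhs_filter l)).
Qed.

(* up to constants, multiplication by a coordinate and differentiation are *)
(* exchanged by ft, so that the set of all ft h, h rapid, is closed *)
Lemma rapid_ft I (b : I -> R) (h : I -> 'rV[R]_d -> 'C[R]) :
  rapid b h -> rapid b (fun i => ft (h i)).
Proof.
move=> rh; exists [set g | exists2 h, rapid b h & g = (fun i => ft (h i))].
split; last by exists h.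
move=> _ [g rg ->]; have Ig i := rapid1_cintegrable (rapid_member i rg).
split.
- have [C gC] := rapid_weight rg.
  exists (C * \int[leb]_x weight x) => i l.
  apply: le_trans (modulus_ft _ (Ig i)) _.
  apply: (@le_trans _ _ (\int[leb]_x (C * b i * weight x))).
    apply: le_Rintegral => //; first exact: integrable_modulus (Ig i).
    exact: integrable_weightZ.
  by rewrite RintegralZl//; [rewrite mulrAC|exact: integrable_weight].
- by move=> i; apply: continuous_ft; exact: rapid_member rg.
- move=> j; have [dg [rdg gd]] := rapid_derive j rg.
  exists (fun i x => (Complex 0 (-1) : 'C[R]) * dg i x); first exact: rapidZ.
  apply/funext => i; apply/funext => l.
  rewrite ftZ; last exact: rapid1_cintegrable (rapid_member i rdg).
  rewrite (ft_partial l (rapid_member i rg) (rapid_member i rdg) (gd i)) mulrA.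
  have -> : (Complex 0 (-1) : 'C[R]) * (Complex 0 (l ord0 j) : 'C[R]) = (l ord0 j)%:C%C.
    by apply: complexP; rewrite !(ReM, ImM) /=; ring.
  by [].
- move=> j.
  exists (fun i => ft (fun x : 'rV[R]_d => (Complex 0 (-1) : 'C[R]) * ((x ord0 j)%:C%C * g i x))).
  split; last by move=> i x; apply: cderive_ft; exact: rapid_member rg.
  exists (fun i (x : 'rV[R]_d) => (Complex 0 (-1) : 'C[R]) * ((x ord0 j)%:C%C * g i x)) => //.
  by apply: rapidZ; exact: rapid_coord.
Qed.

Lemma rapid_ift_weight I (b : I -> R) (h : I -> 'rV[R]_d -> 'C[R]) : rapid b h ->
  exists C, forall i x, modulus (ift (h i) x) <= C * b i * weight x.
Proof.
move=> /rapid_ft/rapid_weight[C hC]; exists C => i x; rewrite iftE.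
apply: le_trans (hC i (- x)) _.
suff -> : weight (- x) = weight x by [].
by apply: eq_bigr => j _; rewrite /oneDsqr mxE sqrrN.
Qed.

(** Converts the pointwise rate [b] of a family into a rate for L^1 norms: the source both of the
    analyticity of the resolvent and of the upper bound for the spectral radius. *)
Lemma rapid_ift_L1 I (b : I -> R) (h : I -> 'rV[R]_d -> 'C[R]) : rapid b h ->
  exists C, forall i, \int[leb]_x modulus (ift (h i) x) <= C * b i.
Proof.
move=> rh; have [C hC] := rapid_ift_weight rh.
exists (C * \int[leb]_x weight x) => i.
have Ih := rapid1_cintegrable (rapid_member i rh).
rewrite mulrAC -RintegralZl//; last exact: integrable_weight.
apply: le_Rintegral => //; last exact: integrable_weightZ.
apply: integrable_modulus.
apply: (cintegrable_le _ (integrable_weightZ d (C * b i))) => //.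
exact: cmeasurable_ift.
Qed.

Lemma rapid1_ift_cintegrable (h : 'rV[R]_d -> 'C[R]) : rapid1 h -> cintegrable leb (ift h).
Proof.
move=> rh; have [C hC] := rapid_ift_weight rh.
have Ih := rapid1_cintegrable rh.
apply: (cintegrable_le _ (integrable_weightZ d (C * 1))); last exact: hC tt.
exact: cmeasurable_ift.
Qed.

Lemma cderive_coord (i j : 'I_d) (x : 'rV[R]_d) :
  cderive (fun y : 'rV[R]_d => (y ord0 j)%:C%C : 'C[R]) x (e_ i) (i == j)%:R.
Proof.
apply: (@cderive_quadratic _ _ _ _ _ 0) => t.
rewrite mul0r !mxE eqxx /= (_ : _ - _ = 0) ?modulus0//.
rewrite eq_sym; case: (_ == _); last by rewrite !mulr0 add0r !subrr.
by rewrite !mulr1 rmorphD addrK subrr.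
Qed.

(** The invariant set of a Schwartz function. It is stable under derivatives too, because the i-th
    derivative of x_j g is delta_ij g plus x_j times that of g. *)
Inductive schwartz_span (f : 'rV[R]_d -> 'C[R]) : ('rV[R]_d -> 'C[R]) -> Prop :=
| SpanPartial s : schwartz_span f (foldr (@partial R d) f s)
| SpanCoord j g : schwartz_span f g ->
    schwartz_span f (fun x : 'rV[R]_d => (x ord0 j)%:C%C * g x)
| SpanAdd g h : schwartz_span f g -> schwartz_span f h ->
    schwartz_span f (fun x => g x + h x).

(** A monomial, given as the list [t], is carried along so that a coordinate factor of [g] can be
    moved into it during the induction. *)
Lemma schwartz_span_bounded f g (t : seq 'I_d) : schwartz f -> schwartz_span f g ->
  exists M, forall x : 'rV[R]_d, `|\prod_(j <- t) x ord0 j| * modulus (g x) <= M.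
Proof.
move=> [sf bf]; move=> sg; elim: sg t => {g} [s|j g _ ih|g h _ ihg _ ihh] t.
- have [b ->] := foldr_partialE s sf.
  pose m : mpoly.multinom d := mpoly.Multinom [tuple count_mem j t | j < d].
  have [M hM] := bf m b; exists M => x; apply: le_trans (hM x).
  suff -> : \prod_(j <- t) x ord0 j = monomial m x by [].
  have -> : monomial m x = \prod_j x ord0 j ^+ count_mem j t.
    by apply: eq_bigr => j _; rewrite /mpoly.fun_of_multinom tnth_mktuple.
  elim: (t) => [|j r ih]; first by rewrite big_nil big1.
  rewrite big_cons ih [RHS](bigD1 j)//= [in LHS](bigD1 j)//= eqxx add1n exprS -mulrA.
  congr (_ * (_ * _)); apply: eq_bigr => i ij.
  by rewrite eq_sym (negbTE ij).
- have [M hM] := ih (j :: t); exists M => x.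
  apply: le_trans (hM x).
  by rewrite big_cons normrM modulusM modulus_real mulrA [`|_| * `|_|]mulrC.
- have [M1 h1] := ihg t; have [M2 h2] := ihh t; exists (M1 + M2) => x.
  apply: le_trans (ler_wpM2l (normr_ge0 _) (modulusD _ _)) _.
  by rewrite mulrDr lerD.
Qed.

Lemma schwartz_rapid1 (f : 'rV[R]_d -> 'C[R]) : schwartz f -> rapid1 f.
Proof.
move=> sf; exists [set g | exists2 g0, schwartz_span f g0 & g = (fun _ => g0)].
split; last by exists f => //; exact: (SpanPartial f [::]).
move=> _ [g sg ->]; split.
- have [M hM] := schwartz_span_bounded [::] sf sg.
  by exists M => _ x; have := hM x; rewrite big_nil normr1 mul1r mulr1.
- move=> _; elim: sg => {g} [s|j g _ ih|g h _ ihg _ ihh].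
  + by have [] := sf.1 s.
  + apply: (ccontinuousM _ ih) => x.
    apply/(@cvg_complexP _ _ _ (nbhs_filter x)); split => /=.
      exact: coord_continuous.
    exact: (@cvg_cst _ _ _ _ (nbhs_filter x)).
  + exact: (ccontinuousD ihg ihh).
- by move=> j; exists (fun x : 'rV[R]_d => (x ord0 j)%:C%C * g x) => //; exact: SpanCoord.
- move=> i.
  suff [dg sdg gd] : exists2 dg, schwartz_span f dg & forall x, cderive g x (e_ i) (dg x).
    by exists (fun _ => dg); split; [exists dg|].
  elim: sg => {g} [s|j g sg [dg sdg gd]|g h _ [dg sdg gd] _ [dh sdh hd]].
  + exists (partial i (foldr (@partial R d) f s)); first exact: (SpanPartial f (i :: s)).
    by move=> x; apply: cderive_partial_smooth; have [] := sf.1 s.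
  + have gd' x := cderiveM (cderive_coord i j x) (gd x).
    case: (eqVneq i j) gd' => [<-|ij] gd'.
      exists (fun x : 'rV[R]_d => g x + (x ord0 i)%:C%C * dg x).
        by apply: SpanAdd => //; exact: SpanCoord.
      by move=> x; apply: cderive_eq (gd' x) _; rewrite mul1r.
    exists (fun x : 'rV[R]_d => (x ord0 j)%:C%C * dg x); first exact: SpanCoord.
    by move=> x; apply: cderive_eq (gd' x) _; rewrite mul0r add0r.
  + exists (fun x => dg x + dh x); first exact: SpanAdd.
    by move=> x; exact: cderiveD.
Qed.

End fourier_of_rapid.

(** * Polynomial functions *)

Section polynomial_functions.
Context (R : realType) (d : nat).
Local Notation e_ := (delta_mx ord0).

(** Described by closure instead of coefficients: derivatives and products with rapid families
    follow by induction on the construction. *)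
Inductive polynomial_fun : ('rV[R]_d -> 'C[R]) -> Prop :=
| PolyCst c : polynomial_fun (fun _ => c)
| PolyCoord j : polynomial_fun (fun x : 'rV[R]_d => (x ord0 j)%:C%C)
| PolyAdd p q : polynomial_fun p -> polynomial_fun q ->
    polynomial_fun (fun x => p x + q x)
| PolyMul p q : polynomial_fun p -> polynomial_fun q ->
    polynomial_fun (fun x => p x * q x).

Lemma polynomial_fun_derive p j : polynomial_fun p -> exists dp, polynomial_fun dp /\
  forall x, cderive p x (e_ j) (dp x).
Proof.
elim=> {p} [c|i|p q pp [dp [pdp dpE]] pq [dq [pdq dqE]]
  |p q pp [dp [pdp dpE]] pq [dq [pdq dqE]]].
- exists (fun _ => 0); split; first exact: PolyCst.
  by move=> x; exact: cderive_cst.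
- exists (fun _ => (j == i)%:R); split; first exact: PolyCst.
  by move=> x; exact: cderive_coord.
- exists (fun x => dp x + dq x); split; first exact: PolyAdd.
  by move=> x; exact: cderiveD.
- exists (fun x => dp x * q x + p x * dq x); split.
    by apply: PolyAdd; exact: PolyMul.
  by move=> x; exact: cderiveM.
Qed.

Lemma polynomial_fun_continuous p : polynomial_fun p -> continuous p.
Proof.
elim=> {p} [c|i|p q _ cp _ cq|p q _ cp _ cq].
- exact: ccontinuous_cst.
- move=> x; apply/(@cvg_complexP _ _ _ (nbhs_filter x)); split => /=.
    exact: coord_continuous.
  exact: (@cvg_cst _ _ _ _ (nbhs_filter x)).
- exact: (ccontinuousD cp cq).
- exact: (ccontinuousM cp cq).
Qed.

Lemma rapid_polynomial I (b : I -> R) g p : rapid b g -> polynomial_fun p ->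
  rapid b (fun i x => p x * g i x).
Proof.
move=> rg pp; elim: pp g rg => {p} [c|j|p q _ ihp _ ihq|p q _ ihp _ ihq] g rg.
- exact: rapidZ.
- exact: rapid_coord.
- apply: rapid_ext (rapidD (ihp _ rg) (ihq _ rg)) => i x.
  by rewrite mulrDl.
- apply: rapid_ext (ihp _ (ihq _ rg)) => i x.
  by rewrite mulrA.
Qed.

Lemma polynomial_fun_prod I (r : seq I) (F : I -> 'rV[R]_d -> 'C[R]) :
  (forall i, polynomial_fun (F i)) -> polynomial_fun (fun x => \prod_(i <- r) F i x).
Proof.
move=> pF; elim: r => [|i r ih].
  by rewrite (_ : (fun _ => _) = fun=> 1);
    [exact: PolyCst|apply/funext => x; rewrite big_nil].
rewrite (_ : (fun _ => _) = fun x => F i x * \prod_(j <- r) F j x).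
  exact: PolyMul.
by apply/funext => x; rewrite big_cons.
Qed.

Lemma polynomial_fun_exp p n : polynomial_fun p -> polynomial_fun (fun x => p x ^+ n).
Proof.
move=> pp; rewrite (_ : (fun _ => _) = fun x => \prod_(i <- iota 0 n) p x).
  exact: polynomial_fun_prod.
by apply/funext => x; rewrite big_const_seq count_predT size_iota -Monoid.iteropE.
Qed.

Lemma polynomial_fun_imag j : polynomial_fun (fun x : 'rV[R]_d => Complex 0 (x ord0 j)).
Proof.
apply: (eq_rect _ _ (PolyMul (PolyCst (Complex 0 1)) (PolyCoord j))).
apply/funext => x.
by apply: complexP; rewrite !(ReM, ImM) /=; ring.
Qed.

Lemma polynomial_fun_symbol P : polynomial_fun (@symbol R d P).
Proof.
rewrite (_ : symbol P = fun x => \sum_(m <- mpoly.msupp P)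
  (mpoly.mcoeff m P : 'C[R]) *
    \prod_j (Complex 0 (x ord0 j) : 'C[R]) ^+ mpoly.fun_of_multinom m j); last first.
  by apply/funext => x; rewrite /symbol mpoly.mevalE.
elim: (mpoly.msupp P : seq _) => [|m r ih].
  by rewrite (_ : (fun _ => _) = fun=> 0);
    [exact: PolyCst|apply/funext => x; rewrite big_nil].
have pt := PolyMul (PolyCst (mpoly.mcoeff m P)) (polynomial_fun_prod (index_enum _)
  (fun j => polynomial_fun_exp (mpoly.fun_of_multinom m j) (polynomial_fun_imag j))).
apply: (eq_rect _ _ (PolyAdd pt ih)); apply/funext => x.
by rewrite big_cons.
Qed.

End polynomial_functions.

(** With a = ln(r2/r1) and y = (n+1) a this is the bound y^m exp(-y) <= m^m; the factor exp(a)
    corrects the exponent n + 1 to n. *)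
Lemma polynomial_geometric_le (R : realType) (r1 r2 : R) m : 0 < r1 -> r1 < r2 ->
  exists C, forall n, n.+1%:R ^+ m * r1 ^+ n <= C * r2 ^+ n.
Proof.
move=> r10 r12; have r20 : 0 < r2 by exact: lt_trans r12.
pose a := ln (r2 / r1); have a0 : 0 < a by rewrite ln_gt0// ltr_pdivlMr ?mul1r.
have rE : r1 = expR (- a) * r2.
  rewrite expRN lnK ?posrE ?divr_gt0//; field.
  by rewrite !gt_eqF.
exists (m%:R ^+ m * expR a / a ^+ m) => n.
rewrite rE exprMn mulrA ler_wpM2r ?exprn_ge0 ?(ltW r20)//.
rewrite ler_pdivlMr ?exprn_gt0// -expRM_natl.
have := @exprn_expRN_le R m (n.+1%:R * a) (mulr_ge0 (ler0n _ _) (ltW a0)).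
rewrite exprMn => h.
rewrite -(ler_pM2r (expR_gt0 (- a))) -[leRHS]mulrA -expRD subrr expR0 mulr1.
apply: le_trans h; rewrite le_eqVlt; apply/orP; left; apply/eqP.
rewrite -[RHS]mulrA mulrAC -!mulrA; congr (_ * _).
rewrite mulrA -expRD mulrC; congr (_ * expR _).
by rewrite -[in RHS]natr1; ring.
Qed.

(** * Families of powers *)

Section rapid_powers.
Context (R : realType) (d : nat).
Local Notation e_ := (delta_mx ord0).
Variables (K : set 'rV[R]_d) (G : nat -> nat -> 'rV[R]_d -> 'C[R]).
Variables (c : nat -> nat -> 'C[R]) (q : 'I_d -> 'rV[R]_d -> 'C[R]).
Variables (B : nat -> R) (r1 r2 : R).
Hypotheses (clK : closed K) (r10 : 0 < r1) (r12 : r1 < r2).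
Hypothesis cle : forall n k, modulus (c n k) <= (n + k)%:R.
Hypothesis pq : forall j, polynomial_fun (q j).
Hypothesis Gd : forall n k j x, K x ->
  cderive (G n k) x (e_ j) (c n k * G n k.+1 x * q j x).
Hypothesis Gle : forall n k x, K x -> modulus (G n k x) <= B k * r1 ^+ n.
Hypothesis Gc : forall n k x, K x -> G n k y @[y --> x] --> G n k x.

(* in the applications G n k is Q ^ (n - k) or Q ^ - (n + k): each derivative *)
(* costs a factor O(n), absorbed by passing from r1 to r2, and increases k *)
Inductive powers_span : (nat -> 'rV[R]_d -> 'C[R]) -> Prop :=
| PowersBase k m (C : R) (a : nat -> 'C[R]) h :
    (forall n, modulus (a n) <= C * n.+1%:R ^+ m) -> rapid1 h ->
    (forall x, ~ K x -> h x = 0) ->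
    powers_span (fun n x => a n * G n k x * h x)
| PowersAdd g h : powers_span g -> powers_span h ->
    powers_span (fun n x => g n x + h n x).

Lemma near_outside (x : 'rV[R]_d) : ~ K x -> \forall y \near x, ~ K y.
Proof.
move=> Kx; apply: open_nbhs_nbhs; split => //.
exact: closed_openC.
Qed.

Lemma cderive_unique (g : 'rV[R]_d -> 'C[R]) x v a b : cderive g x v a -> cderive g x v b -> a = b.
Proof.
move=> [ar ai] [br bi]; apply: complexP.
  by rewrite -(@derive_val _ _ _ _ _ _ _ ar) -(@derive_val _ _ _ _ _ _ _ br).
by rewrite -(@derive_val _ _ _ _ _ _ _ ai) -(@derive_val _ _ _ _ _ _ _ bi).
Qed.

Lemma cderive_outside (g : 'rV[R]_d -> 'C[R]) x v : (forall y, ~ K y -> g y = 0) ->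
  ~ K x -> cderive g x v 0.
Proof.
move=> g0 Kx; apply: cderive_near (cderive_cst 0 x v).
by apply: filterS (near_outside Kx) => y Ky; rewrite g0.
Qed.

(** [powers_span] is itself the invariant set. On K, differentiating a generator gives one with k
    and m raised by 1 and one with the derivative of [h]; off K the functions vanish near the point,
    K being closed. The growth (n+1)^m r1^n is O(r2^n). *)
Lemma rapid_powers_span g : powers_span g -> rapid (fun n => r2 ^+ n) g.
Proof.
move=> sg0; exists powers_span; split => // {g sg0} g sg; split.
- elim: sg => {g} [k m C a h aC rh h0|g h _ [C1 C1P] _ [C2 C2P]].
    have [D hD] := rapid_le rh.
    have [E EP] := polynomial_geometric_le m r10 r12.
    have D0 : 0 <= D by have := le_trans (modulus_ge0 _) (hD tt 0); rewrite mulr1.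
    have C0 : 0 <= C.
      have := le_trans (modulus_ge0 _) (aC 0%N); rewrite expr1n mulr1; exact.
    exists (C * D * `|B k| * E) => n x.
    case: (pselect (K x)) => Kx; last first.
      rewrite h0// mulr0 modulus0 mulr_ge0//; last by rewrite exprn_ge0// ltW// (lt_trans r10).
      rewrite !mulr_ge0//; have := EP 0%N; rewrite expr0 !mulr1 expr1n.
      exact: le_trans ler01.
    rewrite !modulusM.
    apply: (@le_trans _ _ (C * n.+1%:R ^+ m * (`|B k| * r1 ^+ n) * D)).
      apply: ler_pM; rewrite ?modulus_ge0 ?mulr_ge0 ?modulus_ge0//.
        apply: ler_pM; rewrite ?modulus_ge0//.
        apply: le_trans (Gle n k Kx) _; rewrite ler_wpM2r ?exprn_ge0 ?(ltW r10)//.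
        exact: ler_norm.
      by have := hD tt x; rewrite mulr1.
    rewrite (_ : _ * D = C * D * `|B k| * (n.+1%:R ^+ m * r1 ^+ n)); last by ring.
    by rewrite -[leRHS]mulrA ler_wpM2l ?mulr_ge0.
  exists (C1 + C2) => n x; apply: le_trans (modulusD _ _) _.
  by rewrite mulrDl lerD.
- move=> n; elim: sg => {g} [k m C a h aC rh h0|g h _ cg _ ch].
    move=> x; case: (pselect (K x)) => Kx.
      apply: (@ccvgM _ _ _ (nbhs_filter x)); last exact: rapid1_continuous rh x.
      apply: (@ccvgM _ _ _ (nbhs_filter x)); last exact: Gc.
      exact: (@cvg_cst _ _ _ _ (nbhs_filter x)).
    have E0 : a n * G n k x * h x = 0 by rewrite h0// mulr0.
    rewrite /continuous_at E0; apply: (@cvg_near_cst _ _ _ _ _ (nbhs_filter x)).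
    by apply: filterS (near_outside Kx) => y Ky; rewrite h0// mulr0.
  exact: (ccontinuousD cg ch).
- move=> j; elim: sg => {g} [k m C a h aC rh h0|g h _ sg _ sh].
    rewrite (_ : (fun _ _ => _) = fun n (x : 'rV[R]_d) => a n * G n k x * ((x ord0 j)%:C%C * h x)).
      apply: (PowersBase k aC); first exact: rapid1_coord.
      by move=> x Kx; rewrite h0// mulr0.
    by apply/funext => n; apply/funext => x; rewrite mulrCA.
  apply: (eq_rect _ _ (PowersAdd sg sh)); apply/funext => n; apply/funext => x.
  by rewrite mulrDr.
- move=> j; elim: sg => {g} [k m C a h aC rh h0|g h _ [dg [sg gd]] _ [dh [sh hd]]].
    have [dh [rdh hd]] := rapid1_derive j rh.
    have dh0 x : ~ K x -> dh x = 0.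
      by move=> Kx; exact: cderive_unique (hd x) (cderive_outside _ h0 Kx).
    have rqh : rapid1 (fun x => q j x * h x) by exact: rapid_polynomial.
    exists (fun n x => a n * c n k * G n k.+1 x * (q j x * h x) + a n * G n k x * dh x).
    split.
      apply: PowersAdd; last exact: PowersBase aC rdh dh0.
      (* n + k <= (k+1)(n+1), which raises the degree in n by one and multiplies the constant by k +
         1. *)
      apply: (@PowersBase _ m.+1 (C * k.+1%:R)) => // [n|x Kx]; last by rewrite h0// mulr0.
      rewrite modulusM exprSr mulrACA ler_pM ?modulus_ge0//.
      apply: le_trans (cle n k) _; rewrite -natrM ler_nat mulSn mulnS.
      by rewrite addnA (leq_trans _ (leq_addr _ _))// leq_add2r.
    move=> n x; case: (pselect (K x)) => Kx.
      apply: cderive_eq (cderiveM (cderiveZ (a n) (Gd n k j Kx)) (hd x)) _.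
      by congr (_ + _); rewrite !mulrA.
    rewrite h0// dh0// !mulr0 addr0; apply: cderive_outside Kx => y Ky.
    by rewrite h0// mulr0.
  exists (fun n x => dg n x + dh n x); split; first exact: PowersAdd.
  by move=> n x; exact: cderiveD.
Qed.

Lemma rapid_powers h : rapid1 h -> (forall x, ~ K x -> h x = 0) ->
  rapid (fun n => r2 ^+ n) (fun n x => G n 0 x * h x).
Proof.
move=> rh h0; have := @PowersBase 0 0 1 (fun _ => 1) h _ rh h0.
move=> /(_ _)/rapid_powers_span H; apply: rapid_ext (H _) => [n x|n].
  by rewrite mul1r.
by rewrite modulus1 mulr1.
Qed.

End rapid_powers.

Section powers_of_polynomials.
Context (R : realType) (d : nat).
Local Notation e_ := (delta_mx ord0).
Variables (K : set 'rV[R]_d) (Q : 'rV[R]_d -> 'C[R]).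
Hypotheses (clK : closed K) (pQ : polynomial_fun Q).

Lemma cderiveX (f : 'rV[R]_d -> 'C[R]) x v a n : cderive f x v a ->
  cderive (fun y => f y ^+ n) x v (n%:R * f x ^+ n.-1 * a).
Proof.
move=> fa; elim: n => [|n ih].
  by apply: cderive_eq (cderive_cst 1 x v) _; rewrite !mul0r.
rewrite (_ : (fun _ => _) = fun y => f y * f y ^+ n); last first.
  by apply/funext => y; rewrite exprS.
apply: cderive_eq (cderiveM fa ih) _ => /=.
case: n {ih} => [|n]; first by rewrite expr0 !mul0r mulr0 addr0 mulr1 !mul1r.
rewrite !mulrA [f x * _]mulrC -[_ * f x * _]mulrA -exprS /=.
rewrite [a * _]mulrC -[in RHS]natr1 mulrDl mulrDl mul1r addrC.
by [].
Qed.

Lemma polynomial_gradient : exists q, (forall j, polynomial_fun (q j)) /\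
  forall j x, cderive Q x (e_ j) (q j x).
Proof.
have /choice[q qP] : forall j, exists dp, polynomial_fun dp /\
    forall x, cderive Q x (e_ j) (dp x).
  by move=> j; exact: polynomial_fun_derive.
by exists q; split => j; have [] := qP j.
Qed.

(** In [Q ^ (n - k)] the subtraction is truncated: for n <= k the power is constant and its
    coefficient n - k is 0, so the derivative rule persists. The base 1 + 1/r1 of [B] exceeds 1/r1,
    which turns r1^(n-k) into r1^n, and exceeds 1, which covers n < k. *)
Lemma rapid_powers_bounded (r1 r2 : R) h : 0 < r1 -> r1 < r2 ->
  (forall x, K x -> modulus (Q x) <= r1) ->
  rapid1 h -> (forall x, ~ K x -> h x = 0) ->
  rapid (fun n => r2 ^+ n) (fun n x => Q x ^+ n * h x).
Proof.
move=> r10 r12 Qr rh h0; have [q [pq qd]] := polynomial_gradient.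
have := @rapid_powers R d K (fun n k x => Q x ^+ (n - k)) (fun n k => (n - k)%:R) q
  (fun k => (1 + r1^-1) ^+ k) r1 r2 clK r10 r12 _ pq _ _ _ h rh h0.
move=> H; apply: rapid_ext (H _ _ _ _) => {H} [n x|n k|n k j x Kx|n k x Kx|n k x Kx].
- by rewrite subn0.
- rewrite (_ : (n - k)%:R = (n - k)%:R%:C%C :> 'C[R]); last by rewrite rmorph_nat.
  by rewrite modulus_real ger0_norm ?ler0n// ler_nat (leq_trans (leq_subr _ _))// leq_addr.
- by rewrite subnS; apply: cderiveX.
- rewrite modulusX; apply: (@le_trans _ _ (r1 ^+ (n - k))).
    by rewrite lerXn2r ?nnegrE ?modulus_ge0 ?(ltW r10)// Qr.
  have r11 : 1 <= 1 + r1^-1 by rewrite lerDl invr_ge0 ltW.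
  have rr : r1^-1 <= 1 + r1^-1 by rewrite lerDr.
  have r1V : 0 <= r1^-1 by rewrite invr_ge0 ltW.
  case: (leqP k n) => kn.
    rewrite -{2}(subnKC kn) exprD mulrA -[leLHS]mul1r ler_wpM2r ?exprn_ge0 ?(ltW r10)//.
    rewrite -exprMn exprn_ege1//.
    by rewrite mulrDl mul1r mulVf ?gt_eqF// lerDr ltW.
  (* Here the exponent is truncated to 0: 1 <= (r1 + 1)^n = (1 + 1/r1)^n r1^n, and n < k. *)
  rewrite (eqP (ltnW kn : (n - k == 0)%N)) expr0.
  apply: (@le_trans _ _ ((1 + r1^-1) ^+ n * r1 ^+ n)).
    rewrite -exprMn exprn_ege1//.
    by rewrite mulrDl mul1r mulVf ?gt_eqF// lerDr ltW.
  by rewrite ler_wpM2r ?exprn_ge0 ?(ltW r10)// ler_weXn2l// ltnW.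
- exact: polynomial_fun_continuous (polynomial_fun_exp (n - k) pQ) x.
Qed.

(** With G n k the power -(n + k) of Q, a derivative costs the factor -(n + k) and one more inverse
    power, each at most r1 on K. *)
Lemma rapid_powers_inv (r1 r2 : R) h : 0 < r1 -> r1 < r2 ->
  (forall x, K x -> r1^-1 <= modulus (Q x)) ->
  rapid1 h -> (forall x, ~ K x -> h x = 0) ->
  rapid (fun n => r2 ^+ n) (fun n x => (Q x)^-1 ^+ n * h x).
Proof.
move=> r10 r12 Qr rh h0; have [q [pq qd]] := polynomial_gradient.
have Q0 x : K x -> Q x != 0.
  by move=> /Qr Qx; rewrite -modulus_gt0 (lt_le_trans _ Qx)// invr_gt0.
have := @rapid_powers R d K (fun n k x => (Q x)^-1 ^+ (n + k)) (fun n k => - (n + k)%:R) q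
  (fun k => r1 ^+ k) r1 r2 clK r10 r12 _ pq _ _ _ h rh h0.
move=> H; apply: rapid_ext (H _ _ _ _) => {H} [n x|n k|n k j x Kx|n k x Kx|n k x Kx].
- by rewrite addn0.
- rewrite modulusN (_ : (n + k)%:R = (n + k)%:R%:C%C :> 'C[R]); last by rewrite rmorph_nat.
  by rewrite modulus_real ger0_norm ?ler0n.
- apply: cderive_eq (cderiveX (n + k) (cderiveV (Q0 x Kx) (qd j x))) _.
  case: (n + k)%N (addnS n k) => [|m] ->; first by rewrite oppr0 !mul0r.
  rewrite succnK (_ : (Q x)^-1 ^+ m.+2 = (Q x)^-1 ^+ m * (Q x)^-1 ^+ 2); last first.
    by rewrite -exprD addn2.
  rewrite -exprVn; move: (_ ^+ m) (_ ^+ 2) (q j x) (m.+1%:R) => a b q0 n0.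
  by rewrite !mulNr mulrN -!mulrA [q0 * b]mulrC.
- rewrite modulusX modulusV -exprD addnC lerXn2r ?nnegrE ?invr_ge0 ?modulus_ge0 ?(ltW r10)//.
  by rewrite -[leRHS]invrK lef_pV2 ?posrE ?invr_gt0 ?modulus_gt0 ?Q0// Qr.
- have cV : (Q y)^-1 @[y --> x] --> (Q x)^-1.
    apply: (@cvgV _ _ _ (nbhs_filter x)); [exact: Q0|exact: polynomial_fun_continuous pQ x].
  elim: (n + k)%N => [|m ih].
    by rewrite expr0; exact: (@cvg_cst _ _ _ _ (nbhs_filter x)).
  have -> : (Q x)^-1 ^+ m.+1 = (Q x)^-1 * (Q x)^-1 ^+ m by rewrite exprS.
  rewrite (_ : (fun _ => _) = fun y => (Q y)^-1 * (Q y)^-1 ^+ m); last first.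
    by apply/funext => y; rewrite exprS.
  exact: (@ccvgM _ _ _ (nbhs_filter x) _ _ _ _ cV ih).
Qed.

(** The member n = 1 of the family of inverse powers. *)
Lemma rapid1_div (r : R) h : 0 < r -> (forall x, K x -> r <= modulus (Q x)) ->
  rapid1 h -> (forall x, ~ K x -> h x = 0) -> rapid1 (fun x => (Q x)^-1 * h x).
Proof.
move=> r0 Qr rh h0.
have rV : 0 < r^-1 by rewrite invr_gt0.
have r2 : r^-1 < 2 * r^-1 by rewrite mulr_natl mulr2n ltrDl.
have Qr' x : K x -> r^-1^-1 <= modulus (Q x) by rewrite invrK; exact: Qr.
exact: (rapid_member 1%N (rapid_powers_inv rV r2 Qr' rh h0)).
Qed.

End powers_of_polynomials.

(** * Test functions on the Fourier side *)

Section test_functions.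
Context (R : realType) (d : nat).
Local Notation leb := (lebesgue_rV R d).
Local Notation e_ := (delta_mx ord0).

Lemma rapid1_partial (f : 'rV[R]_d -> 'C[R]) j : rapid1 f ->
  rapid1 (partial j f) /\ forall x, cderive f x (e_ j) (partial j f x).
Proof.
move=> rf; have [df [rdf fd]] := rapid1_derive j rf.
have -> : partial j f = df by apply/funext => x; exact: cderive_partial.
by split.
Qed.

Lemma rapid1_foldr (f : 'rV[R]_d -> 'C[R]) s : rapid1 f ->
  rapid1 (foldr (@partial R d) f s).
Proof. by move=> rf; elim: s => //= j s ih; have [] := rapid1_partial j ih. Qed.

Lemma ift_partial (f : 'rV[R]_d -> 'C[R]) j (l : 'rV[R]_d) : rapid1 f ->
  ift (partial j f) l = (Complex 0 (- l ord0 j) : 'C[R]) * ift f l.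
Proof.
move=> rf; have [rdf fd] := rapid1_partial j rf.
by rewrite !iftE (ft_partial (- l) rf rdf fd) mxE.
Qed.

Lemma rapid1_multi_partial (f : 'rV[R]_d -> 'C[R]) m : rapid1 f -> rapid1 (multi_partial m f).
Proof. by move=> rf; rewrite multi_partialE; exact: rapid1_foldr. Qed.

Lemma ift_multi_partial (f : 'rV[R]_d -> 'C[R]) m (l : 'rV[R]_d) : rapid1 f ->
  ift (multi_partial m f) l =
  (\prod_j (Complex 0 (- l ord0 j) : 'C[R]) ^+ mpoly.fun_of_multinom m j) * ift f l.
Proof.
move=> rf.
rewrite (_ : \prod_j _ = \prod_(j <- enum 'I_d)
    (Complex 0 (- l ord0 j) : 'C[R]) ^+ mpoly.fun_of_multinom m j); last by rewrite big_enum.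
have E n j g : rapid1 g -> rapid1 (iter n (@partial R d j) g) /\
    ift (iter n (@partial R d j) g) l = (Complex 0 (- l ord0 j) : 'C[R]) ^+ n * ift g l.
  move=> rg; elim: n => [|n [rn ih]]; first by rewrite mul1r.
  rewrite iterS; split; first by have [] := rapid1_partial j rn.
  by rewrite ift_partial// ih mulrA -exprS.
rewrite /multi_partial; elim: (enum 'I_d) => [|j r ih] /=; first by rewrite big_nil mul1r.
set g := foldr _ _ _ in ih *.
have rg : rapid1 g.
  rewrite /g; elim: {ih g} r => //= i r ih.
  by have [] := E (mpoly.fun_of_multinom m i) i _ ih.
have [_ ->] := E (mpoly.fun_of_multinom m j) j _ rg; rewrite ih mulrA.
by rewrite big_cons.
Qed.

Lemma compact_fun_bounded (K : set 'rV[R]_d) (f : 'rV[R]_d -> R) : compact K ->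
  continuous f -> exists M, forall x, K x -> `|f x| <= M.
Proof.
move=> cK cf.
have : compact (f @` K) by apply: continuous_compact => //; exact: continuous_subspaceT.
move=> /(@compact_bounded R R^o)[M [_ hM]].
exists (M + 1) => x Kx; apply: hM; first by rewrite ltrDl.
by exists x.
Qed.

Lemma partial_outside (K : set 'rV[R]_d) (f : 'rV[R]_d -> 'C[R]) j : closed K ->
  (forall x, ~ K x -> f x = 0) -> forall x, ~ K x -> partial j f x = 0.
Proof.
move=> cK f0 x Kx; apply: cderive_partial.
exact: cderive_outside Kx.
Qed.

(** Brings the transform rules to the test side of a distribution. All the functions concerned are
    continuous and vanish off a compact set, hence are bounded. *)
Lemma test_function_schwartz (f : 'rV[R]_d -> 'C[R]) : test_function f -> schwartz f.
Proof.
move=> [sf cf]; split => // a b; rewrite multi_partialE.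
set g := foldr _ _ _; pose K := support_of f.
have cg : continuous g := (sf _).1.
have clK : closed K by exact: closed_closure.
have g0 x : ~ K x -> g x = 0.
  rewrite /g; elim: (flatten _) x => [x|j r ih x] /=.
    by move=> Kx; apply: contrapT => /eqP fx; apply: Kx; exact: subset_closure.
  exact: partial_outside.
have cm : continuous (fun x : 'rV[R]_d => (monomial a x)%:C%C * g x : 'C[R]).
  apply: ccontinuousM cg.
  have pm : polynomial_fun (fun x : 'rV[R]_d => (monomial a x)%:C%C : 'C[R]).
    rewrite (_ : (fun _ => _) = fun x : 'rV[R]_d => \prod_j
        ((x ord0 j)%:C%C : 'C[R]) ^+ mpoly.fun_of_multinom a j).
      apply: polynomial_fun_prod => j; apply: polynomial_fun_exp; exact: PolyCoord.
    apply/funext => x; rewrite rmorph_prod; apply: eq_bigr => j _.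
    exact: rmorphXn.
  exact: polynomial_fun_continuous pm.
have [M1 h1] := compact_fun_bounded cf (continuous_Re cm).
have [M2 h2] := compact_fun_bounded cf (continuous_Im cm).
exists (Num.max 0 (M1 + M2)) => x; rewrite -modulus_real -modulusM.
case: (pselect (K x)) => Kx; last by rewrite g0// mulr0 modulus0 le_max lexx.
rewrite le_max; apply/orP; right; apply: le_trans (modulus_le _) _.
by rewrite lerD ?h1 ?h2.
Qed.

Lemma ift_exchange (g h : 'rV[R]_d -> 'C[R]) : cintegrable leb g -> cintegrable leb h ->
  cintegral leb (fun x => ift h x * g x) = cintegral leb (fun l => h l * ift g l).
Proof.
move=> Ig Ih.
have mk : cmeasurable (fun z : 'rV[R]_d * 'rV[R]_d => expi (dot z.2 z.1)).
  apply: cmeasurable_expi; exact: measurable_dot measurable_snd measurable_fst.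
have H := cintegral_exchange Ig Ih mk (M := 1).
rewrite (_ : cintegral leb (fun x => ift h x * g x) = cintegral leb
    (fun x => g x * cintegral leb (fun l => h l * expi (dot (x, l).2 (x, l).1)))).
  rewrite H; last by move=> z; rewrite modulus_expi.
  apply: eq_cintegral => l; congr (_ * _); apply: eq_cintegral => x.
  by rewrite dotC.
by apply: eq_cintegral => x; rewrite mulrC.
Qed.

End test_functions.

(** * The inverse transform into L^1 *)

Section inverse_transform.
Context (R : realType) (d : nat).
Local Notation leb := (lebesgue_rV R d).

Let c0 : 'C[R] := ((2 * pi) ^+ d)%:C%C.

Definition inv_ft (h : 'rV[R]_d -> 'C[R]) : L1 leb := L1_of leb (fun x => c0^-1 * ift h x).

Lemma inv_ft_cintegrable h : rapid1 h -> cintegrable leb (fun x => c0^-1 * ift h x).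
Proof. by move=> rh; apply: cintegrableZ; exact: rapid1_ift_cintegrable. Qed.

Lemma inv_ftD g h : rapid1 g -> rapid1 h ->
  inv_ft (fun x => g x + h x) = inv_ft g + inv_ft h.
Proof.
move=> rg rh; rewrite /inv_ft -L1_ofD; [|exact: inv_ft_cintegrable..].
congr L1_of; apply/funext => x.
by rewrite iftD ?mulrDr//; exact: rapid1_cintegrable.
Qed.

Lemma inv_ftZ (a : 'C[R]) h : rapid1 h -> inv_ft (fun x => a * h x) = (a : R[i]) *: inv_ft h.
Proof.
move=> rh; rewrite /inv_ft -L1_ofZ; last exact: inv_ft_cintegrable.
congr L1_of; apply/funext => x.
by rewrite iftZ ?mulrA 1?[c0^-1 * a]mulrC//; exact: rapid1_cintegrable.
Qed.

Lemma inv_ft_regular h g : rapid1 h -> rapid1 g ->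
  cintegral leb (fun x => L1_fun (inv_ft h) x * g x) =
  c0^-1 * cintegral leb (fun l => h l * ift g l).
Proof.
move=> rh rg; have Ih := rapid1_cintegrable rh; have Ig := rapid1_cintegrable rg.
have mg : cmeasurable g by exact: cintegrable_measurable Ig.
have [C gC] := rapid_le rg.
have Iih := rapid1_ift_cintegrable rh.
have Ip : cintegrable leb (fun x => ift h x * g x).
  exact: (cintegrableM Iih mg (gC tt)).
have gC' x : modulus (g x) <= C * 1 by exact: gC tt x.
rewrite -ift_exchange// -cintegralZ//; apply: ae_eq_cintegral.
- exact: (cintegrableM (cintegrable_L1_fun _) mg gC').
- exact: cintegrableZ.
- apply: filterS (L1_of_ae (inv_ft_cintegrable rh)) => x ->.
  by rewrite mulrA.
Qed.

(** The pairing with [psi] moves to the Fourier side, where the derivatives of [psi] become factors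
    (-il)^m on [ift psi]; with the signs (-1)^|m| they assemble to [symbol P]. In particular inverse
    transforms lie in the domain. *)
Lemma weak_diffop_inv_ft P h : rapid1 h ->
  weak_diffop P (inv_ft h) (inv_ft (fun l => symbol P l * h l)).
Proof.
move=> rh psi /test_function_schwartz/schwartz_rapid1 rpsi.
have rPh : rapid1 (fun l => symbol P l * h l).
  exact: rapid_polynomial rh (polynomial_fun_symbol P).
rewrite /regular_distribution inv_ft_regular// /distribution_diffop.
pose t m (l : 'rV[R]_d) : 'C[R] := (mpoly.mcoeff m P : 'C[R]) *
  \prod_j (Complex 0 (l ord0 j) : 'C[R]) ^+ mpoly.fun_of_multinom m j.
have Ipsi := rapid1_cintegrable rpsi.
have It m : cintegrable leb (fun l => t m l * h l * ift psi l).
  have pt := PolyMul (PolyCst d (mpoly.mcoeff m P)) (polynomial_fun_prod (index_enum _)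
    (fun j => polynomial_fun_exp (mpoly.fun_of_multinom m j) (@polynomial_fun_imag R d j))).
  apply: (cintegrableM (rapid1_cintegrable (rapid_polynomial rh pt)) (cmeasurable_ift Ipsi)).
  by move=> l; exact: modulus_ift.
have E m : (mpoly.mcoeff m P : 'C[R]) * distribution_partial m
     (fun psi => cintegral leb (fun x => L1_fun (inv_ft h) x * psi x)) psi =
    c0^-1 * cintegral leb (fun l => t m l * h l * ift psi l).
  rewrite /distribution_partial inv_ft_regular//; last exact: rapid1_multi_partial.
  have rm := rapid1_multi_partial m rpsi.
  rewrite mulrA mulrCA; congr (_ * _); rewrite -cintegralZ; last first.
    apply: (cintegrableM (rapid1_cintegrable rh) (cmeasurable_ift (rapid1_cintegrable rm))).
    by move=> l; apply: modulus_ift; exact: rapid1_cintegrable.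
  apply: eq_cintegral => l; rewrite ift_multi_partial// /t.
  rewrite [h l * _]mulrCA !mulrA; congr (_ * _ * _); rewrite -!mulrA; congr (_ * _).
  rewrite mpoly.mdegE -prodrXr -big_split; apply: eq_bigr => j _ /=.
  rewrite -exprMn; congr (_ ^+ _).
  by rewrite mulN1r; apply: complexP => /=; rewrite ?oppr0 ?opprK.
rewrite (eq_bigr _ (fun m _ => E m)) -mulr_sumr -cintegral_sum//; congr (_ * _).
apply: eq_cintegral => l; rewrite /symbol mpoly.mevalE.
by rewrite -!mulr_suml.
Qed.

End inverse_transform.

Lemma nbhs_modulusP (R : realType) (z : 'C[R]) (A : set 'C[R]) :
  nbhs z A <-> exists2 e : R, 0 < e & forall w, modulus (w - z) < e -> A w.
Proof.
split=> [/nbhs_ballP[[e e'] /=]|[e e0 eA]].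
  rewrite ltcE/= => /andP[/eqP -> e0] eA; exists e => // w we.
  by apply: eA; rewrite -ball_normE/= -modulusE ltcR modulusB.
apply/nbhs_ballP; exists (e%:C%C) => /=; first by rewrite ltcR.
by move=> w; rewrite -ball_normE/= -modulusE ltcR modulusB => /eA.
Qed.

(** * Local spectrum and local spectral radius *)

Section local_spectrum.
Context (R : realType) (d : nat).
Local Notation leb := (lebesgue_rV R d).
Variables (P : mpoly.mpoly d R[i]) (h : 'rV[R]_d -> 'C[R]).
Hypothesis rh : rapid1 h.

Local Notation T := (diffop_L1 P).
Local Notation K := (support_of h).

Let clK : closed K. Proof. exact: closed_closure. Qed.

Let h0 x : ~ K x -> h x = 0.
Proof. by move=> Kx; apply: contrapT => /eqP hx; apply: Kx; exact: subset_closure. Qed.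

Let pP := @polynomial_fun_symbol R d P.

Lemma inv_ft_app g : rapid1 g ->
  op_dom T (inv_ft g) /\ op_app T (inv_ft g) = inv_ft (fun l => symbol P l * g l).
Proof. by move=> rg; apply: diffop_L1_app; exact: weak_diffop_inv_ft. Qed.

Lemma rapid_inv_ft I (b : I -> R) (g : I -> 'rV[R]_d -> 'C[R]) : rapid b g ->
  exists C, forall i, modulus (inv_ft (g i)) <= C * b i.
Proof.
move=> rg; pose c : 'C[R] := (((2 * pi) ^+ d)%:C%C : 'C[R])^-1.
have [C hC] := rapid_ift_L1 rg; exists (modulus c * C) => i.
have rgi := rapid_member i rg.
rewrite modulus_L1_of; last exact: inv_ft_cintegrable.
under eq_Rintegral do rewrite modulusM.
rewrite RintegralZl//; last exact: integrable_modulus (rapid1_ift_cintegrable rgi).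
by rewrite -mulrA ler_wpM2l ?modulus_ge0.
Qed.

Lemma polynomial_fun_symbolB (z : 'C[R]) : polynomial_fun (fun l : 'rV[R]_d => symbol P l - z).
Proof. exact: PolyAdd pP (PolyCst d (- z)). Qed.

Lemma op_pow_inv_ft n : op_dom (op_pow T n) (inv_ft h) /\
  op_app (op_pow T n) (inv_ft h) = inv_ft (fun l => symbol P l ^+ n * h l).
Proof.
elim: n => [|n [Dn En]].
  by split => //=; congr inv_ft; apply/funext => l; rewrite mul1r.
have [Da Ea] := inv_ft_app (rapid_polynomial rh (polynomial_fun_exp n pP)).
rewrite -En in Da Ea; split; first exact: (conj Dn Da).
transitivity (op_app T (op_app (op_pow T n) (inv_ft h))) => //.
by rewrite Ea; congr inv_ft; apply/funext => l; rewrite exprS mulrA.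
Qed.

Lemma ftL_op_pow n l : ftL (op_app (op_pow T n) (inv_ft h)) l =
  symbol P l ^+ n * ftL (inv_ft h) l.
Proof.
elim: n => [|n ih]; first by rewrite mul1r.
have [[_ Dn] _] := op_pow_inv_ft n.+1.
rewrite /ftL /= (ft_diffop_L1 Dn) exprS -mulrA; congr (_ * _).
exact: ih.
Qed.

Let S := closure [set symbol P l | l in K].

Lemma resolvent_gap (z : 'C[R]) : ~ S z ->
  exists2 r : R, 0 < r & forall l, K l -> r <= modulus (symbol P l - z).
Proof.
move=> Sz; have : nbhs z (~` S).
  by apply: open_nbhs_nbhs; split => //; exact/closed_openC/closed_closure.
move=> /nbhs_modulusP[r r0 rS]; exists r => // l Kl.
rewrite leNgt; apply/negP => /rS; apply; apply: subset_closure.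
by exists l.
Qed.

(** Off the support of [h] this is 0 whatever the inverse is; on the support, for z outside [S], the
    denominator is bounded away from 0 by [resolvent_gap]. *)
Definition resolvent_sol (z : 'C[R]) (l : 'rV[R]_d) : 'C[R] := (symbol P l - z)^-1 * h l.

Lemma rapid1_resolvent_sol z r : 0 < r ->
  (forall l, K l -> r <= modulus (symbol P l - z)) -> rapid1 (resolvent_sol z).
Proof.
move=> r0 rK; exact: (rapid1_div clK (polynomial_fun_symbolB z) r0 rK rh h0).
Qed.

Lemma resolvent_eq z : ~ S z -> op_dom T (inv_ft (resolvent_sol z)) /\
  op_app T (inv_ft (resolvent_sol z)) - (z : R[i]) *: inv_ft (resolvent_sol z) = inv_ft h.
Proof.
move=> /resolvent_gap[r r0 rK]; have rs := rapid1_resolvent_sol r0 rK.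
have [D ->] := inv_ft_app rs; split => //.
apply/eqP; rewrite subr_eq -inv_ftZ// -inv_ftD//; last exact: rapid1Z.
apply/eqP; congr inv_ft; apply/funext => l; rewrite /resolvent_sol.
case: (pselect (K l)) => Kl; last by rewrite h0// !mulr0 addr0.
have q0 : symbol P l - z != 0.
  by rewrite -modulus_gt0 (lt_le_trans r0)// rK.
rewrite -[X in _ = X + _](mul1r (h l)) -(divff q0) -mulrA -mulrDl.
by rewrite subrK.
Qed.

(** The expansion of 1/(p - z) in the terms (z - z1)^n (p - z1)^-(n+1) has the exact remainder (z -
    z1)^N (p - z1)^-N / (p - z); convergence is read off from the L^1 norm of its inverse
    transform. *)
Lemma resolvent_analytic z1 : ~ S z1 -> exists a : nat -> L1 leb,
  \forall z \near z1,
    [series ((z - z1) ^+ n : R[i]) *: a n]_n @ \oo --> inv_ft (resolvent_sol z).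
Proof.
move=> /resolvent_gap[r r0 rK].
pose Qi l : 'C[R] := (symbol P l - z1)^-1.
have Qi0 l : K l -> symbol P l - z1 != 0.
  by move=> Kl; rewrite -modulus_gt0 (lt_le_trans r0)// rK.
have rV : 0 < r^-1 by rewrite invr_gt0.
have r2 : r^-1 < 2 / r by rewrite mulr_natl mulr2n ltrDl.
have rK' l : K l -> r^-1^-1 <= modulus (symbol P l - z1) by rewrite invrK; exact: rK.
have rQ g : rapid1 g -> (forall l, ~ K l -> g l = 0) ->
    rapid (fun n => (2 / r) ^+ n) (fun n l => Qi l ^+ n * g l).
  exact: (rapid_powers_inv clK (polynomial_fun_symbolB z1) rV r2 rK').
exists (fun n => inv_ft (fun l => Qi l ^+ n.+1 * h l)).
(* For |z - z1| < r/4 the symbol keeps distance r/2 from z on the support, and |z - z1| times the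
   rate 2/r is below 1/2. The rate has to exceed 1/r. *)
apply/nbhs_modulusP; exists (r / 4) => [|z zr]; first by rewrite divr_gt0.
have zK l : K l -> r / 2 <= modulus (symbol P l - z).
  move=> Kl; have := rK _ Kl.
  rewrite (_ : symbol P l - z1 = (symbol P l - z) + (z - z1)); last by rewrite addrA subrK.
  move=> h1; have h2 := modulusD (symbol P l - z) (z - z1).
  have : r / 4 + r / 4 = r / 2 by field.
  by lra.
have rz : rapid1 (resolvent_sol z).
  by apply: (rapid1_resolvent_sol _ zK); rewrite divr_gt0.
have z0 l : ~ K l -> resolvent_sol z l = 0.
  by move=> Kl; rewrite /resolvent_sol h0// mulr0.
have rQz := rQ _ rz z0.
have rQh := rQ _ rh h0.
pose w : R[i] := z - z1.
have E N : inv_ft (resolvent_sol z) -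
    (\sum_(0 <= n < N) w ^+ n *: inv_ft (fun l => Qi l ^+ n.+1 * h l)) =
    w ^+ N *: inv_ft (fun l => Qi l ^+ N * resolvent_sol z l).
  elim: N => [|N ih].
    rewrite big_nil subr0 expr0 scale1r; congr inv_ft; apply/funext => l.
    by rewrite expr0 mul1r.
  rewrite big_nat_recr//= opprD addrA ih -scalerBr exprSr -scalerA; congr (_ *: _).
  apply/eqP; rewrite subr_eq -(@inv_ftZ _ _ (w : 'C[R])); last exact: rapid_member N.+1 rQz.
  rewrite -inv_ftD; last exact: rapid_member N.+1 rQh; last first.
    by apply: rapid1Z; exact: rapid_member N.+1 rQz.
  apply/eqP; congr inv_ft; apply/funext => l.
  case: (pselect (K l)) => Kl; last by rewrite z0// h0// !mulr0 addr0.
  have q0 : symbol P l - z != 0.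
    by rewrite -modulus_gt0 (lt_le_trans _ (zK l Kl))// divr_gt0.
  have -> : h l = (symbol P l - z) * resolvent_sol z l.
    by rewrite /resolvent_sol mulrA divff// mul1r.
  have E1 : Qi l * ((w : 'C[R]) + (symbol P l - z)) = 1.
    by rewrite addrC addrA subrK mulVf// Qi0.
  transitivity (Qi l ^+ N * (Qi l * ((w : 'C[R]) + (symbol P l - z))) * resolvent_sol z l).
    by rewrite E1 mulr1.
  rewrite exprSr mulrDr mulrDr mulrDl; move: (_ ^+ _) => A.
  congr (_ + _); last by rewrite !mulrA.
  by rewrite mulrA [A * _ * _]mulrC -!mulrA.
apply/cvg_modulusP.
have [C hC] := rapid_inv_ft rQz.
pose t := modulus (z - z1) * (2 / r).
have t0 : 0 <= t by rewrite mulr_ge0 ?modulus_ge0// divr_ge0 ?ltW.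
have t1 : `|t| < 1.
  rewrite ger0_norm// /t mulrA ltr_pdivrMr// mul1r.
  by have := modulus_ge0 (z - z1); lra.
have ct : (fun N => `|C| * t ^+ N) @ \oo --> (0 : R).
  rewrite -[X in _ --> X](mulr0 `|C|); apply: cvgMr.
  exact: cvg_expr.
apply: (@squeeze_cvgr _ _ _ _ (fun=> 0) (fun N => `|C| * t ^+ N)) => //; last exact: cvg_cst.
apply: nearW => N; rewrite modulus_ge0 /= E modulusZ modulusX.
apply: le_trans (ler_wpM2l _ (hC N)) _; first by rewrite exprn_ge0 ?modulus_ge0.
rewrite mulrCA -exprMn ler_wpM2r ?exprn_ge0//; exact: ler_norm.
Qed.

Lemma local_spectrum_inv_ft : (forall l, ftL (inv_ft h) l = h l) ->
  local_spectrum T (inv_ft h) = S.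
Proof.
move=> ftE; apply/seteqP; split=> z.
  move=> rz; apply: contrapT => Sz; apply: rz.
  exists (~` S), (fun z => inv_ft (resolvent_sol z)); split => //.
  - exact/closed_openC/closed_closure.
  - by move=> z1; exact: resolvent_analytic.
  - by move=> z1; exact: resolvent_eq.
move=> Sz [U [phi [oU Uz _ sol]]].
(* Both closures are undone: [U] meets the image of the support at p(l), and by continuity of p some
   x near l with [h x != 0] still has p(x) in [U]. At the parameter p(x) the left side of the
   transformed equation vanishes at x. *)
have [_ [[l Kl <-] Ul]] := Sz U (open_nbhs_nbhs (conj oU Uz)).
have : nbhs l (symbol P @^-1` U).
  exact: (polynomial_fun_continuous pP (open_nbhs_nbhs (conj oU Ul))).
move=> /Kl[x [/= hx Ux]].
have [Dx Ex] := sol _ Ux.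
have := resolvent_ft Dx Ex x; rewrite subrr mul0r ftE => h00.
by rewrite -h00 eqxx in hx.
Qed.

End local_spectrum.

(** * The local spectral radius formula *)

Section spectral_radius.
Context (R : realType) (d : nat).
Local Notation leb := (lebesgue_rV R d).

Lemma le_root_powR (a u : R) n : (0 < n)%N -> 0 <= a -> a ^+ n <= u ->
  a <= u `^ n%:R^-1.
Proof.
move=> n0 a0 au; have u0 : 0 <= u by apply: le_trans au; exact: exprn_ge0.
rewrite -(@ler_pXn2r _ n)// ?nnegrE ?powR_ge0//.
by rewrite -[leRHS]powR_mulrn ?powR_ge0// -powRrM mulVf ?pnatr_eq0 ?gtn_eqF// powRr1.
Qed.

Lemma root_powR_le (b u : R) n : (0 < n)%N -> 0 <= b -> 0 <= u -> u <= b ^+ n ->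
  u `^ n%:R^-1 <= b.
Proof.
move=> n0 b0 u0 ub; rewrite -(@ler_pXn2r _ n)// ?nnegrE ?powR_ge0//.
by rewrite -powR_mulrn ?powR_ge0// -powRrM mulVf ?pnatr_eq0 ?gtn_eqF// powRr1.
Qed.

Lemma near_geometric_le (q C : R) : 0 <= q -> q < 1 -> 0 < C ->
  \forall n \near \oo, q ^+ n <= C.
Proof.
move=> q0 q1 C0.
have : (fun n => q ^+ n) @ \oo --> (0 : R) by apply: cvg_expr; rewrite ger0_norm.
move=> /cvgrPdist_le/(_ _ C0); apply: filterS => n.
by rewrite sub0r normrN; apply: le_trans; exact: ler_norm.
Qed.

Variables (P : mpoly.mpoly d R[i]) (h : 'rV[R]_d -> 'C[R]).
Hypothesis rh : rapid1 h.
Hypothesis ftE : forall l, ftL (inv_ft h) l = h l.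

Local Notation T := (diffop_L1 P).
Local Notation K := (support_of h).
Local Notation S := (closure [set symbol P l | l in K]).

Let u n := modulus (op_app (op_pow T n) (inv_ft h)).
Let s := sup_nonneg [set (modulus z)%:E | z in S].

Lemma spectral_radius_lower (a : R) : (a%:E < s)%E ->
  \forall n \near \oo, a <= u n `^ n%:R^-1.
Proof.
move=> ays.
have [a0|a0] := ltP a 0.
  by apply: nearW => n; rewrite (le_trans (ltW a0))// powR_ge0.
(* |z| > a is an open condition, so it passes from a point of the closure to a value on the support,
   and from there to a point where [h] is non-zero. *)
have [l hl al] : exists2 l, h l != 0 & a < modulus (symbol P l).
  apply: contrapT => nl.
  have out (w : 'C[R]) : a < modulus w -> nbhs w [set v : 'C[R] | a < modulus v].
    move=> aw; apply/nbhs_modulusP; exists (modulus w - a) => [|v]; first by rewrite subr_gt0.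
    rewrite modulusB ltrBrDl -ltrBrDr => /lt_le_trans; apply.
    by have := modulusD v (w - v); rewrite addrC subrK -lerBlDr.
  have Sa : S `<=` [set z | modulus z <= a].
    move=> z Sz; rewrite /= leNgt; apply/negP => /out/Sz[_ [[l Kl <-] /out nl']].
    have /Kl[y [hy ay]] := polynomial_fun_continuous (polynomial_fun_symbol P) nl'.
    by apply: nl; exists y.
  have [y [->|[z Sz <-]]] := ereal_sup_gt ays.
    (* The 0 adjoined in [sup_nonneg] cannot exceed a >= 0. *)
    by rewrite lte_fin ltNge a0.
  by rewrite lte_fin ltNge Sa.
have p0 : 0 < modulus (symbol P l) by exact: le_lt_trans al.
have q1 : a / modulus (symbol P l) < 1 by rewrite ltr_pdivrMr// mul1r.
have q0 : 0 <= a / modulus (symbol P l) by rewrite divr_ge0// ltW.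
have hl0 : 0 < modulus (h l) by rewrite modulus_gt0.
have n0 : \forall n \near \oo, (0 < n)%N by exists 1%N.
(* Eventually (a / |p(l)|)^n <= |h(l)|, that is a^n <= |p(l)^n h(l)|, the modulus at l of the
   transform of the n-th iterate. *)
apply: filterS2 n0 (near_geometric_le q0 q1 hl0) => n n0 qn.
apply: le_root_powR => //.
apply: le_trans (ftL_le _ l).
rewrite (ftL_op_pow P rh) ftE modulusM modulusX mulrC -ler_pdivrMr ?exprn_gt0//.
by rewrite -expr_div_n.
Qed.

Lemma spectral_radius_upper (b : R) : (s < b%:E)%E ->
  \forall n \near \oo, u n `^ n%:R^-1 <= b.
Proof.
move=> sb.
have s0 : (0 <= s)%E by apply: ereal_sup_ubound; left.
have [x sx] : exists x, s = x%:E.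
  by case: s s0 sb => [x| |]// _ _; exists x.
have x0 : 0 <= x by rewrite -lee_fin -sx.
have xb : x < b by rewrite -lte_fin -sx.
have b0 : 0 < b by exact: le_lt_trans xb.
(* Two rates strictly between x and b: [r1] is positive even when x = 0, [r2] absorbs the growth
   from derivatives, and the gap from [r2] to b absorbs the constant in front. *)
pose r1 := (2 * x + b) / 3; pose r2 := (x + 2 * b) / 3.
have r10 : 0 < r1 by rewrite /r1; lra.
have r12 : r1 < r2 by rewrite /r1 /r2; lra.
have r2b : r2 < b by rewrite /r2; lra.
have r20 : 0 < r2 by exact: lt_trans r12.
have Pr l : K l -> modulus (symbol P l) <= r1.
  move=> Kl; apply: (@le_trans _ _ x); last by rewrite /r1; lra.
  rewrite -lee_fin -sx; apply: ereal_sup_ubound; right.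
  by exists (symbol P l) => //; apply: subset_closure; exists l.
have h0 l : ~ K l -> h l = 0.
  by move=> Kl; apply: contrapT => /eqP hl; apply: Kl; exact: subset_closure.
have [C hC] := rapid_inv_ft (rapid_powers_bounded (@closed_closure _ _)
  (polynomial_fun_symbol P) r10 r12 Pr rh h0).
have q0 : 0 <= r2 / b by rewrite divr_ge0// ltW.
have q1 : r2 / b < 1 by rewrite ltr_pdivrMr// mul1r.
have C0 : 0 < (`|C| + 1)^-1 by rewrite invr_gt0 ltr_pwDr.
have n0 : \forall n \near \oo, (0 < n)%N by exists 1%N.
apply: filterS2 n0 (near_geometric_le q0 q1 C0) => n n0 qn.
apply: root_powR_le => //; [exact: ltW|exact: modulus_ge0|].
rewrite /u (op_pow_inv_ft P rh n).2; apply: le_trans (hC n) _.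
apply: (@le_trans _ _ ((`|C| + 1) * r2 ^+ n)).
  by rewrite ler_wpM2r ?exprn_ge0 ?(ltW r20)// (le_trans (ler_norm C))// lerDl.
rewrite mulrC -ler_pdivlMr ?ltr_pwDr//.
by rewrite mulrC -ler_pdivrMr ?exprn_gt0// -expr_div_n.
Qed.

(** For s infinite, only the lower bound has content and gives divergence to infinity. *)
Lemma spectral_radius_cvg : (fun n => (u n `^ n%:R^-1)%:E) @ \oo --> s.
Proof.
have s0 : (0 <= s)%E by apply: ereal_sup_ubound; left.
have lo := spectral_radius_lower; have up := spectral_radius_upper.
case: s s0 lo up => [x _ lo up|_ lo _|//].
  apply: cvg_EFin; first exact: nearW.
  apply/cvgrPdist_le => e e0.
  have l1 : ((x - e)%:E < x%:E)%E by rewrite lte_fin ltrBlDr ltrDl.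
  have u1 : (x%:E < (x + e)%:E)%E by rewrite lte_fin ltrDl.
  apply: filterS2 (lo _ l1) (up _ u1) => n h1 h2 /=.
  by rewrite distrC ler_distl h1 h2.
by apply/cvgeyPge => a; have := lo a (ltry _); apply: filterS => n; rewrite lee_fin.
Qed.

End spectral_radius.

(** * Application to Schwartz functions *)

Section schwartz.
Context (R : realType) (d : nat).
Local Notation leb := (lebesgue_rV R d).

(** Presents [f] as the inverse transform of h = [ft f], the form in which the spectral statements
    are available. *)
Lemma inv_ft_ft (f : 'rV[R]_d -> 'C[R]) : rapid1 f -> inv_ft (ft f) = L1_of leb f.
Proof.
move=> rf; have rft : rapid1 (ft f) by exact: rapid_ft rf.
have If := rapid1_cintegrable rf; have Ift := rapid1_cintegrable rft.
apply: L1_of_eq => //; first exact: inv_ft_cintegrable.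
apply: filterS (ift_ft If Ift (rapid1_ift_cintegrable rft)) => x ->.
rewrite mulrA mulVf ?mul1r//.
rewrite -(rmorph0 (real_complex R)) (inj_eq (@complexI R)) expf_neq0//.
by rewrite mulf_neq0// gt_eqF// pi_gt0.
Qed.

Lemma support_fourier (f : 'rV[R]_d -> 'C[R]) : support_of (fourier f) = support_of (ft f).
Proof.
congr closure; apply/seteqP; split=> l /=; rewrite /fourier mulf_eq0 negb_or.
  by move=> /andP[].
move=> fl; apply/andP; split => //.
rewrite -(rmorph0 (real_complex R)) (inj_eq (@complexI R)) gt_eqF// powR_gt0//.
by rewrite mulr_gt0// pi_gt0.
Qed.

End schwartz.

(** The clauses on integrability and on the domains of all powers guarantee that neither the default
    value of [L1_of] nor values of [op_app] off the domain enter the formulas. *)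
Theorem corollary5p4 (R : realType) (d : nat) (P : mpoly.mpoly d R[i]) :
  SVEP (diffop_L1 P) /\
  forall f : 'rV[R]_d -> 'C[R], schwartz f ->
    let F := L1_of (lebesgue_rV R d) f in
    let T := diffop_L1 P in
    [/\ cintegrable (lebesgue_rV R d) f,
        op_dom T F,
        local_spectrum T F =
          closure [set symbol P l | l in support_of (fourier f)],
        (forall n, op_dom (op_pow T n) F) &
        (fun n => (modulus (op_app (op_pow T n) F) `^ n%:R^-1)%:E) @ \oo -->
          sup_nonneg [set (modulus z)%:E | z in local_spectrum T F]].
Proof.
split; first exact: SVEP_diffop_L1.
move=> f /schwartz_rapid1 rf F T.
have rft : rapid1 (ft f) by exact: rapid_ft rf.
have ftE l : ftL (inv_ft (ft f)) l = ft f l.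
  by rewrite inv_ft_ft// ftL_of//; exact: rapid1_cintegrable.
have FE : F = inv_ft (ft f) by rewrite inv_ft_ft.
have spec : local_spectrum T F = closure [set symbol P l | l in support_of (fourier f)].
  by rewrite FE support_fourier; exact: local_spectrum_inv_ft.
split => //.
- exact: rapid1_cintegrable.
- by rewrite FE; have [] := inv_ft_app P rft.
- by move=> n; rewrite FE; have [] := op_pow_inv_ft P rft n.
- by rewrite spec FE support_fourier; exact: spectral_radius_cvg.
Qed.
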